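(* Let $\beta\approx 8.13488$ be the real root of $x^3-18x^2+110x-242$ and let $\alpha\approx 1.83928$ be the real root of $x^3-x^2-x-1$. Let $H(n):=H\big(\mathrm{Res}(f_0+f_1x+f_2x^2+f_3x^3,\,g)\big)$, where $g=g_0+g_1x+\cdots+g_nx^n$ is a generic polynomial of degree $n$ (all $f_i,g_j$ are independent indeterminates). Then $$H(n)=\frac{\beta}{\pi n}\,\alpha^n-\mathcal{O}\!\left(\frac{\alpha^n}{n^2}\right),$$ where $\mathcal{O}$ is the two-sided notion given in the context; that is, the sequence $E(n)=\frac{\beta}{\pi n}\alpha^n-H(n)$ satisfies $E(n)=\mathcal{O}\big(\frac{\alpha^n}{n^2}\big)$.
   Context: For $f=f_0+\cdots+f_mx^m$ and $g=g_0+\cdots+g_nx^n$ with indeterminate coefficients, $\mathrm{Res}(f,g)$ is the Sylvester resultant: the determinant of the $(m+n)\times(m+n)$ matrix whose first $n$ columns are successive downward shifts of the coefficient vector of $f$ (for $1\le j\le n$, column $j$ has entry $f_i$ in row $i+j$, $0\le i\le m$, and zeros elsewhere) and whose last $m$ columns are successive downward shifts of the coefficient vector of $g$ (for $1\le j\le m$, column $n+j$ has entry $g_i$ in row $i+j$, $0\le i\le n$, and zeros elsewhere). It is a polynomial with integer coefficients in the variables $f_i,g_j$. The height of a polynomial $P=\sum_\alpha c_\alpha U^\alpha\in\mathbb{C}[U_1,\dots,U_p]$ is $H(P)=\max_\alpha|c_\alpha|$. Convention for $\mathcal{O}$ (non-standard, two-sided): for a positive sequence $a(n)$, a sequence $b(n)$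 satisfies $b(n)=\mathcal{O}(a(n))$ if there exist positive constants $c_1,c_2$ and $N$ such that $c_1a(n)\le b(n)\le c_2a(n)$ for all $n>N$. *)

(* Defs.v *)
From HB Require Import structures.
From mathcomp Require Import all_boot all_order all_algebra.
From mathcomp Require Import mpoly.

Set Implicit Arguments.
Unset Strict Implicit.
Unset Printing Implicit Defensive.

Import Order.TTheory GRing.Theory Num.Theory.
Local Open Scope ring_scope.

(* [f i] and [g j] are the coefficients of polynomials of formal degrees [m]
   and [n].  Rows and columns are numbered from 0, so column [c < n] has [f i]
   in row [i + c], and column [n + c] has [g j] in row [j + c]; each sum below
   has at most one term.  MathComp's [Sylvester_mx] is the transpose of this
   matrix, see [sylvester_res_resultant]. *)
Definition sylvester_cols (A : nzRingType) (m n : nat)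
    (f : 'I_m.+1 -> A) (g : 'I_n.+1 -> A) : 'M[A]_(n + m) :=
  \matrix_(r, c)
    match split c with
    | inl j => \sum_(i < m.+1 | r == (i + j)%N :> nat) f i
    | inr j => \sum_(i < n.+1 | r == (i + j)%N :> nat) g i
    end.

Definition sylvester_res (A : comNzRingType) (m n : nat)
    (f : 'I_m.+1 -> A) (g : 'I_n.+1 -> A) : A :=
  \det (sylvester_cols f g).

(* The indeterminates f_0, ..., f_m come first, followed by g_0, ..., g_n. *)
Definition generic_f (m n : nat) (i : 'I_m.+1) : {mpoly int[m.+1 + n.+1]} :=
  'X_(lshift n.+1 i).

Definition generic_g (m n : nat) (j : 'I_n.+1) : {mpoly int[m.+1 + n.+1]} :=
  'X_(rshift m.+1 j).

Definition generic_res (m n : nat) : {mpoly int[m.+1 + n.+1]} :=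
  sylvester_res (@generic_f m n) (@generic_g m n).

Definition height (K : numDomainType) (p : nat) (P : {mpoly K[p]}) : K :=
  \big[Num.max/0]_(a <- msupp P) `|P@_a|.

Definition cubic_res_height (n : nat) : int := height (generic_res 3 n).

(* A two-sided (Theta-like) notion, not the usual upper bound. *)
Definition two_sided_O (R : realDomainType) (b a : nat -> R) : Prop :=
  exists (c1 c2 : R) (N : nat),
    [/\ 0 < c1, 0 < c2, (0 < N)%N &
      forall n : nat, (N < n)%N -> c1 * a n <= b n <= c2 * a n].

Lemma sylvester_res_resultant (A : comNzRingType) (m n : nat)
    (f : 'I_m.+1 -> A) (g : 'I_n.+1 -> A) :
  f ord_max != 0 -> g ord_max != 0 ->
  sylvester_res f g =
  resultant (\poly_(i < m.+1) f (inord i)) (\poly_(i < n.+1) g (inord i)).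
Proof.
move=> fm gn.
have sz k (h : 'I_k.+1 -> A) : h ord_max != 0 ->
    size (\poly_(i < k.+1) h (inord i)) = k.+1.
  move=> hk; apply: size_poly_eq.
  by rewrite (_ : inord k = ord_max) //; apply/val_inj; rewrite /= inordK.
have cf k (h : 'I_k.+1 -> A) (r j : nat) :
    \sum_(i < k.+1 | r == (i + j)%N :> nat) h i =
    ((\poly_(i < k.+1) h (inord i)) * 'X^j)`_r.
  rewrite coefMXn coef_poly; case: ltnP => rj.
    by rewrite big1 // => i /eqP e; move: rj; rewrite e ltnNge leq_addl.
  case: ltnP => rk.
    rewrite (bigD1 (inord (r - j))) /=; last by rewrite inordK // subnK.
    rewrite big1 ?addr0 // => i /andP[/eqP e]; case/eqP; apply/val_inj.
    by rewrite /= inordK // e addnK.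
  rewrite big1 // => i /eqP e; move: rk; rewrite e addnK.
  by rewrite leqNgt ltn_ord.
rewrite /sylvester_res /resultant -det_tr.
set p := \poly_(i < m.+1) _; set q := \poly_(i < n.+1) _.
have : ((size p).-1 = m) by rewrite sz.
have : ((size q).-1 = n) by rewrite sz.
rewrite /Sylvester_mx.
move=> eq_ ep; move: (size p).-1 (size q).-1 ep eq_ => dp dq -> ->.
congr (\det _); apply/matrixP=> c r; rewrite !mxE.
by case: split => j; rewrite mxE /= rVpoly_delta mxE mulrC cf.
Qed.

(* Main.v *)
Require Import Defs.
From HB Require Import structures.
From mathcomp Require Import all_boot all_order all_algebra.
From mathcomp Require Import cyclic separable cyclotomic complex.
From mathcomp Require Import boolp classical_sets functions reals interval_inference.
From mathcomp Require normed_module.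
From mathcomp Require Import topology num_normedtype sequences derive realfun exp trigo.
From mathcomp Require Import ring lra zify.
From mathcomp Require Import mpoly.

Set Implicit Arguments.
Unset Strict Implicit.
Unset Printing Implicit Defensive.

Import Order.TTheory GRing.Theory Num.Theory.
Import normed_module.numFieldNormedType.Exports.
Local Open Scope ring_scope.

(** Up to sign and a power of f_3, the resultant is the determinant of the sum of the g_j f_3^(n-j)
    C^j, where C is f_3 times the companion matrix of f ([sylvester_res_companion]). So the
    coefficient of g_i g_j g_k is, up to a power of f_3, a polarized determinant of C^i, C^j, C^k.
    Factoring out a power of C, or multiplying by a power of its adjugate, reduces the exponents to
    (a, b, 0) with 2b <= a. There the value is 1, p_a or p_a p_b - p_(a+b), with p the power sums of
    the eigenvalues ([coef_le_generic]). The elementary symmetric functions of C and of its adjugate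
    are signed monomials in the f_i with independent exponents, so only the heights of the universal
    polynomials [power_poly a] and [mixed_poly a b] matter. Conversely p_n itself occurs, as the
    coefficient of g_n g_0^2.

    The coefficients of p_n are given by Girard-Waring: (n/N) N!/(a! b! c!) with N = a+b+c and n =
    a+2b+3c ([mcoeff_power]). The weights q_k = alpha^-k, k = 1, 2, 3, sum to 1, and the trinomials
    concentrate at the proportions q_1 : q_2 : q_3. Two-sided Stirling bounds give a maximum of peak
    * alpha^n / n * (1 - c/n) with c between positive constants, where peak = mu^2 alpha^3 / (2 pi)
    = beta / pi and mu is the mean of the law q. The correction has a definite sign because the
    Stirling errors contribute at most -(19/35)/N, while recentering the profile gains at most
    (3/7)/N ([power_coef_near]). Rounding the ideal profile gives the matching lower bound
    ([peak_profile]).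

    It remains to see that mixed sums lose by a constant factor theta < 1 ([mixed_poly_le]). For
    bounded j, concentration makes multiplication by the variable of weight k act on p_i like
    alpha^-k times a shift of the index by k. Hence the mixed sum is close to (t_j alpha^-j - 1)
    p_(i+j), where t_j is the sum of the j-th powers of the roots of the tribonacci cubic, and |t_j
    - alpha^j| < 1. For large j, coefficients are bounded by the maximum over the torus: the mixed
    sum is a sum of six terms x^i y^j, and |x|^2 |y| <= 0.98 alpha^2 for roots of a cubic with
    unimodular coefficients ([root_pair_bound]). This gains 0.98^j, and the missing factor 1/i comes
    from the recurrence in i ([mixed_poly_cubic]). *)

(** * Invariants of 3 by 3 matrices *)

Lemma det_mx33 (A : comNzRingType) (X : 'M[A]_3) :
  \det X = X 0 0 * (X 1 1 * X 2 2 - X 1 2 * X 2 1)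
         - X 0 1 * (X 1 0 * X 2 2 - X 1 2 * X 2 0)
         + X 0 2 * (X 1 0 * X 2 1 - X 1 1 * X 2 0).
Proof.
pose Y (i j : nat) := X (inord i) (inord j).
have XY i j : X i j = Y i j by rewrite /Y !inord_val.
rewrite (expand_det_row _ 0) !big_ord_recl big_ord0 /cofactor.
rewrite !(expand_det_row _ 0) !big_ord_recl !big_ord0 /cofactor !det_mx11 !mxE.
by rewrite !XY /= /bump /=; ring.
Qed.

Section CubicMatrix.
Variable A : comNzRingType.
Implicit Types X Y : 'M[A]_3.

(** The second elementary symmetric function of the eigenvalues. *)
Definition minor_sum X : A :=
  X 0 0 * X 1 1 - X 0 1 * X 1 0 + (X 0 0 * X 2 2 - X 0 2 * X 2 0)
  + (X 1 1 * X 2 2 - X 1 2 * X 2 1).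

Lemma matrix3P X Y : (forall i j : 'I_3, X i j = Y i j) -> X = Y.
Proof. by move=> h; apply/matrixP. Qed.

Lemma ord3_ind (P : 'I_3 -> Prop) : P 0 -> P 1 -> P 2 -> forall i, P i.
Proof.
move=> p0 p1 p2 [[|[|[|//]]] h].
- by rewrite (_ : Ordinal h = 0) //; apply/val_inj.
- by rewrite (_ : Ordinal h = 1) //; apply/val_inj.
- by rewrite (_ : Ordinal h = 2) //; apply/val_inj.
Qed.

Lemma big_ord3 (F : 'I_3 -> A) : \sum_i F i = F 0 + F 1 + F 2.
Proof.
rewrite !big_ord_recl big_ord0 addr0 addrA.
by congr (_ + F _ + F _); apply/val_inj.
Qed.

Lemma cubic_CH X :
  X ^+ 3 = \tr X *: X ^+ 2 - minor_sum X *: X + (\det X)%:M.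
Proof.
apply/matrixP => i j; rewrite !exprS expr0 mulr1.
rewrite det_mx33 /mxtrace big_ord3 /minor_sum.
by rewrite !mxE !big_ord3 !mxE !big_ord3; elim/ord3_ind: i; elim/ord3_ind: j => /=; ring.
Qed.

Lemma mxtrace_sqr3 X : \tr (X ^+ 2) = \tr X ^+ 2 - 2 * minor_sum X.
Proof. by rewrite /mxtrace !big_ord3 expr2 !mxE !big_ord3 /minor_sum; ring. Qed.
End CubicMatrix.

(** * Power sums and complete sums as solutions of a third-order recurrence *)

Section Recurrence.
Variable A : comNzRingType.
Implicit Types (e : 'I_3 -> A) (x y z : A).

Fixpoint cubic_rec e x y z n : A :=
  if n is m.+1 then cubic_rec e y z (e 0 * z + e 1 * y + e 2 * x) m else x.

Lemma cubic_recS e x y z n : cubic_rec e x y z n.+3 =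
  e 0 * cubic_rec e x y z n.+2 + e 1 * cubic_rec e x y z n.+1
  + e 2 * cubic_rec e x y z n.
Proof. by elim: n x y z => [|n IH] x y z //; exact: IH. Qed.

Lemma cubic_rec_uniq e (s : nat -> A) :
    (forall n, s n.+3 = e 0 * s n.+2 + e 1 * s n.+1 + e 2 * s n) ->
  forall n, s n = cubic_rec e (s 0%N) (s 1%N) (s 2%N) n.
Proof.
move=> h n; elim: n s h => [|n IH] s h //=.
by rewrite -h; apply: (IH (fun n => s n.+1)) => m; apply: h.
Qed.

(** Newton's initial values for the power sums of three roots whose elementary symmetric functions
    are [e 0], [- e 1] and [e 2]; the sign is absorbed so that the recurrence has only plus
    signs. *)
Definition power_sum e : nat -> A := cubic_rec e 3 (e 0) (e 0 ^+ 2 + 2 * e 1).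

(* Two leading zeros: [complete_sum e n.+2] is the complete homogeneous sum of degree n. *)
Definition complete_sum e : nat -> A := cubic_rec e 0 0 1.

(** Both sides solve the recurrence, so three initial values decide. This reduces the coefficients
    of power sums to those of complete sums, which are plain trinomials. *)
Lemma power_sum_complete e n : power_sum e n.+1 =
  e 0 * complete_sum e n.+2 + 2 * (e 1 * complete_sum e n.+1)
  + 3 * (e 2 * complete_sum e n).
Proof.
pose s n := e 0 * complete_sum e n.+2 + 2 * (e 1 * complete_sum e n.+1)
  + 3 * (e 2 * complete_sum e n).
have sS k : s k.+3 = e 0 * s k.+2 + e 1 * s k.+1 + e 2 * s k.
  by rewrite /s /complete_sum !(cubic_recS _ _ _ _ k.+2, cubic_recS _ _ _ _ k.+1, cubic_recS _ _ _ _ k); ring.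
rewrite -/(s n) (cubic_rec_uniq sS n) /power_sum /= /s /complete_sum /=.
by congr cubic_rec; ring.
Qed.

(** [complete_sum] is the impulse response of the recurrence. Applied to mixed sums in their first
    index, this later transfers the 1/k decay of complete sums to them. *)
Lemma cubic_rec_complete e (s : nat -> A) k :
    (forall n, s n.+3 = e 0 * s n.+2 + e 1 * s n.+1 + e 2 * s n) ->
  s k = s 0%N * complete_sum e k.+2 + (s 1%N - e 0 * s 0%N) * complete_sum e k.+1
        + (s 2%N - e 0 * s 1%N - e 1 * s 0%N) * complete_sum e k.
Proof.
move=> h; pose t k := s 0%N * complete_sum e k.+2
  + (s 1%N - e 0 * s 0%N) * complete_sum e k.+1
  + (s 2%N - e 0 * s 1%N - e 1 * s 0%N) * complete_sum e k.
have tS m : t m.+3 = e 0 * t m.+2 + e 1 * t m.+1 + e 2 * t m.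
  by rewrite /t /complete_sum !(cubic_recS _ _ _ _ m.+2, cubic_recS _ _ _ _ m.+1, cubic_recS _ _ _ _ m); ring.
rewrite -/(t k) (cubic_rec_uniq h) [RHS](cubic_rec_uniq tS).
by congr cubic_rec; rewrite /t /complete_sum /=; ring.
Qed.

(** In terms of the roots: the sum of x^i y^j over the ordered pairs of roots at distinct
    positions. *)
Definition mixed_sum e i j := power_sum e i * power_sum e j - power_sum e (i + j).

Lemma mixed_sumS e i j : mixed_sum e i.+3 j =
  e 0 * mixed_sum e i.+2 j + e 1 * mixed_sum e i.+1 j + e 2 * mixed_sum e i j.
Proof. by rewrite /mixed_sum /power_sum !addSn !cubic_recS; ring. Qed.

Definition cubic_coefs (X : 'M[A]_3) : 'I_3 -> A :=
  fun i => if i == 0 then \tr X else if i == 1 then - minor_sum X else \det X.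

Lemma mxtrace_exp3 (X : 'M[A]_3) n : \tr (X ^+ n) = power_sum (cubic_coefs X) n.
Proof.
rewrite (@cubic_rec_uniq (cubic_coefs X) (fun n => \tr (X ^+ n))) => [|k].
  by rewrite expr0 mxtrace1 expr1 mxtrace_sqr3 /power_sum /cubic_coefs /= mulrN.
rewrite -(addn3 k) exprD cubic_CH mulrDr mulrBr -scalerAr -scalerAr -exprD addn2.
rewrite -exprSr (_ : X ^+ k * _ = \det X *: X ^+ k); last exact: mul_mx_scalar.
by rewrite mxtraceD raddfB /= !mxtraceZ /cubic_coefs /= mulNr.
Qed.
End Recurrence.

Lemma rmorph_cubic_rec (A B : comNzRingType) (f : {rmorphism A -> B}) e x y z n :
  f (cubic_rec e x y z n) = cubic_rec (f \o e) (f x) (f y) (f z) n.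
Proof. by elim: n x y z => [|n IH] x y z //=; rewrite IH !rmorphD !rmorphM. Qed.

Lemma rmorph_power_sum (A B : comNzRingType) (f : {rmorphism A -> B}) e n :
  f (power_sum e n) = power_sum (f \o e) n.
Proof. by rewrite rmorph_cubic_rec /= rmorph_nat rmorphD rmorphXn rmorphM rmorph_nat. Qed.

Lemma rmorph_mixed_sum (A B : comNzRingType) (f : {rmorphism A -> B}) e i j :
  f (mixed_sum e i j) = mixed_sum (f \o e) i j.
Proof. by rewrite rmorphB rmorphM !rmorph_power_sum. Qed.

(** * Polarization of the 3 by 3 determinant *)

Section Polarization.
Variable A : comNzRingType.
Implicit Types X Y Z : 'M[A]_3.

Definition mixed_det (X : 'I_3 -> 'M[A]_3) : A := \det (\matrix_(i, j) X j i j).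
Definition tri {T} (x y z : T) : 'I_3 -> T :=
  fun i => if i == 0 then x else if i == 1 then y else z.

Lemma mixed_det_mul X (Y : 'I_3 -> 'M[A]_3) :
  mixed_det (fun i => X *m Y i) = \det X * mixed_det Y.
Proof.
rewrite /mixed_det -det_mulmx; congr (\det _).
by apply/matrixP => i j; rewrite !mxE; apply: eq_bigr => k _; rewrite !mxE.
Qed.

Lemma mixed_det_scale (a : 'I_3 -> A) (Y : 'I_3 -> 'M[A]_3) :
  mixed_det (fun i => a i *: Y i) = a 0 * a 1 * a 2 * mixed_det Y.
Proof. by rewrite /mixed_det !det_mx33 !mxE; ring. Qed.

(** The left side is the coefficient of u v w in det(u + v X + w Y); for commuting diagonal matrices
    it is visibly the mixed sum over distinct positions. *)
Lemma polarized_det3 X Y :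
  mixed_det (tri 1%:M X Y) + mixed_det (tri 1%:M Y X) + mixed_det (tri X 1%:M Y)
  + mixed_det (tri Y 1%:M X) + mixed_det (tri X Y 1%:M) + mixed_det (tri Y X 1%:M)
  = \tr X * \tr Y - \tr (X *m Y).
Proof.
rewrite /mixed_det !det_mx33 /mxtrace !big_ord3 !mxE !big_ord3 /tri /= ?mxE /=.
ring.
Qed.

Lemma polarized_det1 X :
  mixed_det (tri 1%:M 1%:M X) + mixed_det (tri 1%:M X 1%:M) + mixed_det (tri X 1%:M 1%:M)
  = \tr X.
Proof. by rewrite /mixed_det !det_mx33 /mxtrace !big_ord3 !mxE /tri /= ?mxE /=; ring. Qed.
End Polarization.

(** * The resultant with a cubic as a companion determinant *)

Section Sylvester.
Variables (A : idomainType) (n : nat) (f : 'I_4 -> A) (g : 'I_n.+1 -> A).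

(** [f 3] times the companion matrix of the monic normalization of f, which avoids fractions. *)
Definition companion3 : 'M[A]_3 :=
  \matrix_(i, j) if j == 2 then - f (widen_ord (leqnSn 3) i)
                 else f 3 *+ (i == j.+1 :> nat).

Lemma companion3_tr : \tr companion3 = - f 2.
Proof.
rewrite /mxtrace big_ord3 !mxE /= !mulr0n !add0r; congr (- f _).
exact/val_inj.
Qed.

Lemma companion3_minors : minor_sum companion3 = f 3 * f 1.
Proof.
rewrite /minor_sum !mxE /= !mulr0n !mulr1n.
have -> : widen_ord (leqnSn 3) 1 = 1 by apply/val_inj.
ring.
Qed.

Lemma companion3_det : \det companion3 = - (f 0 * f 3 ^+ 2).
Proof.
rewrite det_mx33 !mxE /= !mulr0n !mulr1n.
have -> : widen_ord (leqnSn 3) 0 = 0 by apply/val_inj.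
ring.
Qed.

Lemma big_ord4 (F : 'I_4 -> 'cV[A]_3) : \sum_i F i = F 0 + F 1 + F 2 + F 3.
Proof.
rewrite !big_ord_recl big_ord0 addr0 !addrA.
by congr (_ + F _ + F _ + F _); apply/val_inj.
Qed.

Let C := companion3.
Let e0 : 'cV[A]_3 := delta_mx 0 0.

Lemma companion3_root :
  \sum_(k < 4) (f k * f 3 ^+ (3 - k)) *: (C ^+ k *m e0) = 0.
Proof.
rewrite big_ord4 /= cubic_CH companion3_tr companion3_minors companion3_det.
rewrite subnn subn0 !expr1 expr0 mulr1 mul1mx !mulmxDl mulNmx -!scalemxAl mul_scalar_mx.
move: (C ^+ 2 *m e0) (C *m e0) => x y.
apply/colP => i; rewrite !mxE; ring.
Qed.

Let N := n.+2.
(** Applied to the coefficient vector of a polynomial h, [V] gives f_3^N h(C / f_3) e0 without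
    denominators. [T] completes it to a square matrix by selecting the last n rows, and [Z] is a
    permutation matrix that makes the product with this completion block triangular. *)
Let V : 'M[A]_(3, n + 3) :=
  \matrix_(i, r) (f 3 ^+ (N - r) * (C ^+ r *m e0) i 0).
Let T : 'M[A]_(n, n + 3) := \matrix_(i, r) (r == (i + 3)%N :> nat)%:R.
Let F' : 'M[A]_(n + 3, n) :=
  \matrix_(r, j) \sum_(i < 4 | r == (i + j)%N :> nat) f i.
Let G' : 'M[A]_(n + 3, 3) :=
  \matrix_(r, j) \sum_(i < n.+1 | r == (i + j)%N :> nat) g i.
Let Z : 'M[A]_(n + 3) :=
  row_mx (\matrix_(r, j) (r == (j + 3)%N :> nat)%:R) (\matrix_(r, j) (r == j :> nat)%:R).

Lemma sylvester_colsE : sylvester_cols f g = row_mx F' G'.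
Proof. by apply/matrixP => r c; rewrite !mxE; case: fintype.split => j; rewrite mxE. Qed.

Lemma sum_shift m p (h : 'I_m.+1 -> A) (a : nat -> A) (j : nat) : (m + j < p)%N ->
  \sum_(r < p) a r * (\sum_(i < m.+1 | r == (i + j)%N :> nat) h i)
  = \sum_(i < m.+1) h i * a (i + j)%N.
Proof.
move=> mjp; under eq_bigr do rewrite big_distrr /= big_mkcond /=.
rewrite exchange_big /=; apply: eq_bigr => i _.
have ip : (i + j < p)%N by apply: leq_ltn_trans mjp; rewrite leq_add2r -ltnS.
rewrite (bigD1 (Ordinal ip)) //= eqxx big1 ?addr0 1?mulrC // => r.
by rewrite -val_eqE /= => /negbTE ->.
Qed.

Lemma V_F' : V *m F' = 0.
Proof.
apply/matrixP => i j; rewrite mxE [RHS]mxE.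
under eq_bigr do rewrite [V _ _]mxE [F' _ _]mxE.
have jn := ltn_ord j.
have jb : (3 + j < n + 3)%N by lia.
rewrite [LHS](sum_shift f (fun r => f 3 ^+ (N - r) * (C ^+ r *m e0) i 0) jb).
transitivity ((f 3 ^+ (n.-1 - j) *: (C ^+ j *m
    \sum_(k < 4) (f k * f 3 ^+ (3 - k)) *: (C ^+ k *m e0))) i 0); last first.
  by rewrite companion3_root mulmx0 scaler0 mxE.
rewrite mulmx_sumr scaler_sumr summxE; apply: eq_bigr => k _.
rewrite -scalemxAr scalerA [RHS]mxE mulmxA.
rewrite (_ : C ^+ j *m C ^+ k = C ^+ (k + j)); last by rewrite addnC exprD.
rewrite mulrA; congr (_ * _); rewrite mulrCA -exprD; congr (_ * _ ^+ _).
have := ltn_ord k; rewrite /N; lia.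
Qed.

(** This is f_3^n g(C / f_3), whose determinant is the product of the values of g at the roots of f,
    up to a power of f_3. *)
Definition eval_companion := \sum_(j < n.+1) (g j * f 3 ^+ (n - j)) *: C ^+ j.

Lemma companion3_exp_e0 (l : 'I_3) : C ^+ l *m e0 = f 3 ^+ l *: delta_mx l 0.
Proof.
have C0 : C *m e0 = f 3 *: delta_mx 1 0.
  apply/colP => i; rewrite !mxE big_ord3 !mxE /= !mulr0 !addr0 !mulr1.
  by elim/ord3_ind: i; rewrite /= ?mulr0 ?mulr1.
have C1 : C *m delta_mx 1 0 = f 3 *: (delta_mx 2 0 : 'cV_3).
  apply/colP => i; rewrite !mxE big_ord3 !mxE /= !mulr0 !addr0 !add0r !mulr1.
  by elim/ord3_ind: i; rewrite /= ?mulr0 ?mulr1.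
elim/ord3_ind: l => /=; first by rewrite !expr0 mul1mx scale1r.
  by rewrite !expr1.
by rewrite exprS -mulmxA expr1 C0 -scalemxAr C1 scalerA.
Qed.

Lemma V_G' : V *m G' = f 3 ^+ 2 *: eval_companion.
Proof.
apply/matrixP => i l; rewrite mxE [RHS]mxE.
under eq_bigr do rewrite [V _ _]mxE [G' _ _]mxE.
have l3 := ltn_ord l.
have jb : (n + l < n + 3)%N by lia.
rewrite [LHS](sum_shift g (fun r => f 3 ^+ (N - r) * (C ^+ r *m e0) i 0) jb).
rewrite /eval_companion summxE big_distrr /=; apply: eq_bigr => k _.
rewrite exprD -mulmxE -mulmxA companion3_exp_e0 -scalemxAr [in LHS]mxE.
rewrite (_ : (C ^+ k *m delta_mx l 0) i 0 = (C ^+ k) i l); last first.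
  rewrite mxE (bigD1 l) //= big1 ?addr0 ?mxE ?eqxx ?mulr1 // => r rl.
  by rewrite mxE (negbTE rl) mulr0.
rewrite [in RHS]mxE.
have kn := ltn_ord k.
have -> : (N - (k + l) = (2 - l) + (n - k))%N by rewrite /N; lia.
have -> : f 3 ^+ 2 = f 3 ^+ (2 - l) * f 3 ^+ l.
  by rewrite -exprD; congr (_ ^+ _); lia.
by rewrite exprD; ring.
Qed.

Lemma det_T_F' : \det (T *m F') = f 3 ^+ n.
Proof.
rewrite -det_tr det_trig.
  transitivity (\prod_(i < n) f 3); last by rewrite prodr_const card_ord.
  apply: eq_bigr => i _; rewrite !mxE.
  have i3 : (i + 3 < n + 3)%N by rewrite ltn_add2r.
  rewrite (bigD1 (Ordinal i3)) //= !mxE eqxx mul1r [X in _ + X]big1 ?addr0.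
    rewrite (bigD1 3); last exact/eqP/addnC.
    rewrite big1 => [|k /andP[/eqP e] /eqP[]]; first exact: addr0.
    apply/val_inj.
    by move: e => /=; rewrite addnC => /addIn <-.
  by move=> r; rewrite -val_eqE /= => /negbTE rn; rewrite !mxE rn ?mul0r ?mulr0.
apply/is_trig_mxP => i j ij; rewrite !mxE; apply: big1 => r _; rewrite !mxE.
case: eqP => [e|]; rewrite ?mul0r // big1 ?mulr0 // => k /eqP.
by have := ltn_ord k; lia.
Qed.

Lemma det_TV_Z : \det (col_mx T V) * \det Z = f 3 ^+ (3 * N).
Proof.
rewrite -det_mulmx /Z mul_col_row.
rewrite (_ : T *m \matrix_(_, _) _ = 1%:M); last first.
  apply/matrixP => i j; rewrite !mxE.
  have i3 : (i + 3 < n + 3)%N by rewrite ltn_add2r.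
  rewrite (bigD1 (Ordinal i3)) //= !mxE eqxx mul1r [X in _ + X]big1 ?addr0.
    by rewrite eqn_add2r.
  by move=> r; rewrite -val_eqE /= => /negbTE rn; rewrite !mxE rn ?mul0r ?mulr0.
rewrite (_ : T *m \matrix_(_, _) _ = 0); last first.
  apply/matrixP => i j; rewrite !mxE; apply: big1 => r _; rewrite !mxE.
  case: eqP => [->|]; rewrite ?mul0r //; case: eqP; rewrite ?mulr0 //.
  by have := ltn_ord j; lia.
rewrite det_lblock det1 mul1r (_ : V *m \matrix_(_, _) _ = (f 3 ^+ N)%:M).
  by rewrite det_scalar -exprM mulnC.
apply/matrixP => i j; rewrite mxE [RHS]mxE.
have j3 : (j < n + 3)%N by have := ltn_ord j; lia.
rewrite (bigD1 (Ordinal j3)) //= [V _ _]mxE [X in _ + X]big1 ?addr0.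
  rewrite companion3_exp_e0 !mxE !eqxx mulr1 andbT mulrA -exprD subnK.
    by rewrite mulr_natr.
  by have := ltn_ord j; rewrite /N /=; lia.
by move=> r; rewrite -val_eqE /= => /negbTE rn; rewrite !mxE rn ?mul0r ?mulr0.
Qed.

Lemma det_Z : \det Z = 1 \/ \det Z = -1.
Proof.
have : \det Z ^+ 2 = 1.
  rewrite expr2 -{1}(det_tr Z) -det_mulmx /Z tr_row_mx mul_col_row.
  rewrite (_ : block_mx _ _ _ _ = 1%:M) ?det1 // scalar_mx_block.
  congr block_mx; apply/matrixP => i j; rewrite !mxE.
  - have i3 : (i + 3 < n + 3)%N by rewrite ltn_add2r.
    rewrite (bigD1 (Ordinal i3)) //= !mxE eqxx mul1r [X in _ + X]big1 ?addr0.
      by rewrite eqn_add2r.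
    by move=> r; rewrite -val_eqE /= => /negbTE rn; rewrite !mxE rn ?mul0r ?mulr0.
  - apply: big1 => r _; rewrite !mxE; case: eqP => [->|]; rewrite ?mul0r //.
    by case: eqP; rewrite ?mulr0 //; have := ltn_ord j; lia.
  - apply: big1 => r _; rewrite !mxE; case: eqP => [->|]; rewrite ?mul0r //.
    by case: eqP; rewrite ?mulr0 //; have := ltn_ord i; lia.
  - have i3 : (i < n + 3)%N by have := ltn_ord i; lia.
    rewrite (bigD1 (Ordinal i3)) //= !mxE eqxx mul1r [X in _ + X]big1 ?addr0 //.
    by move=> r; rewrite -val_eqE /= => /negbTE rn; rewrite !mxE rn ?mul0r ?mulr0.
by move/eqP; rewrite sqrf_eq1 => /orP[] /eqP; [left|right].
Qed.

(** Multiplying the Sylvester matrix on the left by [T] over [V] gives a block upper triangular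
    matrix: [V] kills the shifts of f by Cayley-Hamilton, and it sends the three shifts of g to the
    columns of [eval_companion]. The powers of f_3 balance since 3 (n + 2) = (n + 6) + 2 n. *)
Lemma sylvester_res_companion : f 3 != 0 ->
  exists s : bool,
    f 3 ^+ (2 * n) * sylvester_res f g = (-1) ^+ s * \det eval_companion.
Proof.
move=> f3.
have h : \det (col_mx T V) * sylvester_res f g
         = f 3 ^+ (n + 6) * \det eval_companion.
  rewrite /sylvester_res sylvester_colsE -det_mulmx mul_col_row V_F' det_ublock.
  by rewrite det_T_F' V_G' detZ -exprM exprD mulrA.
have f0 : f 3 ^+ (n + 6) != 0 by rewrite expf_neq0.
have e : f 3 ^+ (3 * N) = f 3 ^+ (n + 6) * f 3 ^+ (2 * n).
  by rewrite -exprD; congr (_ ^+ _); rewrite /N; lia.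
have := det_TV_Z; rewrite e.
case: det_Z => -> tv; [exists false|exists true]; apply: (mulfI f0);
  rewrite mulrA -tv mulrAC h /=; ring.
Qed.
End Sylvester.

(** * Coefficient bounds, heights and substitution of signed monomials *)

Lemma mcoeffXM (R : comNzRingType) k (p : {mpoly R[k]}) (m m' : 'X_{1..k}) :
  ('X_[m] * p)@_m' = if (m <= m')%MM then p@_(m' - m) else 0.
Proof.
rewrite mulrC; case: ifPn => [mm'|]; first by rewrite -{1}(submK mm') addmC mcoeffMX.
apply: contraNeq; rewrite -mcoeff_msupp (perm_mem (msuppMX p m)).
by move=> /mapP[m0 _ ->]; rewrite lem_addr.
Qed.

Section CoefBound.
Variables (R : numDomainType) (k : nat).
Implicit Types (p q : {mpoly R[k]}) (K : R).

Definition coef_le K p := forall m, `|p@_m| <= K.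

Lemma coef_leXM K p m : 0 <= K -> coef_le K p -> coef_le K ('X_[m] * p).
Proof. by move=> K0 h m'; rewrite mcoeffXM; case: ifP; rewrite ?normr0. Qed.

Lemma coef_leXM_inv K p m : coef_le K ('X_[m] * p) -> coef_le K p.
Proof.
move=> h m'; have := h (m + m')%MM.
by rewrite mcoeffXM lem_addr addmC addmK.
Qed.

Lemma coef_leN K p : coef_le K (- p) -> coef_le K p.
Proof. by move=> h m; rewrite -normrN -mcoeffN. Qed.

Lemma coef_le_sign K p (s : nat) : coef_le K ((-1) ^+ s * p) <-> coef_le K p.
Proof.
rewrite -signr_odd; case: odd; rewrite ?mul1r // expr1 mulN1r; split.
  exact: coef_leN.
by move=> h; apply: coef_leN; rewrite opprK.
Qed.

Lemma coef_leW K K' p : K <= K' -> coef_le K p -> coef_le K' p.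
Proof. by move=> h pK m; apply: le_trans (pK m) h. Qed.
End CoefBound.

Section Height.
Variables (R : realDomainType) (k : nat).
Implicit Types (p : {mpoly R[k]}) (K : R).

Lemma height_le K p : 0 <= K -> coef_le K p -> height p <= K.
Proof. by move=> K0 h; rewrite /height; apply: bigmax_le. Qed.

Lemma coef_le_height p : coef_le (height p) p.
Proof.
move=> m; rewrite /height; case: (boolP (m \in msupp p)) => mp.
  exact: (@le_bigmax_seq _ _ _ _ 0 m xpredT (fun a => `|p@_a|) mp).
by rewrite memN_msupp_eq0 // normr0; apply: bigmax_ge_id.
Qed.
End Height.

(* Substitution of signed monomials for the three variables; on exponents it is
   the linear map [mon3 nu], and injectivity of that map prevents collisions. *)
Section SignedMonomials.
Variables (k : nat) (nu : 'I_3 -> 'X_{1..k}) (s : 'I_3 -> bool).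

Definition signed_mon (i : 'I_3) : {mpoly int[k]} := (-1) ^+ s i * 'X_[nu i].

Definition signed_subst : {mpoly int[3]} -> {mpoly int[k]} :=
  mmap (@mpolyC k int) signed_mon.

HB.instance Definition _ := GRing.RMorphism.on signed_subst.

Definition mon3 (m : 'X_{1..3}) : 'X_{1..k} := (\sum_i nu i *+ m i)%MM.

Lemma signed_substX m : exists t : bool,
  signed_subst 'X_[m] = (-1) ^+ t * 'X_[mon3 m].
Proof.
exists (odd (\sum_i s i * m i)).
rewrite /signed_subst mmapX /mmap1 /mon3 -mprodXnE signr_odd.
rewrite (big_morph (fun n => (-1) ^+ n) (exprD (-1)) (expr0 (-1))) -big_split /=.
by apply: eq_bigr => i _; rewrite /signed_mon exprMn -exprM.
Qed.

Lemma mcoeff_signed_mon p m m' : exists t : bool,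
  (signed_subst (p@_m *: 'X_[m]))@_m' = (-1) ^+ t * (p@_m * (mon3 m == m')%:R).
Proof.
have [t tE] := signed_substX m; exists t.
rewrite -mul_mpolyC rmorphM /= tE {1}/signed_subst mmapC mcoeffCM.
rewrite -[(-1) ^+ t](rmorph_sign (@mpolyC k int)) mcoeffCM mcoeffX.
by rewrite mulrCA.
Qed.

Hypothesis inj : injective mon3.

Lemma mcoeff_signed_subst p m : exists t : bool,
  (signed_subst p)@_(mon3 m) = (-1) ^+ t * p@_m.
Proof.
have [t tE] := mcoeff_signed_mon p m (mon3 m); exists t.
rewrite eqxx mulr1 in tE; rewrite -tE.
have e0 m' : m' != m -> (signed_subst (p@_m' *: 'X_[m']))@_(mon3 m) = 0.
  move=> mm'; have [t' ->] := mcoeff_signed_mon p m' (mon3 m).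
  by rewrite (inj_eq inj) (negbTE mm') !mulr0.
rewrite {1}[p]mpolyE rmorph_sum raddf_sum /=.
case: (boolP (m \in msupp p)) => mp.
  by rewrite (bigD1_seq m) ?msupp_uniq //= [X in _ + X]big1 ?addr0.
rewrite tE memN_msupp_eq0 // mulr0 big_seq big1 // => m' m'p.
by apply: e0; apply: contraNneq mp => <-.
Qed.

Lemma coef_le_signed_subst K p : 0 <= K ->
  coef_le K p -> coef_le K (signed_subst p).
Proof.
move=> K0 h m'.
case: (boolP (has (fun m => mon3 m == m') (msupp p))) => [/hasP[m _ /eqP <-]|/hasPn nm].
  have [t ->] := mcoeff_signed_subst p m.
  by rewrite normrM normrX normrN1 expr1n mul1r.
rewrite [p]mpolyE rmorph_sum raddf_sum /= big_seq big1 ?normr0 // => m mp.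
by have [t ->] := mcoeff_signed_mon p m m'; rewrite (negbTE (nm _ mp)) !mulr0.
Qed.
End SignedMonomials.

(** * Multilinear expansion of the determinant *)

Section Multilinear.
Variable A : comNzRingType.
Implicit Types X Y Z : 'M[A]_3.

Lemma mixed_det_diag X : mixed_det (tri X X X) = \det X.
Proof. by congr (\det _); apply/matrixP => i j; rewrite mxE /tri; case: ifP => // _; case: ifP. Qed.

Lemma mixed_det_sum0 I (r : seq I) (a : I -> A) (F : I -> 'M[A]_3) Y Z :
  mixed_det (tri (\sum_(x <- r) a x *: F x) Y Z)
  = \sum_(x <- r) a x * mixed_det (tri (F x) Y Z).
Proof.
elim: r => [|x r IH]; first by rewrite !big_nil /mixed_det det_mx33 !mxE /=; ring.
by rewrite !big_cons -IH /mixed_det !det_mx33 !mxE /=; ring.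
Qed.

Lemma mixed_det_sum1 I (r : seq I) (a : I -> A) (F : I -> 'M[A]_3) X Z :
  mixed_det (tri X (\sum_(x <- r) a x *: F x) Z)
  = \sum_(x <- r) a x * mixed_det (tri X (F x) Z).
Proof.
elim: r => [|x r IH]; first by rewrite !big_nil /mixed_det det_mx33 !mxE /=; ring.
by rewrite !big_cons -IH /mixed_det !det_mx33 !mxE /=; ring.
Qed.

Lemma mixed_det_sum2 I (r : seq I) (a : I -> A) (F : I -> 'M[A]_3) X Y :
  mixed_det (tri X Y (\sum_(x <- r) a x *: F x))
  = \sum_(x <- r) a x * mixed_det (tri X Y (F x)).
Proof.
elim: r => [|x r IH]; first by rewrite !big_nil /mixed_det det_mx33 !mxE /=; ring.
by rewrite !big_cons -IH /mixed_det !det_mx33 !mxE /=; ring.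
Qed.

Lemma det3_sum (I : finType) (a : I -> A) (F : I -> 'M[A]_3) :
  \det (\sum_x a x *: F x) =
  \sum_(t : I * I * I)
     a t.1.1 * a t.1.2 * a t.2 * mixed_det (tri (F t.1.1) (F t.1.2) (F t.2)).
Proof.
rewrite -mixed_det_diag mixed_det_sum0.
transitivity (\sum_x \sum_y \sum_z
    a x * a y * a z * mixed_det (tri (F x) (F y) (F z))).
  apply: eq_bigr => x _; rewrite mixed_det_sum1 big_distrr /=; apply: eq_bigr => y _.
  rewrite mixed_det_sum2 mulrA big_distrr /=; apply: eq_bigr => z _.
  by rewrite !mulrA.
by rewrite !pair_bigA.
Qed.
End Multilinear.

(** * Collecting the terms of a monomial g_i g_j g_k *)

Section Perms.
Variables (I : eqType).
Implicit Types i j k x y z : I.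

Definition triple_perms i j k : seq (I * I * I) :=
  [:: (k, i, j); (k, j, i); (i, k, j); (j, k, i); (i, j, k); (j, i, k)].

Lemma perm_pair x y i j :
  perm_eq [:: x; y] [:: i; j] -> (x = i /\ y = j) \/ (x = j /\ y = i).
Proof.
move=> h; have := perm_mem h x; rewrite mem_head !inE => /esym/orP[]/eqP e.
  by move: h; rewrite e perm_cons => /(@perm_small_eq _ [:: y] [:: j] isT)[->]; left.
move: h; rewrite e (perm_sym _ [:: i; j]) (perm_catC [:: i] [:: j]) perm_sym.
by rewrite perm_cons => /(@perm_small_eq _ [:: y] [:: i] isT)[->]; right.
Qed.

Lemma perm_triple x y z i j k :
  perm_eq [:: x; y; z] [:: i; j; k] -> (x, y, z) \in triple_perms i j k.
Proof.
have key a b : perm_eq [:: x; y; z] [:: x; a; b] -> (y = a /\ z = b) \/ (y = b /\ z = a).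
  by rewrite perm_cons => /perm_pair.
move=> h; have := perm_mem h x; rewrite mem_head !inE => /esym/or3P[] /eqP e; subst.
- by case: (key _ _ h) => -[-> ->]; rewrite eqxx ?orbT.
- have h' : perm_eq [:: j; y; z] [:: j; i; k].
    by rewrite (permPl h) (perm_catCA [:: i] [:: j] [:: k]).
  by case: (key _ _ h') => -[-> ->]; rewrite eqxx ?orbT.
- have h' : perm_eq [:: k; y; z] [:: k; i; j].
    by rewrite (permPl h) (perm_catC [:: i; j] [:: k]).
  by case: (key _ _ h') => -[-> ->]; rewrite eqxx ?orbT.
Qed.

Lemma perm3_count x y z i j k :
    (forall t, (x == t) + (y == t) + (z == t) = (i == t) + (j == t) + (k == t))%N ->
  perm_eq [:: x; y; z] [:: i; j; k].
Proof.
move=> h; apply/allP => t _ /=; rewrite !addn0 !addnA; exact/eqP/h.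
Qed.
End Perms.

Lemma mnm_triple p (x y z i j k : 'I_p) :
  ((U_(x) + U_(y) + U_(z) == U_(i) + U_(j) + U_(k))%MM)
  = ((x, y, z) \in triple_perms i j k).
Proof.
apply/eqP/idP => [/mnmP h|].
  apply/perm_triple/perm3_count => t; have := h t.
  by rewrite !mnmDE !mnm1E.
have C : forall a b c : 'X_{1..p}, (a + b + c = b + a + c)%MM.
  by move=> a b c; rewrite (addmC a).
have D : forall a b c : 'X_{1..p}, (a + b + c = a + c + b)%MM.
  by move=> a b c; rewrite -!addmA (addmC b).
rewrite !inE => /or4P[| | |/or3P[]] /eqP[-> -> ->] //.
- by rewrite C D.
- by rewrite C D C.
- by rewrite D C.
Qed.

Section PolarizedSum.
Variables (A : comNzRingType) (I : eqType).
Implicit Types (F G : I -> 'M[A]_3) (i j k : I).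

(** With [undup] each distinct ordering counts once, so this is the coefficient of a_i a_j a_k in
    the determinant of the sum of the a_x F(x), also when indices coincide. *)
Definition polarized_sum F i j k : A :=
  \sum_(t <- undup (triple_perms i j k)) mixed_det (tri (F t.1.1) (F t.1.2) (F t.2)).

Lemma polarized_sum_map F G (c : A) i j k :
    (forall x y z, (x, y, z) \in triple_perms i j k ->
       mixed_det (tri (F x) (F y) (F z)) = c * mixed_det (tri (G x) (G y) (G z))) ->
  polarized_sum F i j k = c * polarized_sum G i j k.
Proof.
move=> h; rewrite /polarized_sum [RHS]big_distrr !big_seq; apply: eq_bigr.
by move=> [[x y] z]; rewrite mem_undup => /h.
Qed.

Lemma polarized_sum_mul F Y i j k :
  polarized_sum (fun x => Y *m F x) i j k = \det Y * polarized_sum F i j k.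
Proof.
apply: polarized_sum_map => x y z _; rewrite -mixed_det_mul /mixed_det.
congr (\det _); apply/matrixP => a b; rewrite !mxE /tri.
by case: (b == 0); rewrite ?mxE //; case: (b == 1); rewrite ?mxE.
Qed.

Lemma polarized_sum_scale (a : I -> A) F i j k :
  polarized_sum (fun x => a x *: F x) i j k = a i * a j * a k * polarized_sum F i j k.
Proof.
apply: polarized_sum_map => x y z xyz.
transitivity (a x * a y * a z * mixed_det (tri (F x) (F y) (F z))).
  by rewrite /mixed_det !det_mx33 !mxE /=; ring.
congr (_ * _); move: xyz; rewrite !inE.
by move=> /or4P[| | |/or3P[]] /eqP[-> -> ->]; ring.
Qed.

Lemma polarized_sum_eq F G i j k : F i = G i -> F j = G j -> F k = G k ->
  polarized_sum F i j k = polarized_sum G i j k.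
Proof.
move=> ei ej ek; rewrite -[RHS]mul1r; apply: polarized_sum_map => x y z.
by rewrite mul1r !inE => /or4P[| | |/or3P[]] /eqP[-> -> ->]; rewrite ?(ei, ej, ek).
Qed.

Lemma polarized_sum_rev F i j k : polarized_sum F i j k = polarized_sum F k j i.
Proof.
apply: perm_big; apply: uniq_perm; rewrite ?undup_uniq // => t.
rewrite !mem_undup !inE.
by do 6 case: (t == _).
Qed.

Lemma polarized_sum3 F i j k : i != j -> i != k -> j != k -> F k = 1%:M ->
  polarized_sum F i j k = \tr (F i) * \tr (F j) - \tr (F i *m F j).
Proof.
move=> ij ik jk Fk; rewrite -polarized_det3 /polarized_sum.
rewrite undup_id; last first.
  rewrite /= !inE !xpair_eqE !eqxx.
  rewrite ![j == i]eq_sym ![k == i]eq_sym ![k == j]eq_sym.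
  by rewrite (negbTE ij) (negbTE ik) (negbTE jk) ?(andbF, orbF).
by rewrite !big_cons big_nil /= Fk; ring.
Qed.

Lemma polarized_sum2 F i k : i != k -> F k = 1%:M ->
  polarized_sum F i k k = \tr (F i).
Proof.
move=> ik Fk; rewrite -polarized_det1 /polarized_sum.
rewrite (_ : undup _ = [:: (k, k, i); (i, k, k); (k, i, k)]).
  by rewrite !big_cons big_nil /= Fk; ring.
rewrite /= !inE !xpair_eqE !eqxx ![k == i]eq_sym (negbTE ik).
by rewrite ?(andbF, orbF, andbT, orbT) /=.
Qed.

Lemma polarized_sum1 F k : F k = 1%:M -> polarized_sum F k k k = 1.
Proof.
move=> Fk; rewrite /polarized_sum /= !inE !eqxx /=.
rewrite big_seq1 /= Fk /mixed_det det_mx33 !mxE /tri /= ?mxE /=; ring.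
Qed.
End PolarizedSum.

(** * The adjugate, which reverses exponents *)

Section Adjugate.
Variable A : comNzRingType.
Implicit Type X : 'M[A]_3.

Definition adj3 X : 'M[A]_3 := X ^+ 2 - \tr X *: X + (minor_sum X)%:M.

Lemma adj3_mul X : adj3 X * X = (\det X)%:M.
Proof.
rewrite /adj3 mulrDl mulrBl -exprSr cubic_CH -scalerAl -expr2.
rewrite (_ : _%:M * X = minor_sum X *: X); last exact: mul_scalar_mx.
rewrite -[LHS]addrA [X in _ + X]addrC -[X in _ + X]opprB.
by rewrite addrAC subrr add0r.
Qed.

(** Multiplying by the i-th power of the adjugate replaces an exponent j by i - j, up to a scalar.
    This exchanges the two gaps of a triple of exponents. *)
Lemma adj3_exp_mul X i j : (j <= i)%N ->
  adj3 X ^+ i * X ^+ j = (\det X ^+ j) *: adj3 X ^+ (i - j).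
Proof.
move=> ji; rewrite -{1}(subnK ji) exprD -mulrA.
have C : GRing.comm (adj3 X) X.
  apply: commr_sym; apply: commrD; last exact: comm_mx_scalar.
  apply: commrB; first exact/commrX/commr_refl.
  by rewrite /GRing.comm -scalerAl -scalerAr.
rewrite -exprMn_comm // adj3_mul -(rmorphXn (@scalar_mx _ _)).
by rewrite (_ : _ * _%:M = \det X ^+ j *: adj3 X ^+ (i - j)) //; exact: mul_mx_scalar.
Qed.

Lemma det3_exp X k : \det (X ^+ k) = \det X ^+ k.
Proof.
elim: k => [|k IH]; first by rewrite !expr0 det1.
by rewrite !exprS -IH -det_mulmx.
Qed.

Lemma adj3_tr X : \tr (adj3 X) = minor_sum X.
Proof.
rewrite /adj3 mxtraceD raddfB /= mxtraceZ mxtrace_sqr3 mxtrace_scalar -mulr_natl.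
ring.
Qed.

Lemma adj3_minors X : minor_sum (adj3 X) = \tr X * \det X.
Proof.
rewrite det_mx33 /minor_sum /adj3 /mxtrace /minor_sum expr2 !mxE !big_ord3 /=.
ring.
Qed.

Lemma adj3_det X : \det (adj3 X) = \det X ^+ 2.
Proof.
rewrite !det_mx33 /adj3 /mxtrace /minor_sum expr2 !mxE !big_ord3 /=.
ring.
Qed.
End Adjugate.

Definition power_poly n : {mpoly int[3]} := power_sum (fun i => 'X_i) n.
Definition mixed_poly i j : {mpoly int[3]} := mixed_sum (fun i => 'X_i) i j.

(** * Coefficients of polarized powers of the generic companion matrix *)

Section GenericCubic.
Let f4 (i : 'I_4) : {mpoly int[4]} := 'X_i.
Let C : 'M[{mpoly int[4]}]_3 := companion3 f4.
Let Y := adj3 C.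
(** Exponents of the invariants -f_2, -f_1 f_3, -f_0 f_3^2 of [C]. Below, [nuY] does the same for
    the adjugate, whose invariants are f_1 f_3, -f_2 f_0 f_3^2 and f_0^2 f_3^4. *)
Let nuC : 'I_3 -> 'X_{1..4} := (tri U_(2) (U_(3) + U_(1)) (U_(0%R) + U_(3) *+ 2))%MM.
Let sC : 'I_3 -> bool := tri true true true.
Let nuY : 'I_3 -> 'X_{1..4} :=
  (tri (U_(3) + U_(1)) (U_(2) + (U_(0%R) + U_(3) *+ 2)) ((U_(0%R) + U_(3) *+ 2) *+ 2))%MM.
Let sY : 'I_3 -> bool := tri false true false.

Lemma ord3_eqP (T : Type) (a b : 'I_3 -> T) : a 0 = b 0 -> a 1 = b 1 -> a 2 = b 2 -> a =1 b.
Proof. by move=> h0 h1 h2; elim/ord3_ind. Qed.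

Lemma cubic_coefs_C : cubic_coefs C =1 signed_mon nuC sC.
Proof.
apply: ord3_eqP; rewrite /cubic_coefs /signed_mon /nuC /sC /tri /= expr1 mulN1r.
- exact: companion3_tr.
- by rewrite companion3_minors mpolyXD.
- by rewrite companion3_det mpolyXD mpolyXn.
Qed.

Lemma cubic_coefs_Y : cubic_coefs Y =1 signed_mon nuY sY.
Proof.
apply: ord3_eqP; rewrite /cubic_coefs /signed_mon /nuY /sY /tri /= ?expr1 ?expr0 ?mul1r ?mulN1r.
- by rewrite adj3_tr companion3_minors mpolyXD.
- by rewrite adj3_minors companion3_tr companion3_det mulrNN !mpolyXD expr2.
- rewrite adj3_det companion3_det sqrrN. by rewrite -mpolyXn mpolyXD -mpolyXn.
Qed.

Lemma mon3E k (nu : 'I_3 -> 'X_{1..k}) m i :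
  mon3 nu m i = (nu 0%R i * m 0%R + nu 1%R i * m 1%R + nu 2%R i * m 2%R)%N.
Proof.
rewrite /mon3 mnm_sumE !big_ord_recl big_ord0 addn0 addnA !mulmnE.
by congr (_ * m _ + nu _ _ * m _ + nu _ _ * m _)%N; apply/val_inj.
Qed.

Lemma mon3_nuC_inj : injective (mon3 nuC).
Proof.
move=> m m' /mnmP h; apply/mnmP; apply: ord3_eqP.
- have := h 2; rewrite !mon3E /nuC /tri /= ?(mulmnE, mnmDE) !mnm1E /=; lia.
- have := h 1; rewrite !mon3E /nuC /tri /= ?(mulmnE, mnmDE) !mnm1E /=; lia.
- have := h 0; rewrite !mon3E /nuC /tri /= ?(mulmnE, mnmDE) !mnm1E /=; lia.
Qed.

Lemma mon3_nuY_inj : injective (mon3 nuY).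
Proof.
move=> m m' /mnmP h; apply/mnmP.
have h1 : m 1 = m' 1.
  have := h 2; rewrite !mon3E /nuY /tri /= ?(mulmnE, mnmDE) !mnm1E /=; lia.
apply: ord3_eqP => //.
- have := h 1; rewrite !mon3E /nuY /tri /= ?(mulmnE, mnmDE) !mnm1E /=; lia.
- have := h 0; rewrite !mon3E /nuY /tri /= ?(mulmnE, mnmDE) !mnm1E /=; lia.
Qed.

Let mu : 'X_{1..4} := (U_(0%R) + U_(3) *+ 2)%MM.

Lemma det_C : \det C = - 'X_[mu].
Proof. by rewrite companion3_det mpolyXD mpolyXn. Qed.

Lemma det_C_exp k : exists m, \det C ^+ k = (-1) ^+ k * 'X_[m].
Proof. by exists (mu *+ k)%MM; rewrite -mpolyXn det_C [LHS]exprNn. Qed.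

Lemma eq_power_sum (B : comNzRingType) (e e' : 'I_3 -> B) n :
  e =1 e' -> power_sum e n = power_sum e' n.
Proof.
move=> h; rewrite /power_sum !h; elim: n 3 (e' 0) (e' 0 ^+ 2 + _) => //= n IH x y z.
by rewrite !h IH.
Qed.

Lemma signed_subst_power_poly k nu s n :
  @signed_subst k nu s (power_poly n) = power_sum (signed_mon nu s) n.
Proof.
rewrite rmorph_power_sum; apply: eq_power_sum => i.
by rewrite /= /signed_subst mmapX mmap1U.
Qed.

Lemma signed_subst_mixed_poly k nu s i j :
  @signed_subst k nu s (mixed_poly i j) = mixed_sum (signed_mon nu s) i j.
Proof.
by rewrite /mixed_poly /mixed_sum rmorphB rmorphM /= -!signed_subst_power_poly.
Qed.

Variables (K : int) (n : nat).
Hypothesis K1 : 1 <= K.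
Hypothesis power_le : forall a, (0 < a <= n)%N -> coef_le K (power_poly a).
Hypothesis mixed_le : forall a b, (0 < b)%N -> (b.*2 <= a <= n)%N -> coef_le K (mixed_poly a b).

Let K0 : 0 <= K. Proof. exact: le_trans K1. Qed.

Lemma coef_le1 k : coef_le K (1 : {mpoly int[k]}).
Proof. by move=> m; rewrite mcoeff1; case: eqP; rewrite ?normr1 ?normr0. Qed.

Section Bound.
Variables (nu : 'I_3 -> 'X_{1..4}) (s : 'I_3 -> bool) (M : 'M[{mpoly int[4]}]_3).
Hypothesis nu_inj : injective (mon3 nu).
Hypothesis coefsM : cubic_coefs M =1 signed_mon nu s.

Lemma coef_le_tr a : (0 < a <= n)%N -> coef_le K (\tr (M ^+ a)).
Proof.
move=> an; rewrite mxtrace_exp3 (eq_power_sum _ coefsM) -signed_subst_power_poly.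
by apply: coef_le_signed_subst => //; apply: power_le.
Qed.

(** The condition 2b <= a forces a and b to differ when b > 0. The three indices are then distinct,
    and the polarized sum is a whole mixed sum rather than half of one. *)
Lemma coef_le_polarized (F : nat -> 'M[{mpoly int[4]}]_3) i j k a b :
    F k = 1%:M -> F i = M ^+ a -> F j = M ^+ b ->
    (i == k) = (a == 0)%N -> (j == k) = (b == 0)%N -> (i == j) = (a == b) ->
    (b.*2 <= a <= n)%N ->
  coef_le K (polarized_sum F i j k).
Proof.
move=> Fk Fi Fj ik jk ij ba.
case: (posnP b) => [b0|b0].
  have {}jk : j = k by apply/eqP; rewrite jk b0.
  rewrite jk; case: (posnP a) => [a0|a0].
    have -> : i = k by apply/eqP; rewrite ik a0.
    by rewrite polarized_sum1 //; apply: coef_le1.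
  rewrite polarized_sum2 ?Fi ?ik -?lt0n //.
  by apply: coef_le_tr; rewrite a0; case/andP: ba.
rewrite polarized_sum3 ?ik ?jk ?ij //; try by lia.
rewrite Fi Fj (_ : _ *m _ = M ^+ (a + b)); last by rewrite exprD.
rewrite !mxtrace_exp3 -/(mixed_sum (cubic_coefs M) a b) /mixed_sum.
rewrite !(eq_power_sum _ coefsM) -/(mixed_sum _ a b) -signed_subst_mixed_poly.
by apply: coef_le_signed_subst => //; apply: mixed_le.
Qed.
End Bound.

Let D i j k := polarized_sum (fun x => C ^+ x) i j k.

(** If the lower gap j - k is at most i - j, factor out [C ^+ k] to reach exponents (i - k, j - k,
    0). Otherwise multiply by the i-th power of the adjugate to reach (i - k, i - j, 0) for the
    adjugate. In both cases the scalars are signed monomials, so heights are preserved. *)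
Lemma coef_le_generic i j k : (k <= j)%N -> (j <= i)%N -> (i <= n)%N ->
  coef_le K (D i j k).
Proof.
move=> kj ji in_; case: (leqP (j - k) (i - j)) => h.
- have -> : D i j k = \det C ^+ k * polarized_sum (fun x => C ^+ (x - k)) i j k.
    rewrite -det3_exp -polarized_sum_mul; apply: polarized_sum_eq => /=;
    by rewrite mulmxE -exprD subnKC //; lia.
  have [m ->] := det_C_exp k; rewrite -mulrA coef_le_sign.
  apply: coef_leXM => //.
  apply: (coef_le_polarized mon3_nuC_inj cubic_coefs_C (a := i - k) (b := j - k));
    rewrite ?subnn //; lia.
- pose m' := (mu *+ (2 * i))%MM.
  apply: (@coef_leXM_inv _ _ _ _ m').
  have -> : 'X_[m'] * D i j k = \det C ^+ (i + j + k)
             * polarized_sum (fun x => Y ^+ (i - x)) k j i.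
    rewrite -polarized_sum_rev.
    rewrite !exprD -(polarized_sum_scale (fun x => \det C ^+ x)).
    have -> : 'X_[m'] = \det (Y ^+ i).
      by rewrite -mpolyXn det3_exp adj3_det det_C sqrrN -exprM.
    rewrite -polarized_sum_mul; apply: polarized_sum_eq;
    by rewrite mulmxE adj3_exp_mul //; lia.
  have [m ->] := det_C_exp (i + j + k); rewrite -mulrA coef_le_sign.
  apply: coef_leXM => //.
  apply: (coef_le_polarized mon3_nuY_inj cubic_coefs_Y (a := i - k) (b := i - j));
    rewrite ?subnn //; lia.
Qed.

Lemma polarized_sum_top a : (0 < a)%N ->
  D a 0 0 = signed_subst nuC sC (power_poly a).
Proof.
move=> a0; rewrite /D polarized_sum2 -?lt0n //.
by rewrite mxtrace_exp3 (eq_power_sum _ cubic_coefs_C) signed_subst_power_poly.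
Qed.
End GenericCubic.

Lemma polarized_sum_val (A : comNzRingType) p (F : nat -> 'M[A]_3) (i j k : 'I_p) :
  polarized_sum (fun x : 'I_p => F x) i j k = polarized_sum F i j k.
Proof.
rewrite /polarized_sum.
pose h (t : 'I_p * 'I_p * 'I_p) := (val t.1.1, val t.1.2, val t.2).
have h_inj : injective h.
  by move=> [[a b] c] [[a' b'] c'] [] /val_inj -> /val_inj -> /val_inj ->.
have -> : triple_perms (i : nat) j k = map h (triple_perms i j k) by [].
by rewrite undup_map_inj // big_map.
Qed.

Lemma sort_triple p (x y z : 'I_p) : exists i j k : 'I_p,
  [/\ (k <= j)%N, (j <= i)%N & (x, y, z) \in triple_perms i j k].
Proof.
case: (leqP x y) => xy; case: (leqP y z) => yz; case: (leqP x z) => xz.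
- by exists z, y, x; split=> //; rewrite !inE !eqxx ?orbT.
- by lia.
- by exists y, z, x; split=> //; [exact: ltnW|rewrite !inE !eqxx ?orbT].
- by exists y, x, z; split=> //; [exact: ltnW|rewrite !inE !eqxx ?orbT].
- by exists z, x, y; split=> //; [exact: ltnW|rewrite !inE !eqxx ?orbT].
- by exists x, z, y; split=> //; [exact: ltnW|rewrite !inE !eqxx ?orbT].
- by lia.
- by exists x, y, z; split=> //; [exact: ltnW|exact: ltnW|rewrite !inE !eqxx ?orbT].
Qed.

(** * From polarized sums to the height of the resultant *)

Section GenericResultant.
Variable n : nat.
Local Notation B := {mpoly int[4 + n.+1]}.
Implicit Types (m : 'X_{1..4 + n.+1}) (a : 'X_{1..4}) (c : 'X_{1..n.+1}).

Definition lpart m : 'X_{1..4} := [multinom m (lshift n.+1 i) | i < 4].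
Definition rpart m : 'X_{1..n.+1} := [multinom m (rshift 4 i) | i < n.+1].
Definition lrmon a c : 'X_{1..4 + n.+1} :=
  [multinom match fintype.split i with inl j => a j | inr j => c j end | i < 4 + n.+1].

Lemma lrmonK a c m : (lrmon a c == m) = (a == lpart m) && (c == rpart m).
Proof.
apply/eqP/andP => [<-|[/eqP-> /eqP->]].
  split; apply/eqP/mnmP => i; rewrite !mnmE.
    by rewrite (unsplitK (inl i)).
  by rewrite (unsplitK (inr i)).
by apply/mnmP => i; rewrite mnmE; case: splitP => j e; rewrite mnmE; congr (m _); apply/val_inj.
Qed.

Definition f_embed : {mpoly int[4]} -> B :=
  mmap (@mpolyC _ int) (fun i => 'X_(lshift n.+1 i)).
HB.instance Definition _ := GRing.RMorphism.on f_embed.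

Lemma f_embedU i : f_embed 'X_i = generic_f n i.
Proof. by rewrite /f_embed mmapX mmap1U. Qed.

Lemma f_embedX a c :
  'X_[lrmon a c] = f_embed 'X_[a] * \prod_j generic_g 3 j ^+ c j.
Proof.
rewrite mpolyXE_id big_split_ord /f_embed mmapX /mmap1; congr (_ * _).
  by apply: eq_bigr => i _; rewrite mnmE (unsplitK (inl i)).
by apply: eq_bigr => i _; rewrite mnmE (unsplitK (inr i)).
Qed.

Lemma mcoeff_f_embed p c m :
  (f_embed p * \prod_j generic_g 3 j ^+ c j)@_m = if c == rpart m then p@_(lpart m) else 0.
Proof.
rewrite {1}[p]mpolyE rmorph_sum mulr_suml raddf_sum /=.
transitivity (\sum_(a <- msupp p) p@_a * ((a == lpart m) && (c == rpart m))%:R).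
  apply: eq_bigr => a _; rewrite -mul_mpolyC rmorphM /= {1}/f_embed mmapC -mulrA.
  by rewrite -f_embedX mcoeffCM mcoeffX lrmonK.
case: ifP => _; last by rewrite big1 // => a _; rewrite andbF mulr0.
rewrite [in RHS](mpolyE p) raddf_sum; apply: eq_bigr => a _.
by rewrite /= mcoeffZ mcoeffX andbT.
Qed.

Let f4 (i : 'I_4) : {mpoly int[4]} := 'X_i.
Let C := companion3 f4.

Lemma companion3_generic : companion3 (@generic_f 3 n) = map_mx f_embed C.
Proof.
apply/matrixP => i j; rewrite !mxE; case: ifP => _; rewrite ?raddfN ?raddfMn /=;
by rewrite f_embedU.
Qed.

Let term (t : 'I_n.+1 * 'I_n.+1 * 'I_n.+1) : {mpoly int[4]} :=
  f4 3 ^+ ((n - t.1.1) + (n - t.1.2) + (n - t.2)) *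
  mixed_det (tri (C ^+ t.1.1) (C ^+ t.1.2) (C ^+ t.2)).

Lemma det_eval_companion : \det (eval_companion (@generic_f 3 n) (@generic_g 3 n)) =
  \sum_t f_embed (term t) *
     \prod_j generic_g 3 j ^+ (U_(t.1.1) + U_(t.1.2) + U_(t.2))%MM j.
Proof.
rewrite /eval_companion det3_sum; apply: eq_bigr => -[[x y] z] _ /=.
rewrite companion3_generic -!rmorphXn /=.
have -> : mixed_det (tri (map_mx f_embed (C ^+ x)) (map_mx f_embed (C ^+ y))
    (map_mx f_embed (C ^+ z))) = f_embed (mixed_det (tri (C ^+ x) (C ^+ y) (C ^+ z))).
  rewrite -det_map_mx /mixed_det; congr (\det _); apply/matrixP => i j.
  by rewrite !mxE; elim/ord3_ind: j; rewrite /tri /= mxE.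
rewrite rmorphM rmorphXn /= f_embedU !exprD.
have -> : \prod_j generic_g 3 j ^+ (U_(x) + U_(y) + U_(z))%MM j
   = generic_g 3 x * generic_g 3 y * generic_g 3 z :> B.
  under eq_bigr do rewrite !mnmDE !exprD.
  rewrite !big_split /=.
  have e (w : 'I_n.+1) : \prod_j generic_g 3 j ^+ U_(w)%MM j = generic_g 3 w :> B.
    rewrite (bigD1 w) //= mnm1E eqxx expr1 big1 ?mulr1 // => j jw.
    by rewrite mnm1E eq_sym (negbTE jw).
  by rewrite !e.
by ring.
Qed.

(** The g-part of the monomial selects the orderings of (i, j, k); all of them carry the same power
    of f_3, which factors out. *)
Lemma mcoeff_det_eval_companion m (i j k : 'I_n.+1) :
  rpart m = (U_(i) + U_(j) + U_(k))%MM ->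
  (\det (eval_companion (@generic_f 3 n) (@generic_g 3 n)))@_m =
  (f4 3 ^+ ((n - i) + (n - j) + (n - k)) *
     polarized_sum (fun x => C ^+ x) (i : nat) j k)@_(lpart m).
Proof.
move=> rm; rewrite det_eval_companion raddf_sum /=.
transitivity (\sum_(t <- undup (triple_perms i j k)) (term t)@_(lpart m)).
  rewrite [RHS]big_uniq ?undup_uniq // [RHS]big_mkcond; apply: eq_bigr => t _.
  by rewrite mcoeff_f_embed rm mnm_triple mem_undup; case: t => -[].
rewrite -raddf_sum -(polarized_sum_val (fun x => C ^+ x)) /polarized_sum.
congr mcoeff; rewrite [RHS]big_distrr !big_seq; apply: eq_bigr => t.
rewrite mem_undup /term => tP; congr (_ ^+ _ * _).
by move: tP; rewrite !inE => /or4P[| | |/or3P[]] /eqP -> /=; lia.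
Qed.

Lemma mcoeff_det_eval_companion0 m :
    (forall i j k : 'I_n.+1, rpart m <> (U_(i) + U_(j) + U_(k))%MM) ->
  (\det (eval_companion (@generic_f 3 n) (@generic_g 3 n)))@_m = 0.
Proof.
move=> rm; rewrite det_eval_companion raddf_sum /= big1 // => t _.
by rewrite mcoeff_f_embed; case: eqP => // /esym/rm.
Qed.

Lemma generic_res_companion : exists (a : 'X_{1..4 + n.+1}) (s : bool),
  'X_[a] * generic_res 3 n =
  (-1) ^+ s * \det (eval_companion (@generic_f 3 n) (@generic_g 3 n)).
Proof.
have f0 : @generic_f 3 n 3 != 0.
  by rewrite -msupp_eq0 msuppX.
have [s sE] := sylvester_res_companion (@generic_g 3 n) f0.
by exists (U_(lshift n.+1 3) *+ (2 * n))%MM, s; rewrite -mpolyXn -sE.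
Qed.

Lemma rpart_dec m :
  (exists i j k : 'I_n.+1, rpart m = (U_(i) + U_(j) + U_(k))%MM) \/
  (forall i j k : 'I_n.+1, rpart m <> (U_(i) + U_(j) + U_(k))%MM).
Proof.
pose b := [exists i : 'I_n.+1, exists j : 'I_n.+1, exists k : 'I_n.+1,
             rpart m == (U_(i) + U_(j) + U_(k))%MM].
case: (boolP b) => [/existsP[i /existsP[j /existsP[k /eqP e]]]|h].
  by left; exists i, j, k.
right => i j k e; case/negP: h.
by apply/existsP; exists i; apply/existsP; exists j; apply/existsP; exists k; apply/eqP.
Qed.

(** The power of f_3 that multiplies the resultant only shifts monomials, and each g-monomial has a
    decreasing triple of indices, to which [coef_le_generic] applies. *)
Lemma cubic_res_height_le (K : int) :
    1 <= K ->
    (forall i, (0 < i <= n)%N -> coef_le K (power_poly i)) ->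
    (forall i j, (0 < j)%N -> (j.*2 <= i <= n)%N -> coef_le K (mixed_poly i j)) ->
  cubic_res_height n <= K.
Proof.
move=> K1 hp hm; have K0 : 0 <= K by apply: le_trans K1.
apply: height_le => //.
have [a [s e]] := generic_res_companion.
apply: (@coef_leXM_inv _ _ _ _ a); rewrite e coef_le_sign => m.
case: (rpart_dec m) => [[x [y [z rm]]]|h]; last first.
  by rewrite mcoeff_det_eval_companion0 ?normr0.
have [i [j [k [kj ji xyz]]]] := sort_triple x y z.
have {}rm : rpart m = (U_(i) + U_(j) + U_(k))%MM.
  by rewrite rm; apply/eqP; rewrite mnm_triple.
rewrite (mcoeff_det_eval_companion rm) /f4 mpolyXn.
move: (lpart m); apply: coef_leXM => //.
by apply: (coef_le_generic K1 hp hm kj ji); rewrite -ltnS.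
Qed.

(** Only the coefficient of g_n g_0^2 is inspected: up to a power of f_3 it is the trace of
    [C ^+ n], that is, the n-th power sum in signed monomials of f. *)
Lemma cubic_res_height_ge : (0 < n)%N -> coef_le (cubic_res_height n) (power_poly n).
Proof.
move=> n0.
have [a [s e]] := generic_res_companion.
have := coef_le_height (generic_res 3 n).
move=> /(coef_leXM a (bigmax_ge_id _ _ _ _)).
rewrite e coef_le_sign => h.
suff : coef_le (cubic_res_height n) (polarized_sum (fun x => C ^+ x) n 0 0).
  rewrite polarized_sum_top // => {}h p.
  have [t tE] := mcoeff_signed_subst (tri true true true) mon3_nuC_inj (power_poly n) p.
  have := congr1 Num.norm tE; rewrite normrM normrX normrN1 expr1n mul1r => <-.
  exact: h.
apply: (@coef_leXM_inv _ _ _ _ (U_(3) *+ (n + n))%MM) => m.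
pose c : 'X_{1..n.+1} := (U_(ord_max) + U_(ord0) + U_(ord0))%MM.
have /andP[/eqP lm /eqP rm] : (m == lpart (lrmon m c)) && (c == rpart (lrmon m c)).
  by rewrite -lrmonK.
have := h (lrmon m c).
rewrite (mcoeff_det_eval_companion (esym rm)) -lm /= subnn subn0 add0n.
by rewrite /f4 -mpolyXn.
Qed.
End GenericResultant.

(** * Coefficients are bounded by the maximum on the torus *)

Section Fourier.
Variable C : numClosedFieldType.

Lemma prim_root_exists n : (0 < n)%N -> exists z : C, n.-primitive_root z.
Proof.
pose p : {poly C} := 'X^n - 1; have [r Dp] := closed_field_poly_normal p.
move=> n_gt0; rewrite (monicP _) ?monicXnsubC // scale1r in Dp.
have rn1 : all n.-unity_root r by apply/allP=> z; rewrite -root_prod_XsubC -Dp.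
have sz_r : (n < (size r).+1)%N.
  by rewrite -(size_prod_XsubC r id) -Dp size_XnsubC.
have [|z] := hasP (has_prim_root n_gt0 rn1 _ sz_r); last by exists z.
by rewrite -separable_prod_XsubC -Dp separable_Xn_sub_1 // pnatr_eq0 -lt0n.
Qed.

Lemma norm_prim_root n (z : C) : n.-primitive_root z -> `|z| = 1.
Proof.
move=> zn; have n0 := prim_order_gt0 zn.
by apply/eqP; rewrite -(pexpr_eq1 n0) // -normrX prim_expr_order // normr1.
Qed.

Lemma sum_prim_root n (z : C) a b : n.-primitive_root z -> (a < n)%N -> (b < n)%N ->
  \sum_(t < n) (z ^+ t) ^+ a / (z ^+ t) ^+ b = n%:R * (a == b)%:R.
Proof.
move=> zn an bn; pose x := z ^+ a / z ^+ b.
have z0 : z != 0 by rewrite -normr_gt0 (norm_prim_root zn) ltr01.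
have -> : \sum_(t < n) (z ^+ t) ^+ a / (z ^+ t) ^+ b = \sum_(t < n) x ^+ t.
  apply: eq_bigr => t _; rewrite /x expr_div_n -!exprM.
  by rewrite [(t * a)%N]mulnC [(t * b)%N]mulnC.
case: eqP => [eab|/eqP ab].
  rewrite (eq_bigr (fun=> 1)) ?sumr_const ?card_ord ?mulr1 // => t _.
  by rewrite /x eab divff ?expf_neq0 // expr1n.
have x1 : x - 1 != 0.
  rewrite subr_eq0; apply: contra ab => /eqP xE.
  have : z ^+ a = z ^+ b by rewrite -[LHS](divfK (expf_neq0 b z0)) -/x xE mul1r.
  by move/eqP; rewrite (eq_prim_root_expr zn) !modn_small.
apply: (mulfI x1); rewrite -subrX1 mulr0 mulr0 /x expr_div_n -!exprM.
by rewrite ![(_ * n)%N]mulnC !exprM (prim_expr_order zn) !expr1n divr1 subrr.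
Qed.

(** Discrete Fourier inversion: averaging Q times an inverse monomial over M-th roots of unity
    isolates one coefficient, because M exceeds all exponents of Q and of m. *)
Lemma mcoeff_le_torus k (Q : {mpoly C[k]}) (K : C) :
    (forall z : 'I_k -> C, (forall i, `|z i| = 1) -> `|Q.@[z]| <= K) ->
  forall m, `|Q@_m| <= K.
Proof.
move=> QK m; pose M := maxn (msize Q) (mdeg m).+1.
have M0 : (0 < M)%N by rewrite leq_max orbT.
have [z zM] := prim_root_exists M0.
have small (m' : 'X_{1..k}) i : (mdeg m' < M)%N -> (m' i < M)%N.
  by apply: leq_ltn_trans; rewrite mdegE (bigD1 i) //= leq_addr.
pose pt (w : {ffun 'I_k -> 'I_M}) i := z ^+ w i.
have pt1 w i : `|pt w i| = 1 by rewrite normrX (norm_prim_root zM) expr1n.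
have eS : \sum_w Q.@[pt w] * \prod_i (pt w i ^+ m i)^-1 = (M ^ k)%:R * Q@_m.
  under eq_bigr do rewrite mevalE mulr_suml.
  rewrite exchange_big /=.
  transitivity (\sum_(m' <- msupp Q) Q@_m' * ((M ^ k)%:R * (m' == m)%:R)).
    rewrite !big_seq; apply: eq_bigr => m' m'Q.
    under eq_bigr do rewrite -mulrA -big_split /=.
    rewrite -big_distrr /=; congr (_ * _).
    rewrite -(bigA_distr_bigA (fun (i : 'I_k) (t : 'I_M) =>
                                 (z ^+ t) ^+ m' i / (z ^+ t) ^+ m i)) /=.
    have m'M : (mdeg m' < M)%N by rewrite leq_max msize_mdeg_lt.
    have mM : (mdeg m < M)%N by rewrite leq_max leqnn orbT.
    under eq_bigr do rewrite (sum_prim_root zM (small _ _ m'M) (small _ _ mM)).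
    rewrite big_split /= prodr_const card_ord natrX; congr (_ * _).
    case: eqP => [->|/eqP mm']; first by rewrite big1 // => i _; rewrite eqxx.
    have [i im] : exists i, m' i != m i.
      by apply/existsP; apply: contraR mm' => /existsPn h; apply/eqP/mnmP => i;
        have := h i; rewrite negbK => /eqP.
    by rewrite (bigD1 i) //= (negbTE im) mul0r.
  rewrite [in RHS](mpolyE Q) raddf_sum /= big_distrr /=; apply: eq_bigr => m' _.
  by rewrite mcoeffZ mcoeffX mulrCA.
have : `|(M ^ k)%:R * Q@_m| <= (M ^ k)%:R * K.
  rewrite -eS; apply: le_trans (ler_norm_sum _ _ _) _.
  rewrite (_ : _ * K = \sum_(w : {ffun 'I_k -> 'I_M}) K); last first.
    by rewrite sumr_const card_ffun !card_ord mulr_natl.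
  apply: ler_sum => w _; rewrite normrM normr_prod big1 ?mulr1; first exact: QK.
  by move=> i _; rewrite normfV normrX pt1 expr1n invr1.
by rewrite normrM ger0_norm ?ler0n // ler_pM2l // ltr0n expn_gt0 M0.
Qed.
End Fourier.

(** * The tribonacci constant and cubics with unimodular coefficients *)

Section Tribonacci.
Variables (R : realFieldType) (alpha : R).
Hypothesis Halpha : alpha ^+ 3 - alpha ^+ 2 - alpha - 1 = 0.

(** This is the cofactor of c - alpha in the tribonacci cubic at c. Its positivity lets the sign of
    the cubic at a rational point locate alpha. *)
Lemma cubic_factor_gt0 (c : R) : 18 / 10 <= c <= 2 ->
  0 < alpha ^+ 2 + (c - 1) * alpha + (c ^+ 2 - c - 1).
Proof.
move=> /andP[c1 c2].
have -> : alpha ^+ 2 + (c - 1) * alpha + (c ^+ 2 - c - 1)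
  = (alpha + (c - 1) / 2) ^+ 2 + (c ^+ 2 - c - 1 - (c - 1) ^+ 2 / 4) by field.
by rewrite ltr_wpDl ?sqr_ge0 //; nra.
Qed.

Lemma cubic_factor (c : R) : c ^+ 3 - c ^+ 2 - c - 1 =
  (c - alpha) * (alpha ^+ 2 + (c - 1) * alpha + (c ^+ 2 - c - 1)).
Proof. by rewrite -[LHS]subr0 -Halpha; ring. Qed.

Lemma alpha_lower : 57 / 31 < alpha.
Proof.
rewrite ltNge; apply/negP => h.
have c0 : 0 < alpha ^+ 2 + (57 / 31 - 1) * alpha + ((57 / 31) ^+ 2 - 57 / 31 - 1).
  by apply: cubic_factor_gt0; lra.
have := cubic_factor (57 / 31); have : 0 <= 57 / 31 - alpha by lra.
by move=> /mulr_ge0 /(_ (ltW c0)) => + e; rewrite -e; lra.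
Qed.

Lemma alpha_upper : alpha < 46 / 25.
Proof.
rewrite ltNge; apply/negP => h.
have c0 : 0 < alpha ^+ 2 + (46 / 25 - 1) * alpha + ((46 / 25) ^+ 2 - 46 / 25 - 1).
  by apply: cubic_factor_gt0; lra.
have := cubic_factor (46 / 25); have : 46 / 25 - alpha <= 0 by lra.
by move=> /mulr_le0_ge0 /(_ (ltW c0)) => + e; rewrite -e; lra.
Qed.

Lemma le_alpha (r : R) : 0 <= r -> r ^+ 3 <= r ^+ 2 + r + 1 -> r <= alpha.
Proof.
move=> r0 h; rewrite leNgt; apply/negP => ar.
have a1 := alpha_lower.
have : 0 < (r - alpha) * (r ^+ 2 + (alpha - 1) * r + (alpha ^+ 2 - alpha - 1)).
  by rewrite mulr_gt0 ?subr_gt0 //; nra.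
have -> : (r - alpha) * (r ^+ 2 + (alpha - 1) * r + (alpha ^+ 2 - alpha - 1))
  = r ^+ 3 - r ^+ 2 - r - alpha * (alpha ^+ 2 - alpha - 1) by ring.
have -> : alpha * (alpha ^+ 2 - alpha - 1) = 1 by move: Halpha; nra.
lra.
Qed.

(** Here r and t are the moduli of two roots of a cubic with unimodular coefficients, and r, A, B, x
    are the moduli of the coefficients of the cubic reflected at the first root, whose squares sum
    to 4. *)
Lemma root_product_bound (r t x A B : R) : 0 < r -> 0 < t -> x * r = 1 -> 0 <= A -> 0 <= B ->
    r <= alpha -> r * t <= alpha -> A ^+ 2 + B ^+ 2 = 4 - r ^+ 2 - x ^+ 2 ->
    r * t ^+ 3 <= A * t ^+ 2 + B * t + x ->
  r ^+ 2 * t <= 98 / 100 * alpha ^+ 2.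
Proof.
move=> r0 t0 xr A0 B0 ra rta AB h; rewrite leNgt; apply/negP => big.
have a1 := alpha_lower; have a2 := alpha_upper.
have a3 : (57 / 31) ^+ 2 <= alpha ^+ 2 by rewrite lerXn2r ?nnegrE //; lra.
have b1 : 33 / 10 < r ^+ 2 * t by lra.
rewrite expr2 -mulrA in b1.
have rt : r * t <= 46 / 25 by lra.
have r2 : r <= 46 / 25 by lra.
(* A product r * (r t) above 3.3 with both factors at most 1.84 forces r and r t to be close to
   alpha and t close to 1. Then A and B are too small for the root inequality in the last
   hypothesis. *)
have r1 : 34 / 19 <= r.
  have h1 : r * (r * t) <= r * (46 / 25) by rewrite ler_wpM2l // ltW.
  lra.
have t1 : 37 / 38 <= t.
  have h1 : r * (r * t) <= 46 / 25 * (46 / 25 * t).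
    apply: ler_pM => //; [exact: ltW|by rewrite ltW // mulr_gt0|].
    by rewrite ler_pM2r.
  lra.
have t2 : t <= 36 / 35.
  have h1 : 34 / 19 * t <= r * t by rewrite ler_pM2r.
  lra.
have x1 : 27 / 50 <= x by clear -xr r0 r2; nra.
have x2 : x <= 14 / 25 by clear -xr r1; nra.
have s1 : A ^+ 2 + B ^+ 2 <= 51 / 100 by clear -AB r1 x1; nra.
have s2 : A + B <= 101 / 100.
  by have := sqr_ge0 (A - B); clear -A0 B0 s1; nra.
have s3 : A * t ^+ 2 + B * t <= (A + B) * (53 / 50).
  have t3 : t ^+ 2 <= 53 / 50 by clear -t0 t2; nra.
  have t4 : t <= 53 / 50 by lra.
  by rewrite mulrDl lerD // ler_wpM2l.
have s4 : 923 / 1000 <= t ^+ 3 by rewrite !exprS expr0 mulr1; clear -t1; nra.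
clear -h s2 s3 s4 r1 x2; nra.
Qed.
End Tribonacci.

Section CubicRoots.
Local Open Scope complex_scope.
Variables (R : rcfType) (alpha : R).
Hypothesis Halpha : alpha ^+ 3 - alpha ^+ 2 - alpha - 1 = 0.
Implicit Types x y z : R[i].

Definition cabs z : R := Normc.normc z.

Lemma cabsE z : `|z| = (cabs z)%:C. Proof. by case: z. Qed.

Lemma cabs_ge0 z : 0 <= cabs z.
Proof. by case: z => a b; rewrite /cabs /= sqrtr_ge0. Qed.

Lemma cabsM x y : cabs (x * y) = cabs x * cabs y.
Proof. exact: Normc.normcM. Qed.

Lemma cabs1 : cabs 1 = 1. Proof. exact: Normc.normc1. Qed.

Lemma cabsX x n : cabs (x ^+ n) = cabs x ^+ n.
Proof. by elim: n => [|n IH]; rewrite ?expr0 ?cabs1 // !exprS cabsM IH. Qed.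

Lemma cabsD x y : cabs (x + y) <= cabs x + cabs y.
Proof. exact: le_normcD. Qed.

Lemma cabsN x : cabs (- x) = cabs x. Proof. exact: normcN. Qed.

Lemma cabs_sqr x : cabs x ^+ 2 = complex.Re x ^+ 2 + complex.Im x ^+ 2.
Proof. by case: x => a b; rewrite /cabs /= sqr_sqrtr // addr_ge0 ?sqr_ge0. Qed.

Lemma cubic_roots_exist (e : 'I_3 -> R[i]) : exists x y z : R[i],
  [/\ e 0 = x + y + z, e 1 = - (x * y + x * z + y * z) & e 2 = x * y * z].
Proof.
pose p : {poly R[i]} := 'X^3 + (- e 0 *: 'X^2 + (- e 1 *: 'X + (- e 2)%:P)).
have sz : size p = 4.
  rewrite size_polyDl size_polyXn // ltnS.
  rewrite (leq_trans (size_polyD _ _)) // geq_max (leq_trans (size_scale_leq _ _)) ?size_polyXn //.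
  rewrite (leq_trans (size_polyD _ _)) // geq_max (leq_trans (size_scale_leq _ _)) ?size_polyX //.
  by rewrite (leq_trans (size_polyC_leq1 _)).
have coefs := (coefD, coefZ, coefXn, coefX, coefC).
have lc : lead_coef p = 1 by rewrite lead_coefE sz /p !coefs /= !mulr0 !addr0.
have [s sE] := closed_field_poly_normal p.
rewrite lc scale1r in sE.
have : size s = 3 by have := sz; rewrite sE size_prod_XsubC => -[].
case: s sE => [|x [|y [|z []]]] // sE _; exists x, y, z.
have {}sE : p = 'X^3 + (- (x + y + z) *: 'X^2
    + ((x * y + x * z + y * z) *: 'X + (- (x * y * z))%:P)).
  rewrite sE !big_cons big_nil -!mul_polyC !(polyCM, polyCD, polyCN); ring.
split.
- have := congr1 (fun q : {poly R[i]} => q`_2) sE.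
  by rewrite /p !coefs /= !mulr1 !mulr0 !addr0 !add0r => /oppr_inj.
- have := congr1 (fun q : {poly R[i]} => q`_1) sE.
  by rewrite /p !coefs /= !mulr1 !mulr0 !addr0 !add0r => <-; rewrite opprK.
- have := congr1 (fun q : {poly R[i]} => q`_0) sE.
  by rewrite /p !coefs /= !mulr0 !add0r => /oppr_inj.
Qed.

Section Unimodular.
Variables x y z : R[i].
Hypothesis h0 : cabs (x + y + z) = 1.
Hypothesis h1 : cabs (x * y + x * z + y * z) = 1.
Hypothesis h2 : cabs (x * y * z) = 1.

Lemma root_le_alpha : cabs x <= alpha.
Proof.
apply: le_alpha => //; first exact: cabs_ge0.
have -> : cabs x ^+ 3 = cabs ((x + y + z) * x ^+ 2 - (x * y + x * z + y * z) * x + x * y * z).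
  by rewrite -cabsX; congr cabs; ring.
do 2 (apply: le_trans (cabsD _ _) _; apply: lerD; rewrite ?h2 //).
  by rewrite cabsM h0 mul1r cabsX.
by rewrite cabsN cabsM h1 mul1r.
Qed.

Lemma root_gt0 : 0 < cabs x.
Proof.
rewrite lt_def cabs_ge0 andbT; apply: contra_eq_neq h2 => x0.
by rewrite !cabsM x0 !mul0r eq_sym oner_eq0.
Qed.

(* Replacing the factor X - x by 1 - x^* X keeps the l2 norm of the
   coefficients, which is 2 for a cubic with unimodular coefficients. *)
Lemma reflected_norm (a b c d s t : R) :
  let q1 := a +i* b in let q0 := c +i* d in let xi := s +i* t in
  1 + cabs (q1 - xi) ^+ 2 + cabs (q0 - xi * q1) ^+ 2 + cabs (xi * q0) ^+ 2 =
  cabs xi ^+ 2 + cabs (1 - (s -i* t) * q1) ^+ 2 + cabs (q1 - (s -i* t) * q0) ^+ 2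
  + cabs q0 ^+ 2.
Proof. by move=> q1 q0 xi; rewrite !cabs_sqr /=; ring. Qed.
End Unimodular.

(** Since y stays a root after reflection at x, the triangle inequality there gives the last
    hypothesis of [root_product_bound], while [reflected_norm] controls the middle coefficients. *)
Lemma root_pair_bound x y z :
  cabs (x + y + z) = 1 -> cabs (x * y + x * z + y * z) = 1 -> cabs (x * y * z) = 1 ->
  cabs x ^+ 2 * cabs y <= 98 / 100 * alpha ^+ 2.
Proof.
move=> h0 h1 h2.
have x0 := root_gt0 h2.
have y0 : 0 < cabs y by apply: (@root_gt0 y x z); rewrite -h2; congr cabs; ring.
have z0 : 0 < cabs z by apply: (@root_gt0 z x y); rewrite -h2; congr cabs; ring.
have xyz : cabs x * cabs y * cabs z = 1 by rewrite -!cabsM.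
pose xc : R[i] := complex.Re x -i* complex.Im x.
pose q1 := - (y + z); pose q0 := y * z.
have xcE : cabs xc = cabs x by rewrite /xc; case: (x) => a b; rewrite /cabs /= sqrrN.
have rn : 1 + cabs (q1 - x) ^+ 2 + cabs (q0 - x * q1) ^+ 2 + cabs (x * q0) ^+ 2 =
   cabs x ^+ 2 + cabs (1 - xc * q1) ^+ 2 + cabs (q1 - xc * q0) ^+ 2 + cabs q0 ^+ 2.
  have := reflected_norm (complex.Re q1) (complex.Im q1) (complex.Re q0) (complex.Im q0) (complex.Re x) (complex.Im x).
  by rewrite /xc; move: q1 q0 => [a b] [c d]; case: (x).
have e0 : cabs (q1 - x) = 1 by rewrite -h0 -cabsN; congr cabs; rewrite /q1; ring.
have e1 : cabs (q0 - x * q1) = 1 by rewrite -h1; congr cabs; rewrite /q0 /q1; ring.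
have e2 : cabs (x * q0) = 1 by rewrite -h2; congr cabs; rewrite /q0; ring.
apply: (@root_product_bound R alpha Halpha (cabs x) (cabs y) (cabs q0)
          (cabs (1 - xc * q1)) (cabs (q1 - xc * q0))) => //; rewrite ?cabs_ge0 //.
- by rewrite /q0 cabsM -xyz; ring.
- exact: (root_le_alpha h0 h1 h2).
(* The product of the three moduli is 1, so |x y| = 1/|z|, and 1/z is a root of the reversed cubic,
   whose coefficients have modulus 1 as well. *)
- apply: (le_alpha Halpha); first by rewrite mulr_ge0 ?cabs_ge0.
  have zr : cabs x * cabs y = (cabs z)^-1.
    by apply: (mulIf (lt0r_neq0 z0)); rewrite xyz mulVf // lt0r_neq0.
  have : 1 <= cabs z ^+ 3 + cabs z ^+ 2 + cabs z.
    have -> : 1 = cabs (z ^+ 3 - (x + y + z) * z ^+ 2 + (x * y + x * z + y * z) * z).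
      by rewrite -h2; congr cabs; ring.
    apply: le_trans (cabsD _ _) _; apply: lerD.
      apply: le_trans (cabsD _ _) _; apply: lerD.
    + by rewrite cabsX.
    + by rewrite cabsN cabsM h0 mul1r cabsX.
    + by rewrite cabsM h1 mul1r.
  rewrite zr => h; rewrite -(ler_pM2r (exprn_gt0 3 z0)) exprVn mulVf ?expf_neq0 ?lt0r_neq0 //.
  apply: le_trans h _; rewrite le_eqVlt; apply/orP; left; apply/eqP.
  by field; rewrite lt0r_neq0.
- move: rn; rewrite e0 e1 e2 expr1n => rn; lra.
- have -> : cabs x * cabs y ^+ 3 = cabs ((1 - xc * q1) * y ^+ 2 + (q1 - xc * q0) * y + q0).
    rewrite -xcE -cabsX -cabsM; congr cabs; rewrite /q1 /q0; ring.
  apply: le_trans (cabsD _ _) _; rewrite lerD2r.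
  by apply: le_trans (cabsD _ _) _; rewrite !cabsM.
Qed.
End CubicRoots.

(** * Exponential gain for mixed sums on the torus *)

Section MixedBound.
Local Open Scope complex_scope.
Variables (R : rcfType) (alpha : R).
Hypothesis Halpha : alpha ^+ 3 - alpha ^+ 2 - alpha - 1 = 0.

Lemma power_sum_roots (A : comNzRingType) (e : 'I_3 -> A) (x y z : A) n :
    e 0 = x + y + z -> e 1 = - (x * y + x * z + y * z) -> e 2 = x * y * z ->
  power_sum e n = x ^+ n + y ^+ n + z ^+ n.
Proof.
move=> e0 e1 e2.
rewrite (@cubic_rec_uniq A e (fun n => x ^+ n + y ^+ n + z ^+ n)) => [|k].
  by rewrite /power_sum e0 e1; congr cubic_rec; ring.
by rewrite e0 e1 e2 !exprS; ring.
Qed.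

(** The mixed sum has six terms x^i y^j = x^(i-2j) (x^2 y)^j; the first factor is bounded through
    |x| <= alpha, the second by [root_pair_bound]. *)
Lemma mixed_sum_le (e : 'I_3 -> R[i]) i j : (forall k, `|e k| = 1) -> (j.*2 <= i)%N ->
  cabs (mixed_sum e i j) <= 6 * (alpha ^+ (i - j.*2) * (98 / 100 * alpha ^+ 2) ^+ j).
Proof.
move=> e1 ji.
have [x [y [z [E0 E1 E2]]]] := cubic_roots_exist e.
have ce k : cabs (e k) = 1 by have := e1 k; rewrite cabsE => -[].
set K := _ * _ ^+ j.
have term u v w : cabs (u + v + w) = 1 -> cabs (u * v + u * w + v * w) = 1 ->
    cabs (u * v * w) = 1 -> cabs (u ^+ i * v ^+ j) <= K.
  move=> h0 h1 h2; rewrite -(subnK ji) -addnn !exprD -mulrA.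
  rewrite (_ : _ * _ * _ = (u ^+ 2 * v) ^+ j); last by rewrite expr2 !exprMn.
  rewrite cabsM !cabsX cabsM cabsX addnn.
  apply: ler_pM; rewrite ?exprn_ge0 ?mulr_ge0 ?cabs_ge0 //.
    by rewrite lerXn2r ?nnegrE ?cabs_ge0 ?(le_trans (cabs_ge0 u)) ?(root_le_alpha Halpha h0 h1 h2).
  have pb := root_pair_bound Halpha h0 h1 h2.
  have p0 : 0 <= cabs u ^+ 2 * cabs v by rewrite mulr_ge0 ?exprn_ge0 ?cabs_ge0.
  by rewrite lerXn2r ?nnegrE // (le_trans p0 pb).
have -> : mixed_sum e i j = x ^+ i * y ^+ j + x ^+ i * z ^+ j + y ^+ i * x ^+ j
    + y ^+ i * z ^+ j + z ^+ i * x ^+ j + z ^+ i * y ^+ j.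
  by rewrite /mixed_sum !(power_sum_roots _ E0 E1 E2) !exprD; ring.
have h0 := ce 0; rewrite E0 in h0.
have h1 := ce 1; rewrite E1 cabsN in h1.
have h2 := ce 2; rewrite E2 in h2.
have -> : 6 * K = K + K + K + K + K + K by ring.
apply: le_trans (cabsD _ _) _; apply: lerD; last first.
  by apply: (@term z y x); [rewrite -h0|rewrite -h1|rewrite -h2]; congr cabs; ring.
apply: le_trans (cabsD _ _) _; apply: lerD; last first.
  by apply: (@term z x y); [rewrite -h0|rewrite -h1|rewrite -h2]; congr cabs; ring.
apply: le_trans (cabsD _ _) _; apply: lerD; last first.
  by apply: (@term y z x); [rewrite -h0|rewrite -h1|rewrite -h2]; congr cabs; ring.
apply: le_trans (cabsD _ _) _; apply: lerD; last first.
  by apply: (@term y x z); [rewrite -h0|rewrite -h1|rewrite -h2]; congr cabs; ring.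
apply: le_trans (cabsD _ _) _; apply: lerD; last first.
  by apply: (@term x z y); [rewrite -h0|rewrite -h1|rewrite -h2]; congr cabs; ring.
exact: (@term x y z).
Qed.

Lemma mixed_poly_torus i j m : (j.*2 <= i)%N ->
  `|(mixed_poly i j)@_m|%:~R <= 6 * (alpha ^+ (i - j.*2) * (98 / 100 * alpha ^+ 2) ^+ j).
Proof.
move=> ji; set K := 6 * _.
pose Q := map_mpoly (intr : int -> R[i]) (mixed_poly i j).
have : `|Q@_m| <= K%:C.
  apply: mcoeff_le_torus => z z1.
  have -> : Q.@[z] = mixed_sum z i j.
    rewrite /Q /mixed_poly !rmorph_mixed_sum /mixed_sum.
    by congr (_ * _ - _); apply: eq_power_sum => k; rewrite /= map_mpolyX mevalXU.
  by rewrite cabsE lecR; apply: mixed_sum_le.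
rewrite /Q mcoeff_map_mpoly /= -intr_norm -(rmorph_int (real_complex R)) lecR.
by [].
Qed.
End MixedBound.

(** * Explicit coefficients of power sums and complete sums *)

Section Trinomial.
Variable R : numFieldType.
Implicit Types a b c : nat.

Definition trinom a b c : R := (a + b + c)`!%:R / (a`!%:R * b`!%:R * c`!%:R).

Lemma fact_neq0 n : n`!%:R != 0 :> R.
Proof. by rewrite pnatr_eq0 -lt0n fact_gt0. Qed.

Lemma trinom_gt0 a b c : 0 < trinom a b c.
Proof. by rewrite divr_gt0 ?mulr_gt0 ?ltr0n ?fact_gt0. Qed.

Lemma trinom_predl a b c :
  (if a is a'.+1 then trinom a' b c else 0) * (a + b + c)%:R = a%:R * trinom a b c.
Proof.
case: a => [|a]; first by rewrite !mul0r.
rewrite /trinom !addSn !factS !natrM.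
have f := fact_neq0; have : (a.+1)%:R != 0 :> R by rewrite pnatr_eq0.
by move: (a.+1%:R) => y y0; field; rewrite y0 !f.
Qed.

Lemma trinom_predm a b c :
  (if b is b'.+1 then trinom a b' c else 0) * (a + b + c)%:R = b%:R * trinom a b c.
Proof.
case: b => [|b]; first by rewrite !mul0r.
rewrite /trinom !(addnS, addSn) !factS !natrM.
have f := fact_neq0; have : (b.+1)%:R != 0 :> R by rewrite pnatr_eq0.
by move: (b.+1%:R) => y y0; field; rewrite y0 !f.
Qed.

Lemma trinom_predr a b c :
  (if c is c'.+1 then trinom a b c' else 0) * (a + b + c)%:R = c%:R * trinom a b c.
Proof.
case: c => [|c]; first by rewrite !mul0r.
rewrite /trinom !(addnS, addSn) !factS !natrM.
have f := fact_neq0; have : (c.+1)%:R != 0 :> R by rewrite pnatr_eq0.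
by move: (c.+1%:R) => y y0; field; rewrite y0 !f.
Qed.

Lemma trinom_pascal a b c : (0 < a + b + c)%N ->
  trinom a b c = (if a is a'.+1 then trinom a' b c else 0)
               + (if b is b'.+1 then trinom a b' c else 0)
               + (if c is c'.+1 then trinom a b c' else 0).
Proof.
move=> N0; have n0 : (a + b + c)%:R != 0 :> R by rewrite pnatr_eq0 -lt0n.
apply: (mulIf n0); rewrite !mulrDl trinom_predl trinom_predm trinom_predr.
by rewrite -!mulrDl -!natrD mulrC.
Qed.

(** One term of the trinomial expansion, proved by induction with Pascal's rule. *)
Lemma trinom_le x y z a b c : 0 <= x -> 0 <= y -> 0 <= z ->
  trinom a b c * (x ^+ a * y ^+ b * z ^+ c) <= (x + y + z) ^+ (a + b + c).
Proof.
move=> x0 y0 z0; have [N] := ubnP (a + b + c).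
elim: N a b c => // N IH a b c; rewrite ltnS => abcN.
case: (posnP (a + b + c)) => [/eqP|N0].
  rewrite !addn_eq0 => /andP[/andP[/eqP-> /eqP->] /eqP->].
  by rewrite /trinom fact0 !expr0 !mulr1 divr1.
rewrite trinom_pascal // !mulrDl -(prednK N0) exprS !mulrDl.
apply: lerD; first apply: lerD.
- case: a abcN {N0} => [|a] h; first by rewrite mul0r mulr_ge0 ?exprn_ge0 ?addr_ge0.
  rewrite exprS [leLHS](_ : _ = x * (trinom a b c * (x ^+ a * y ^+ b * z ^+ c))).
    by rewrite ler_wpM2l //; apply: IH.
  by ring.
- case: b abcN {N0} => [|b] h; first by rewrite mul0r mulr_ge0 ?exprn_ge0 ?addr_ge0.
  rewrite addnS addSn in h *; rewrite exprS [leLHS](_ : _ = y * (trinom a b c * (x ^+ a * y ^+ b * z ^+ c))).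
    by rewrite ler_wpM2l //; apply: IH.
  by ring.
- case: c abcN {N0} => [|c] h; first by rewrite mul0r mulr_ge0 ?exprn_ge0 ?addr_ge0.
  rewrite addnS in h *; rewrite exprS [leLHS](_ : _ = z * (trinom a b c * (x ^+ a * y ^+ b * z ^+ c))).
    by rewrite ler_wpM2l //; apply: IH.
  by ring.
Qed.
End Trinomial.

Definition complete_poly n : {mpoly int[3]} := complete_sum (fun i => 'X_i) n.

Lemma complete_polyS n : complete_poly n.+3 =
  'X_0 * complete_poly n.+2 + 'X_1 * complete_poly n.+1 + 'X_2 * complete_poly n.
Proof. exact: cubic_recS. Qed.

(** The grading in which an elementary symmetric function has its degree in the roots. *)
Definition wt3 (m : 'X_{1..3}) : nat := (m 0%R + 2 * m 1%R + 3 * m 2%R)%N.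
Definition deg3 (m : 'X_{1..3}) : nat := (m 0%R + m 1%R + m 2%R)%N.

Section Coefficients.
Variable R : numFieldType.
Implicit Types m : 'X_{1..3}.

Lemma mcoeffXUM (A : comNzRingType) (p : {mpoly A[3]}) i m :
  ('X_i * p)@_m = if m i is _.+1 then p@_(m - U_(i)) else 0.
Proof. by rewrite mcoeffXM lep1mP; case: (m i). Qed.

Definition trinom_mnm m : R := trinom R (m 0) (m 1) (m 2).

Lemma mcoeff_pred0 (p : {mpoly int[3]}) w m :
    (forall m', (p@_m')%:~R = (wt3 m' + 2 == w)%N%:R * trinom_mnm m' :> R) ->
  (('X_0 * p)@_m)%:~R =
  (wt3 m + 2 == w.+1)%N%:R * (if m 0 is a.+1 then trinom R a (m 1) (m 2) else 0) :> R.
Proof.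
move=> pE; rewrite mcoeffXUM; case m0 : (m 0) => [|a]; first by rewrite mulr0.
rewrite pE /trinom_mnm !mnmBE !mnm1E /= m0 subn1 !subn0 /=; congr (_%:R * _).
by rewrite /wt3 !mnmBE !mnm1E /= m0; lia.
Qed.

Lemma mcoeff_pred1 (p : {mpoly int[3]}) w m :
    (forall m', (p@_m')%:~R = (wt3 m' + 2 == w)%N%:R * trinom_mnm m' :> R) ->
  (('X_1 * p)@_m)%:~R =
  (wt3 m + 2 == w.+2)%N%:R * (if m 1 is a.+1 then trinom R (m 0) a (m 2) else 0) :> R.
Proof.
move=> pE; rewrite mcoeffXUM; case m0 : (m 1) => [|a]; first by rewrite mulr0.
rewrite pE /trinom_mnm !mnmBE !mnm1E /= m0 subn1 !subn0 /=; congr (_%:R * _).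
by rewrite /wt3 !mnmBE !mnm1E /= m0; lia.
Qed.

Lemma mcoeff_pred2 (p : {mpoly int[3]}) w m :
    (forall m', (p@_m')%:~R = (wt3 m' + 2 == w)%N%:R * trinom_mnm m' :> R) ->
  (('X_2 * p)@_m)%:~R =
  (wt3 m + 2 == w.+3)%N%:R * (if m 2 is a.+1 then trinom R (m 0) (m 1) a else 0) :> R.
Proof.
move=> pE; rewrite mcoeffXUM; case m0 : (m 2) => [|a]; first by rewrite mulr0.
rewrite pE /trinom_mnm !mnmBE !mnm1E /= m0 subn1 !subn0 /=; congr (_%:R * _).
by rewrite /wt3 !mnmBE !mnm1E /= m0; lia.
Qed.

(** On coefficients the recurrence of complete sums is Pascal's rule. The shift by 2 comes from the
    two leading zeros of [complete_sum]. *)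
Lemma mcoeff_complete n m :
  ((complete_poly n)@_m)%:~R = (wt3 m + 2 == n)%N%:R * trinom_mnm m :> R.
Proof.
elim/ltn_ind: n m => -[|[|[|n]]] IH m.
- by rewrite addn2 mul0r /complete_poly /= mcoeff0.
- by rewrite addn2 mul0r /complete_poly /= mcoeff0.
- rewrite /complete_poly /= mcoeff1; case: eqP => [->|m0].
    rewrite /wt3 /trinom_mnm !mnm0E /trinom !muln0 !addn0 fact0 !mulr1 divr1.
    by rewrite eqxx rmorph1 mulr1.
  case: eqP => [w|]; last by rewrite mul0r.
  case: m0; apply/mnmP; move: w; rewrite /wt3 => w.
  by apply: ord3_eqP; rewrite mnm0E; lia.
rewrite complete_polyS; move: (IH n.+2) (IH n.+1) (IH n) => {IH}.
move: (complete_poly n.+2) (complete_poly n.+1) (complete_poly n) => p2 p1 p0.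
move=> /(_ (ltnSn _)) h2 /(_ (leqW (ltnSn _))) h1 /(_ (leqW (leqW (ltnSn _)))) h0.
rewrite !mcoeffD !rmorphD /= (mcoeff_pred0 _ h2) (mcoeff_pred1 _ h1) (mcoeff_pred2 _ h0).
rewrite -!mulrDr; case: eqP => [w|]; rewrite ?mul0r // !mul1r.
by rewrite /trinom_mnm [RHS]trinom_pascal //; move: w; rewrite /wt3; lia.
Qed.

(** The Girard-Waring formula. In [power_sum_complete] the three terms carry factors 1, 2, 3, and by
    absorption they contribute a/N, 2b/N and 3c/N of the same trinomial. *)
Lemma mcoeff_power n m : (0 < n)%N ->
  ((power_poly n)@_m)%:~R = (wt3 m == n)%:R * (n%:R / (deg3 m)%:R * trinom_mnm m) :> R.
Proof.
case: n => // n _.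
have -> : power_poly n.+1 = 'X_0 * complete_poly n.+2
    + (2%:MP * ('X_1 * complete_poly n.+1) + 3%:MP * ('X_2 * complete_poly n)).
  by rewrite /power_poly power_sum_complete !mpolyC_nat addrA.
have h2 := mcoeff_complete n.+2; have h1 := mcoeff_complete n.+1.
have h0 := mcoeff_complete n; move: h2 h1 h0.
move: (complete_poly n.+2) (complete_poly n.+1) (complete_poly n) => p2 p1 p0 h2 h1 h0.
rewrite !mcoeffD !mcoeffCM !intrD !intrM.
rewrite (mcoeff_pred0 _ h2) (mcoeff_pred1 _ h1) (mcoeff_pred2 _ h0).
rewrite addn2 !eqSS; case: eqP => [w|]; last by rewrite !mul0r !mulr0 !addr0.
have N0 : (deg3 m)%:R != 0 :> R.
  by rewrite pnatr_eq0 -lt0n; move: w; rewrite /wt3 /deg3; lia.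
rewrite !mul1r; apply: (mulIf N0); rewrite [RHS]mulrAC divfK //.
rewrite !mulrDl -!mulrA /deg3 trinom_predl trinom_predm trinom_predr -w /wt3.
by rewrite natrD natrD !natrM /trinom_mnm; ring.
Qed.

Lemma trinom_mnm_gt0 m : 0 < trinom_mnm m.
Proof. exact: trinom_gt0. Qed.
End Coefficients.

(** * Two-sided Stirling bounds through Wallis integrals *)

Section Stirling.
Variable R : realType.
Implicit Types (f df : R -> R) (x a b : R) (n m : nat).

Lemma le_of_derive_ge0 f df a b : a <= b ->
    (forall x, a <= x <= b -> is_derive x 1 f (df x)) ->
    (forall x, a <= x <= b -> 0 <= df x) ->
  f a <= f b.
Proof.
move=> ab fd df0.
have fd' x : x \in `]a, b[ -> is_derive x 1 f (df x).
  by rewrite in_itv /= => /andP[ax xb]; apply: fd; rewrite !ltW.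
have [|c] := MVT_segment ab fd'.
  apply: derivable_within_continuous => x; rewrite in_itv /= => xab.
  by apply: ex_derive; exact: fd.
rewrite in_itv /= => cab e.
by rewrite -subr_ge0 e mulr_ge0 ?subr_ge0 ?df0.
Qed.

Fixpoint sin_primitive n x : R :=
  match n with
  | 0 => x
  | 1 => 1 - cos x
  | m.+2 => ((m.+1)%:R * sin_primitive m x - cos x * sin x ^+ m.+1) / m.+2%:R
  end.

Lemma is_derive_sin_primitive n x :
  is_derive x 1 (sin_primitive n) (sin x ^+ n).
Proof.
suff : is_derive x 1 (sin_primitive n) (sin x ^+ n) /\
       is_derive x 1 (sin_primitive n.+1) (sin x ^+ n.+1) by case.
elim: n => [|n [IH1 IH2]]; split; [| |exact: IH2|].
- by rewrite expr0; exact: is_derive_id.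
- by apply: is_derive_eq; rewrite add0r mul1r opprK expr1.
rewrite [sin_primitive n.+2]/=.
have -> : (fun y => (n.+1%:R * sin_primitive n y - cos y * sin y ^+ n.+1) / n.+2%:R)
   = n.+2%:R^-1 \*: (n.+1%:R \*: (sin_primitive n) - cos * (sin ^+ n.+1) : R -> R).
  by apply/funext => y /=; rewrite mulrC; congr (_ * (_ - _)); rewrite /GRing.mul /= exprfctE.
apply: is_derive_eq.
rewrite /GRing.scale /= exprfctE.
have := cos2Dsin2 x; move: (sin x) (cos x) => s c sc.
have {sc} c2 : c * c = 1 - s * s by rewrite -sc; ring.
have -> : c * (n.+1%:R * s ^+ n * c) = s ^+ n * n.+1%:R * (1 - s * s).
  by rewrite -c2; ring.
have : n.+2%:R != 0 :> R by rewrite pnatr_eq0.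
by rewrite !exprS -!natr1 => n0; field.
Qed.

(** The integral of sin^n over [0, pi/2], as the value of a primitive that vanishes at 0. *)
Definition wallis n : R := sin_primitive n (pi / 2).

Lemma wallisSS n : wallis n.+2 = n.+1%:R / n.+2%:R * wallis n.
Proof. by rewrite /wallis /= cos_pihalf mul0r subr0 mulrAC. Qed.

Lemma wallis_leS n : wallis n.+1 <= wallis n.
Proof.
rewrite -subr_ge0.
have -> : 0 = sin_primitive n 0 - sin_primitive n.+1 0.
  suff : sin_primitive n 0 = 0 /\ sin_primitive n.+1 0 = 0.
    by move=> [-> ->]; rewrite subr0.
  elim: n => [|n [IH1 IH2]].
    by split; [|rewrite /= cos0 subrr].
  by split=> //=; rewrite IH1 sin0 expr0n !mulr0 subr0 mul0r.
pose f := sin_primitive n - sin_primitive n.+1.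
have pi0 : 0 <= pi / 2 :> R by rewrite divr_ge0 ?pi_ge0.
have s01 x : 0 <= x <= pi / 2 -> 0 <= sin x <= 1.
  move=> /andP[x0 x1]; rewrite sin_le1 andbT sin_ge0_pi // x0 /=.
  by rewrite (le_trans x1)// ler_pdivrMr// ler_peMr ?pi_ge0// ler1n.
apply: (@le_of_derive_ge0 f (fun x => sin x ^+ n - sin x ^+ n.+1)) => //.
- move=> x _; apply: is_deriveB; exact: is_derive_sin_primitive.
- move=> x /s01 /andP[s0 s1].
  by rewrite subr_ge0 exprS ler_piMl // exprn_ge0.
Qed.

Lemma wallis_gt0 n : 0 < wallis n.
Proof.
suff : 0 < wallis n /\ 0 < wallis n.+1 by case.
elim: n => [|n [IH1 IH2]].
  by rewrite /wallis /= cos_pihalf subr0 divr_gt0 ?pi_gt0.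
by rewrite IH2 wallisSS !mulr_gt0 ?invr_gt0.
Qed.

Lemma wallisMS n : n.+1%:R * wallis n * wallis n.+1 = pi / 2.
Proof.
elim: n => [|n <-]; first by rewrite /wallis /= cos_pihalf subr0 mulr1 mul1r.
rewrite wallisSS; have : n.+2%:R != 0 :> R by rewrite pnatr_eq0.
by move: (n.+2%:R) => y y0; field.
Qed.

Lemma wallis_sqr_ge n : pi / 2 <= n.+1%:R * wallis n ^+ 2.
Proof.
rewrite -(wallisMS n) expr2 mulrA ler_wpM2l ?wallis_leS//.
by rewrite mulr_ge0// ltW// wallis_gt0.
Qed.

Lemma wallis_sqr_le n : n%:R * wallis n ^+ 2 <= pi / 2.
Proof.
case: n => [|n]; first by rewrite mul0r divr_ge0 ?pi_ge0.
rewrite -(wallisMS n) expr2 !mulrA ler_wpM2r ?(ltW (wallis_gt0 _))//.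
by rewrite ler_wpM2l ?wallis_leS.
Qed.

Lemma wallis_even n :
  wallis n.*2 = pi / 2 * ((n.*2)`!%:R / (n`!%:R ^+ 2 * 4 ^+ n)).
Proof.
elim: n => [|n IH]; first by rewrite /wallis /= expr1n !mulr1 divr1 mulr1.
rewrite doubleS wallisSS IH !factS !natrM.
have f0 : n`!%:R != 0 :> R by rewrite pnatr_eq0 -lt0n fact_gt0.
have p0 : 4 ^+ n != 0 :> R by rewrite expf_neq0.
rewrite -(natr1 n.*2.+1) -(natr1 n.*2) -(natr1 n) -addnn natrD [4 ^+ n.+1]exprS.
have n0 : 0 <= n%:R :> R by [].
by field; rewrite f0 p0 /=; apply/andP; split; lra.
Qed.

Lemma ln1Dx_sub_ln1Bx_ge x : 0 <= x < 1 ->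
  2 * x + 2 / 3 * x ^+ 3 <= ln (1 + x) - ln (1 - x).
Proof.
move=> /andP[x0 x1].
pose f y : R := ln (1 + y) - ln (1 - y) - 2 * y - 2 / 3 * y ^+ 3.
suff : f 0 <= f x.
  by rewrite /f addr0 subr0 ln1 expr0n /= !mulr0 !subr0 => h; lra.
pose df y : R := (1 + y)^-1 + (1 - y)^-1 - 2 - 2 * y ^+ 2.
apply: (@le_of_derive_ge0 f df) => [|y /andP[y0 yx]|y /andP[y0 yx]]; first exact: x0.
  have h1 : 0 < 1 + y by lra.
  have h2 : 0 < 1 - y by lra.
  have d1 := is_derive1_ln h1; have d2 := is_derive1_ln h2.
  apply: is_derive_eq; rewrite /df /GRing.scale /=.
  by field; rewrite !gt_eqF.
have h1 : 0 < 1 + y by lra.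
have h2 : 0 < 1 - y by lra.
have -> : df y = 2 * y ^+ 4 / ((1 + y) * (1 - y)).
  by rewrite /df; field; rewrite !gt_eqF.
by rewrite divr_ge0 // mulr_ge0 ?exprn_ge0 // ltW.
Qed.

Lemma ln1Dx_sub_ln1Bx_le x : 0 <= x <= 3^-1 ->
  ln (1 + x) - ln (1 - x) <= 2 * x + 3 / 4 * x ^+ 3.
Proof.
move=> /andP[x0 x1].
pose f y : R := 2 * y + 3 / 4 * y ^+ 3 - (ln (1 + y) - ln (1 - y)).
suff : f 0 <= f x.
  by rewrite /f addr0 subr0 ln1 expr0n /= !mulr0 !subr0 => h; lra.
pose df y : R := 2 + 9 / 4 * y ^+ 2 - ((1 + y)^-1 + (1 - y)^-1).
apply: (@le_of_derive_ge0 f df) => [|y /andP[y0 yx]|y /andP[y0 yx]]; first exact: x0.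
  have h1 : 0 < 1 + y by lra.
  have h2 : 0 < 1 - y by lra.
  have d1 := is_derive1_ln h1; have d2 := is_derive1_ln h2.
  apply: is_derive_eq; rewrite /df /GRing.scale /=.
  by field; rewrite !gt_eqF.
have h1 : 0 < 1 + y by lra.
have h2 : 0 < 1 - y by lra.
have -> : df y = y ^+ 2 * (1 / 4 - 9 / 4 * y ^+ 2) / ((1 + y) * (1 - y)).
  by rewrite /df; field; rewrite !gt_eqF.
by rewrite divr_ge0 // mulr_ge0 ?exprn_ge0 ?(ltW h1) ?(ltW h2) //; nra.
Qed.

(** The logarithm of n! e^n / n^(n + 1/2), which tends to ln(2 pi) / 2. *)
Definition stirling_seq n : R :=
  ln n`!%:R - (n%:R + 2^-1) * ln n%:R + n%:R.

(** With x = 1/(2n+1), the ratio (n+1)/n is (1+x)/(1-x), and a cubic expansion of its logarithm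
    suffices. The constants 1/14 and 1/10 bracket the exact 1/12 and leave room for the crude
    remainders. *)
Lemma stirling_seqS n : (0 < n)%N ->
  14^-1 * (n%:R^-1 - n.+1%:R^-1) <= stirling_seq n - stirling_seq n.+1
    <= 10^-1 * (n%:R^-1 - n.+1%:R^-1).
Proof.
move=> n0; have n1 : 1 <= n%:R :> R by rewrite ler1n.
rewrite /stirling_seq factS natrM lnM ?posrE ?ltr0n ?fact_gt0 //.
rewrite -(natr1 n); move: n1; set y : R := n%:R => n1.
set x := (2 * y + 1)^-1.
have y0 : 0 < y by lra.
have y1 : 0 < y + 1 by lra.
have y2 : 0 < 2 * y + 1 by lra.
have x0 : 0 < x by rewrite invr_gt0.
have xy : x * (2 * y + 1) = 1 by rewrite mulVf ?gt_eqF.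
have x3 : x <= 3^-1 by nra.
have -> : ln n`!%:R - (y + 2^-1) * ln y + y -
   (ln (y + 1) + ln n`!%:R - (y + 1 + 2^-1) * ln (y + 1) + (y + 1)) =
   (y + 2^-1) * (ln (y + 1) - ln y) - 1 by ring.
have -> : ln (y + 1) - ln y = ln (1 + x) - ln (1 - x).
  rewrite -!ln_div ?posrE //; [congr ln | lra | lra].
  by rewrite /x; field; rewrite !gt_eqF //=; lra.
have -> : y^-1 - (y + 1)^-1 = 4 * x ^+ 2 / (1 - x ^+ 2).
  rewrite /x; field; rewrite !gt_eqF //=.
  have -> : ((2 * y + 1) ^+ 2 - 1) = 4 * y * (y + 1) by ring.
  by rewrite !mulr_gt0.
have -> : y + 2^-1 = (2 * x)^-1.
  by rewrite /x; field; rewrite gt_eqF.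
have xx : 0 < 1 - x ^+ 2 by clear -x0 x3; nra.
have hl : 2 * x + 2 / 3 * x ^+ 3 <= ln (1 + x) - ln (1 - x).
  by apply: ln1Dx_sub_ln1Bx_ge; lra.
have hu : ln (1 + x) - ln (1 - x) <= 2 * x + 3 / 4 * x ^+ 3.
  by apply: ln1Dx_sub_ln1Bx_le; lra.
move: (ln (1 + x) - ln (1 - x)) hl hu => L hl hu.
have x20 : 0 < 2 * x by lra.
apply/andP; split.
  rewrite lerBrDr ler_pdivlMl //.
  apply: le_trans hl.
  have -> : 14^-1 * (4 * x ^+ 2 / (1 - x ^+ 2)) = (2 / 7 * x ^+ 2) / (1 - x ^+ 2).
    by field; rewrite gt_eqF.
  suff : 2 * x * (2 / 7 * x ^+ 2 / (1 - x ^+ 2)) <= 2 * x * (3^-1 * x ^+ 2) by lra.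
  rewrite ler_pM2l //.
  rewrite ler_pdivrMr //.
  have : x * x <= 3^-1 * 3^-1 by apply: ler_pM => //; apply: ltW.
  by have := sqr_ge0 x; rewrite -expr2; move: (x ^+ 2) => s s0 s1; nra.
rewrite lerBlDr ler_pdivrMl //; apply: le_trans hu _.
have -> : 10^-1 * (4 * x ^+ 2 / (1 - x ^+ 2)) = (2 / 5 * x ^+ 2) / (1 - x ^+ 2).
  by field; rewrite gt_eqF.
suff : 2 * x * (3 / 8 * x ^+ 2) <= 2 * x * (2 / 5 * x ^+ 2 / (1 - x ^+ 2)) by lra.
rewrite ler_pM2l //.
by rewrite ler_pdivlMr //; have := sqr_ge0 x; move: (x ^+ 2) => s s0; nra.
Qed.

Lemma stirling_seqD n k : (0 < n)%N ->
  14^-1 * (n%:R^-1 - (n + k)%:R^-1) <= stirling_seq n - stirling_seq (n + k)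
    <= 10^-1 * (n%:R^-1 - (n + k)%:R^-1).
Proof.
move=> n0; elim: k => [|k /andP[IH1 IH2]].
  by rewrite addn0 !subrr !mulr0 lexx.
have /andP[h1 h2] := stirling_seqS (leq_trans n0 (leq_addr k n)).
rewrite addnS; move: h1 h2 IH1 IH2.
by move: (n%:R^-1) ((n + k)%:R^-1) ((n + k).+1%:R^-1) => x y z; lra.
Qed.

(** The combination 2 s_n - s_(2n) is governed by the central binomial coefficient, hence by
    [wallis n.*2]. This identifies the limit. *)
Lemma stirling_seq_double n : (0 < n)%N ->
  2^-1 * ln (2 * pi) <= 2 * stirling_seq n - stirling_seq n.*2
    <= 2^-1 * ln (2 * pi) + (4 * n%:R)^-1.
Proof.
move=> n0; have n1 : 1 <= n%:R :> R by rewrite ler1n.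
have y0 : 0 < n%:R :> R by lra.
have pi0 : 0 < pi :> R by exact: pi_gt0.
have w0 := wallis_gt0 n.*2.
have f0 m : 0 < m`!%:R :> R by rewrite ltr0n fact_gt0.
have lw : ln (wallis n.*2) = ln pi - ln 2 +
    (ln (n.*2)`!%:R - 2 * ln n`!%:R - 2 * n%:R * ln 2).
  have e4 : 0 < 4 ^+ n :> R by rewrite exprn_gt0.
  have ln4 : ln 4 = 2 * ln 2 :> R.
    by rewrite mulr_natl -lnXn //; congr ln; ring.
  rewrite wallis_even lnM ?posrE ?divr_gt0 ?mulr_gt0 ?exprn_gt0 //.
  rewrite !ln_div ?posrE ?mulr_gt0 ?exprn_gt0 // lnM ?posrE ?exprn_gt0 //.
  rewrite !lnXn // ln4 -[ln _ *+ 2]mulr_natl -[_ *+ n]mulr_natl.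
  by ring.
have := wallis_sqr_ge n.*2; have := wallis_sqr_le n.*2.
rewrite -(natr1 n.*2) -muln2 natrM muln2.
have z0 : 0 < n%:R * 2 + 1 :> R by lra.
rewrite -[X in is_true X -> _]ler_ln ?posrE ?divr_gt0 ?mulr_gt0 ?exprn_gt0 ?ltr0n ?double_gt0 //.
rewrite -[X in _ -> is_true X -> _]ler_ln ?posrE ?divr_gt0 ?mulr_gt0 ?exprn_gt0 //.
rewrite ln_div ?posrE // ![ln (_ * wallis _ ^+ 2)]lnM ?posrE ?mulr_gt0 ?exprn_gt0 //.
rewrite expr2 [ln (wallis _ * _)]lnM ?posrE // lw [ln (n%:R * 2)]lnM ?posrE // => h1 h2.
have h3 : ln (n%:R * 2 + 1 : R) <= ln n%:R + ln 2 + (2 * n%:R)^-1.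
  rewrite [X in ln X](_ : _ = n%:R * 2 * (1 + (2 * n%:R)^-1)); last first.
    by field; rewrite gt_eqF.
  have i0 : 0 < (2 * n%:R)^-1 :> R by rewrite invr_gt0; lra.
  rewrite !lnM ?posrE ?mulr_gt0 ?addr_gt0 ?lerD2l //.
  by apply: le_ln1Dx; lra.
rewrite /stirling_seq -muln2 natrM muln2 !lnM ?posrE //.
have -> : (4 * n%:R)^-1 = 2^-1 * (2 * n%:R)^-1 :> R by field; rewrite gt_eqF.
move: h1 h2 h3.
by move: (ln n%:R) (ln pi) (ln 2) (ln n`!%:R) (ln (n.*2)`!%:R) => a b c d e; nra.
Qed.

Lemma le_of_le_add_inv (x y c : R) n :
  (forall m, (n <= m)%N -> x <= y + c / m%:R) -> x <= y.
Proof.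
move=> h; rewrite leNgt; apply/negP => yx.
have xy0 : 0 < x - y by lra.
pose m := (maxn n (Num.truncn (`|c| / (x - y))).+1)%N.
have m0 : 0 < m%:R :> R by rewrite ltr0n leq_max orbT.
have := h m (leq_maxl _ _).
have : `|c| / (x - y) < m%:R.
  apply: lt_le_trans (truncnS_gt _) _.
  by rewrite ler_nat leq_maxr.
rewrite ltr_pdivrMr // => h1 h2.
have : (x - y) * m%:R <= c by rewrite -ler_pdivlMr //; lra.
have := ler_norm c; nra.
Qed.

(** Telescope from n to m, compare s_m with the limit by [stirling_seq_double], and let m grow. *)
Lemma stirling n : (0 < n)%N ->
  14^-1 / n%:R <= stirling_seq n - 2^-1 * ln (2 * pi) <= 10^-1 / n%:R.
Proof.
move=> n0; apply/andP; split.
- rewrite lerBrDr addrC -lerBrDr.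
  apply: (@le_of_le_add_inv _ _ (1 : R) n) => m nm.
  have m0 : (0 < m)%N := leq_trans n0 nm.
  have /andP[h1 _] := stirling_seqD (m - n) n0; rewrite subnKC // in h1.
  have /andP[h2 _] := stirling_seq_double m0.
  have := stirling_seqD m m0; rewrite addnn => /andP[h3 h4].
  have : m.*2%:R^-1 = 2^-1 * m%:R^-1 :> R by rewrite -muln2 natrM invfM mulrC.
  have : 0 < m%:R^-1 :> R by rewrite invr_gt0 ltr0n.
  lra.
- rewrite lerBlDr addrC -lerBlDr.
  apply: (@le_of_le_add_inv _ _ (4^-1 : R) n) => m nm.
  have m0 : (0 < m)%N := leq_trans n0 nm.
  have /andP[_ h1] := stirling_seqD (m - n) n0; rewrite subnKC // in h1.
  have /andP[_ h2] := stirling_seq_double m0.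
  have := stirling_seqD m m0; rewrite addnn => /andP[h3 h4].
  have : m.*2%:R^-1 = 2^-1 * m%:R^-1 :> R by rewrite -muln2 natrM invfM mulrC.
  have : 0 < m%:R^-1 :> R by rewrite invr_gt0 ltr0n.
  move: h2; rewrite invfM; lra.
Qed.
End Stirling.

(** * The limiting law of profiles and the quadratic form in the exponent *)

Section Weights.
Variables (R : realFieldType) (alpha : R).
Hypothesis Halpha : alpha ^+ 3 - alpha ^+ 2 - alpha - 1 = 0.

(** For k = 1, 2, 3 these form a probability law, by the equation of alpha; [mean_wgt] is the mean
    part size under it. *)
Definition wgt k : R := alpha^-1 ^+ k.
Definition mean_wgt : R := wgt 1 + 2 * wgt 2 + 3 * wgt 3.

Lemma alpha_gt0 : 0 < alpha. Proof. by have := alpha_lower Halpha; lra. Qed.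

Lemma wgt_gt0 k : 0 < wgt k.
Proof. by rewrite exprn_gt0 // invr_gt0 alpha_gt0. Qed.

Lemma wgt_sum : wgt 1 + wgt 2 + wgt 3 = 1.
Proof.
have a0 := alpha_gt0; have a3 : alpha ^+ 3 != 0 by rewrite expf_neq0 // gt_eqF.
apply: (mulIf a3); rewrite mul1r /wgt !exprS expr0 mulr1.
transitivity (alpha ^+ 2 + alpha + 1); last by move: Halpha; lra.
by field; rewrite gt_eqF.
Qed.

Lemma wgt1_lower : 25 / 46 < wgt 1.
Proof.
have := alpha_upper Halpha; have a0 := alpha_gt0.
by rewrite /wgt expr1 -[25 / 46]invrK invf_div ltf_pV2 ?posrE //; lra.
Qed.

Lemma wgt1_upper : wgt 1 < 31 / 57.
Proof.
have := alpha_lower Halpha; have a0 := alpha_gt0.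
by rewrite /wgt expr1 -[31 / 57]invrK invf_div ltf_pV2 ?posrE //; lra.
Qed.

Lemma wgt2E : wgt 2 = wgt 1 ^+ 2. Proof. by rewrite /wgt expr1. Qed.
Lemma wgt3E : wgt 3 = 1 - wgt 1 - wgt 1 ^+ 2.
Proof. by rewrite -wgt_sum wgt2E; ring. Qed.

(** Completing the square with 3/4 of N q s^2; the term 3 s^2 costs at most 1/20 of it since N q >=
    60, which leaves 1/5. *)
Lemma quad_le (A q s N : R) : 0 < q -> 0 < N -> 60 <= N * q ->
  A * s + 3 * s ^+ 2 - N * q * s ^+ 2 <= A ^+ 2 / q / (3 * N) - 1 / 5 * (N * (q * s ^+ 2)).
Proof.
move=> q0 N0 Nq.
have e : A * s <= A ^+ 2 / q / (3 * N) + 3 / 4 * (N * (q * s ^+ 2)).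
  rewrite -subr_ge0.
  have -> : A ^+ 2 / q / (3 * N) + 3 / 4 * (N * (q * s ^+ 2)) - A * s
     = 3 / 4 * (N * q) * (s - 2 / 3 * A / (N * q)) ^+ 2.
    by field; rewrite !gt_eqF.
  by rewrite mulr_ge0 ?sqr_ge0 //; lra.
have h : 60 * s ^+ 2 <= N * q * s ^+ 2 by rewrite ler_wpM2r ?sqr_ge0.
move: e h; rewrite !mulrA; move: (A * s) (s ^+ 2) => u v.
lra.
Qed.

Lemma wgt_bounds : [/\ 1 / 2 <= wgt 1, 2 / 7 <= wgt 2, 4 / 25 <= wgt 3
  & 8 / 5 <= mean_wgt].
Proof.
rewrite /mean_wgt wgt3E wgt2E; have := wgt1_lower; have := wgt1_upper.
by move: (wgt 1) => x h1 h2; split; nra.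
Qed.

Lemma mean_wgt_gt0 : 0 < mean_wgt.
Proof. by have [_ _ _ h] := wgt_bounds; lra. Qed.

Lemma drift_bounds :
  [/\ `|4 * wgt 1 / mean_wgt - 1| <= 7 / 20, `|8 * wgt 2 / mean_wgt - 1| <= 8 / 17
    & `|12 * wgt 3 / mean_wgt - 1| <= 1 / 5].
Proof.
have m0 := mean_wgt_gt0.
have key (u v : R) : mean_wgt * (1 - v) <= u -> u <= mean_wgt * (1 + v) ->
    `|u / mean_wgt - 1| <= v.
  move=> h1 h2; rewrite ler_norml lerBrDr lerBlDr.
  by rewrite ler_pdivlMr // ler_pdivrMr // ![_ * mean_wgt]mulrC [- v + 1]addrC [v + 1]addrC h1 h2.
move: m0; rewrite /mean_wgt wgt3E wgt2E in key *.
have := wgt1_lower; have := wgt1_upper.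
move: (wgt 1) key => x key h1 h2 m0.
split; apply: key; nra.
Qed.

(** The bases 4 k q_k / mu - 1 are the linear coefficients in w_k - 1 of the exponent below. After
    division by 3N the bound 9/7 becomes 3/7, which must stay below the Stirling gain 19/35. *)
Lemma drift_quadratic :
  (4 * wgt 1 / mean_wgt - 1) ^+ 2 / wgt 1 + (8 * wgt 2 / mean_wgt - 1) ^+ 2 / wgt 2
  + (12 * wgt 3 / mean_wgt - 1) ^+ 2 / wgt 3 <= 9 / 7.
Proof.
have [q1 q2 q3 _] := wgt_bounds; have [d1 d2 d3] := drift_bounds.
have sq (A c q v : R) : `|A| <= c -> 0 < q -> c ^+ 2 <= v * q -> A ^+ 2 / q <= v.
  move=> Ac q0 cv; rewrite ler_pdivrMr //; apply: le_trans cv.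
  by rewrite -[A ^+ 2]real_normK ?num_real // lerXn2r ?nnegrE ?(le_trans _ Ac).
have S1 : (4 * wgt 1 / mean_wgt - 1) ^+ 2 / wgt 1 <= 1 / 4.
  by apply: (sq _ _ _ _ d1) => //; clear -q1; lra.
have S2 : (8 * wgt 2 / mean_wgt - 1) ^+ 2 / wgt 2 <= 7 / 9.
  by apply: (sq _ _ _ _ d2) => //; clear -q2; lra.
have S3 : (12 * wgt 3 / mean_wgt - 1) ^+ 2 / wgt 3 <= 1 / 4.
  by apply: (sq _ _ _ _ d3) => //; clear -q3; lra.
clear - S1 S2 S3; lra.
Qed.

Lemma inv_le_quad (w : R) : 1 / 2 <= w -> w^-1 - 1 <= - (w - 1) + 2 * (w - 1) ^+ 2.
Proof.
move=> h; have w0 : 0 < w by lra.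
rewrite -subr_ge0 (_ : _ - _ = (w - 1) ^+ 2 * (2 - w^-1)); last by field; rewrite gt_eqF.
by rewrite mulr_ge0 ?sqr_ge0 // subr_ge0 -[2]invrK lef_pV2 ?posrE //; lra.
Qed.

Lemma exponent_term (N A q u w : R) : 0 < q -> 0 < N -> 60 <= N * q -> 1 / 2 <= w ->
    A = 2 * u - 1 -> u <= 1 ->
  u * (w ^+ 2 - 1) + (w^-1 - 1) - N * (q * (w - 1) ^+ 2)
  <= A ^+ 2 / q / (3 * N) - 1 / 5 * (N * (q * (w - 1) ^+ 2)).
Proof.
move=> q0 N0 Nq hw uA u1; apply: le_trans (quad_le A (w - 1) q0 N0 Nq).
have i := inv_le_quad hw.
have h : u * (w - 1) ^+ 2 <= (w - 1) ^+ 2 by rewrite ler_piMl ?sqr_ge0.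
have -> : u * (w ^+ 2 - 1) = 2 * u * (w - 1) + u * (w - 1) ^+ 2 by ring.
rewrite uA mulrA; move: i h; move: ((w - 1) ^+ 2) => v.
clear; lra.
Qed.

(** If the proportions of a profile are q_k w_k^2, this is the sum of the squared differences of
    square roots, a squared Hellinger distance to the law q. *)
Definition chi2 w1 w2 w3 : R :=
  wgt 1 * (w1 - 1) ^+ 2 + wgt 2 * (w2 - 1) ^+ 2 + wgt 3 * (w3 - 1) ^+ 2.

Lemma exponent_bound N w1 w2 w3 : 400 <= N ->
    1 / 2 <= w1 -> 1 / 2 <= w2 -> 1 / 2 <= w3 ->
  2 * ((wgt 1 * w1 ^+ 2 + 2 * (wgt 2 * w2 ^+ 2) + 3 * (wgt 3 * w3 ^+ 2)) / mean_wgt - 1)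
  + (w1^-1 - 1) + (w2^-1 - 1) + (w3^-1 - 1) - N * chi2 w1 w2 w3
  <= 3 / 7 / N - 1 / 5 * (N * chi2 w1 w2 w3).
Proof.
move=> N4 h1 h2 h3.
have [q1 q2 q3 mb] := wgt_bounds.
have m0 := mean_wgt_gt0.
have N0 : 0 < N by clear -N4; lra.
have Nw q : 4 / 25 <= q -> 60 <= N * q by clear -N4 => qb; nra.
have dq : 9 / 7 / (3 * N) = 3 / 7 / N :> R by clear -N0; field; rewrite gt_eqF.
have := drift_quadratic; rewrite -(ler_pM2r (_ : 0 < (3 * N)^-1)); last first.
  by rewrite invr_gt0 mulr_gt0.
rewrite dq => dquad.
have ws := wgt_sum.
have n1 : 60 <= N * wgt 1 by apply: Nw; lra.
have n2 : 60 <= N * wgt 2 by apply: Nw; lra.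
have n3 : 60 <= N * wgt 3 by exact: Nw.
have u1 : 2 * wgt 1 / mean_wgt <= 1 by rewrite ler_pdivrMr // mul1r /mean_wgt; lra.
have u2 : 4 * wgt 2 / mean_wgt <= 1 by rewrite ler_pdivrMr // mul1r /mean_wgt; lra.
have u3 : 6 * wgt 3 / mean_wgt <= 1 by rewrite ler_pdivrMr // mul1r /mean_wgt; lra.
have T1 := exponent_term (wgt_gt0 1) N0 n1 h1 erefl u1.
have T2 := exponent_term (wgt_gt0 2) N0 n2 h2 erefl u2.
have T3 := exponent_term (wgt_gt0 3) N0 n3 h3 erefl u3.
have E : 2 * ((wgt 1 * w1 ^+ 2 + 2 * (wgt 2 * w2 ^+ 2) + 3 * (wgt 3 * w3 ^+ 2)) / mean_wgt - 1)
  = 2 * wgt 1 / mean_wgt * (w1 ^+ 2 - 1) + 4 * wgt 2 / mean_wgt * (w2 ^+ 2 - 1)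
  + 6 * wgt 3 / mean_wgt * (w3 ^+ 2 - 1).
  have e : mean_wgt / mean_wgt = 1 by rewrite divff ?gt_eqF.
  rewrite -[X in _ - X]e {2}/mean_wgt; move: (mean_wgt^-1) => v; ring.
rewrite E /chi2; move: T1 T2 T3 dquad.
have A1 : 2 * (2 * wgt 1 / mean_wgt) = 4 * wgt 1 / mean_wgt by rewrite !mulrA -natrM.
have A2 : 2 * (4 * wgt 2 / mean_wgt) = 8 * wgt 2 / mean_wgt by rewrite !mulrA -natrM.
have A3 : 2 * (6 * wgt 3 / mean_wgt) = 12 * wgt 3 / mean_wgt by rewrite !mulrA -natrM.
have C3 (a b c : R) : N * (a + b + c) = N * a + N * b + N * c by ring.
have D3 (a b c d : R) : (a + b + c) * d = a * d + b * d + c * d by ring.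
rewrite A1 A2 A3 C3 D3.
move: (_ / wgt 1 / _) (_ / wgt 2 / _) (_ / wgt 3 / _) => a1 a2 a3.
move: (_ * (w1 ^+ 2 - 1)) (_ * (w2 ^+ 2 - 1)) (_ * (w3 ^+ 2 - 1)) => b1 b2 b3.
move: (N * (wgt 1 * _)) (N * (wgt 2 * _)) (N * (wgt 3 * _)) => c1 c2 c3.
move: (w1^-1) (w2^-1) (w3^-1) (3 / 7 / N) => v1 v2 v3 v.
by clear -R; lra.
Qed.
End Weights.

(** * Logarithm of a coefficient near the peak *)

Section LogTrinom.
Variables (R : realType) (alpha : R).
Hypothesis Halpha : alpha ^+ 3 - alpha ^+ 2 - alpha - 1 = 0.
Local Notation q := (wgt alpha).
Local Notation mu := (mean_wgt alpha).

(** At proportions q the trinomial is about alpha^n / (2 pi N sqrt(q_1 q_2 q_3)) with q_1 q_2 q_3 =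
    alpha^-6; the factor n/N and N = n/mu contribute one mu each. *)
Definition peak : R := mu ^+ 2 * alpha ^+ 3 / (2 * pi).
Definition power_coef (a b c : nat) : R :=
  (a + 2 * b + 3 * c)%:R / (a + b + c)%:R * trinom R a b c.
Definition stirling_err (n : nat) : R := stirling_seq R n - 2^-1 * ln (2 * pi).

Let a0 : 0 < alpha := alpha_gt0 Halpha.
Let q0 k : 0 < q k := wgt_gt0 Halpha k.
Let mu0 : 0 < mu := mean_wgt_gt0 Halpha.

Lemma peak_gt0 : 0 < peak.
Proof. by rewrite divr_gt0 ?mulr_gt0 ?exprn_gt0 ?pi_gt0. Qed.

Lemma ln_wgt k : ln (q k) = - (k%:R * ln alpha).
Proof. by rewrite /wgt lnXn ?invr_gt0 // lnV ?posrE // mulNrn mulr_natl. Qed.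

Lemma ln_fact n : ln n`!%:R = (n%:R + 2^-1) * ln n%:R - n%:R
                   + 2^-1 * ln (2 * pi) + stirling_err n :> R.
Proof. by rewrite /stirling_err /stirling_seq; ring. Qed.

Lemma ln_power_coef (a b c : nat) (w1 w2 w3 : R) :
    (0 < a)%N -> (0 < b)%N -> (0 < c)%N -> 0 < w1 -> 0 < w2 -> 0 < w3 ->
    let N : R := (a + b + c)%:R in let n : R := (a + 2 * b + 3 * c)%:R in
    a%:R = N * (q 1 * w1 ^+ 2) -> b%:R = N * (q 2 * w2 ^+ 2) ->
    c%:R = N * (q 3 * w3 ^+ 2) ->
  ln (power_coef a b c) = ln peak + n * ln alpha - ln n + 2 * ln (n / N / mu)
    - (2 * a%:R + 1) * ln w1 - (2 * b%:R + 1) * ln w2 - (2 * c%:R + 1) * ln w3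
    + (stirling_err (a + b + c) - stirling_err a - stirling_err b - stirling_err c).
Proof.
move=> a1 b1 c1 w10 w20 w30 N n Ea Eb Ec.
have N0 : 0 < N by rewrite ltr0n; lia.
have n0 : 0 < n by rewrite ltr0n; lia.
have f0 m : 0 < m`!%:R :> R by rewrite ltr0n fact_gt0.
have lw (w : R) k : 0 < w -> ln (N * (q k * w ^+ 2)) = ln N - k%:R * ln alpha + 2 * ln w.
  move=> w0; have ww : 0 < w ^+ 2 by rewrite exprn_gt0.
  rewrite [LHS]lnM ?posrE ?mulr_gt0 // [ln (q k * _)]lnM ?posrE // lnXn // ln_wgt.
  by rewrite -mulr_natl; ring.
have la := lw _ 1%N w10; rewrite -Ea in la.
have lb := lw _ 2%N w20; rewrite -Eb in lb.
have lc := lw _ 3%N w30; rewrite -Ec in lc.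
have lT : ln (power_coef a b c) =
    ln n - ln N + (ln (a + b + c)`!%:R - (ln a`!%:R + ln b`!%:R + ln c`!%:R)).
  rewrite /power_coef /trinom lnM ?posrE ?divr_gt0 ?mulr_gt0 // -/N -/n.
  congr (_ + _); first by rewrite ln_div.
  rewrite ln_div ?posrE ?mulr_gt0 //; congr (_ - _).
  by rewrite lnM ?posrE ?mulr_gt0 // lnM ?posrE.
have lmu : ln (n / N / mu) = ln n - ln N - ln mu.
  by rewrite ln_div ?posrE ?divr_gt0 // ln_div.
have lp : ln peak = 2 * ln mu + 3 * ln alpha - ln (2 * pi).
  rewrite /peak ln_div ?posrE ?mulr_gt0 ?exprn_gt0 ?pi_gt0 //; congr (_ - _).
  by rewrite lnM ?posrE ?exprn_gt0 // !lnXn // -!(mulr_natl (ln _)).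
rewrite lT lmu lp !ln_fact la lb lc -/N.
have nE : n = a%:R + 2 * b%:R + 3 * c%:R by rewrite /n natrD natrD !natrM.
have NE : N = a%:R + b%:R + c%:R by rewrite /N !natrD.
move: (ln n) (ln N) => ln_n ln_N.
by rewrite nE NE; field.
Qed.

Lemma stirling_err_bounds m : (0 < m)%N ->
  14^-1 / m%:R <= stirling_err m <= 10^-1 / m%:R.
Proof. exact: stirling. Qed.

(** By the harmonic mean inequality 1/a + 1/b + 1/c >= 9/N, and 1/10 - 9/14 = -19/35. *)
Lemma stirling_err_sum (a b c : nat) : (0 < a)%N -> (0 < b)%N -> (0 < c)%N ->
  stirling_err (a + b + c) - stirling_err a - stirling_err b - stirling_err c
  <= - (19 / 35) / (a + b + c)%:R.
Proof.
move=> a1 b1 c1; have abc : (0 < a + b + c)%N by lia.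
have /andP[_ hN] := stirling_err_bounds abc.
have /andP[ha _] := stirling_err_bounds a1.
have /andP[hb _] := stirling_err_bounds b1.
have /andP[hc _] := stirling_err_bounds c1.
have harm (x y z : R) : 0 < x -> 0 < y -> 0 < z ->
    9 / (x + y + z) <= x^-1 + y^-1 + z^-1.
  move=> x0 y0 z0; have s0 : 0 < x + y + z by rewrite !addr_gt0.
  rewrite ler_pdivrMr // -subr_ge0.
  have -> : (x^-1 + y^-1 + z^-1) * (x + y + z) - 9 =
     (x - y) ^+ 2 / (x * y) + (x - z) ^+ 2 / (x * z) + (y - z) ^+ 2 / (y * z).
    by field; rewrite !gt_eqF.
  by rewrite !addr_ge0 // divr_ge0 ?sqr_ge0 // ltW // mulr_gt0.
have a2 : 0 < a%:R :> R by rewrite ltr0n.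
have b2 : 0 < b%:R :> R by rewrite ltr0n.
have c2 : 0 < c%:R :> R by rewrite ltr0n.
have := harm _ _ _ a2 b2 c2; rewrite -!natrD.
move: hN ha hb hc; move: (a%:R^-1) (b%:R^-1) (c%:R^-1) ((a + b + c)%:R^-1) => x y z t.
by clear; lra.
Qed.

Lemma ln_le_sub1 (x : R) : 0 < x -> ln x <= x - 1.
Proof. by move=> x0; have := @le_ln1Dx R (x - 1); rewrite subrKC; apply; lra. Qed.

Lemma ln_ge_sub1 (x : R) : 0 < x -> 1 - x^-1 <= ln x.
Proof.
move=> x0; have := @ln_le_sub1 x^-1; rewrite invr_gt0 lnV ?posrE // => /(_ x0); lra.
Qed.

(** This fixes the sign of the second-order term: 3/7 - 19/35 = -4/35, which is below -1/10.
    Parametrizing by square roots w_k makes the entropy term exactly minus N times [chi2] after the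
    bound ln w >= 1 - 1/w. *)
Lemma power_coef_near (a b c : nat) (w1 w2 w3 : R) :
    1 / 2 <= w1 -> 1 / 2 <= w2 -> 1 / 2 <= w3 ->
    let N : R := (a + b + c)%:R in let n : R := (a + 2 * b + 3 * c)%:R in
    400 <= N ->
    a%:R = N * (q 1 * w1 ^+ 2) -> b%:R = N * (q 2 * w2 ^+ 2) ->
    c%:R = N * (q 3 * w3 ^+ 2) ->
  ln (power_coef a b c) <= ln peak + n * ln alpha - ln n
    - 1 / 10 / N - 1 / 5 * (N * chi2 alpha w1 w2 w3).
Proof.
move=> h1 h2 h3 N n N4 Ea Eb Ec.
have N0 : 0 < N by lra.
have wp (w : R) : 1 / 2 <= w -> 0 < w by lra.
have pos m k (w : R) : 1 / 2 <= w -> m%:R = N * (q k * w ^+ 2) -> (0 < m)%N.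
  by move=> hw e; rewrite -(ltr0n R) e mulr_gt0 // mulr_gt0 // exprn_gt0 // wp.
have a1 := pos _ _ _ h1 Ea; have b1 := pos _ _ _ h2 Eb; have c1 := pos _ _ _ h3 Ec.
have [w10 w20 w30] := And3 (wp _ h1) (wp _ h2) (wp _ h3).
have n0 : 0 < n by rewrite ltr0n -addnA addn_gt0 a1.
rewrite (ln_power_coef a1 b1 c1 w10 w20 w30 Ea Eb Ec) -/N -/n.
have E := exponent_bound Halpha N4 h1 h2 h3.
have S := stirling_err_sum a1 b1 c1; rewrite -/N in S.
have nE : n = a%:R + 2 * b%:R + 3 * c%:R by rewrite /n natrD natrD !natrM.
have NE : N = a%:R + b%:R + c%:R by rewrite /N !natrD.
clearbody N n.
have nN : n / N = q 1 * w1 ^+ 2 + 2 * (q 2 * w2 ^+ 2) + 3 * (q 3 * w3 ^+ 2).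
  by rewrite nE Ea Eb Ec; field; rewrite gt_eqF.
have L : ln (n / N / mu) <= n / N / mu - 1 by apply: ln_le_sub1; rewrite !divr_gt0.
have ws : q 1 * w1 ^+ 2 + q 2 * w2 ^+ 2 + q 3 * w3 ^+ 2 = 1.
  by apply: (mulfI (lt0r_neq0 N0)); rewrite mulr1 !mulrDr -Ea -Eb -Ec.
have D (m : nat) k (w : R) : 1 / 2 <= w -> m%:R = N * (q k * w ^+ 2) ->
    - ((2 * m%:R + 1) * ln w) <= (w^-1 - 1) + 2 * N * (q k * w - q k * w ^+ 2).
  move=> hw e; have w0 := wp _ hw.
  have -> : (w^-1 - 1) + 2 * N * (q k * w - q k * w ^+ 2) = - ((2 * m%:R + 1) * (1 - w^-1)).
    by rewrite e; field; rewrite gt_eqF.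
  by rewrite lerN2 ler_wpM2l ?ln_ge_sub1 // addr_ge0 // mulr_ge0.
have D1 := D _ _ _ h1 Ea; have D2 := D _ _ _ h2 Eb; have D3 := D _ _ _ h3 Ec.
(* Both the q_k w_k^2 and the q_k sum to 1, so the linear terms combine to a sum of squares. *)
have C2 : 2 * N * (q 1 * w1 - q 1 * w1 ^+ 2) + 2 * N * (q 2 * w2 - q 2 * w2 ^+ 2)
   + 2 * N * (q 3 * w3 - q 3 * w3 ^+ 2) = - (N * chi2 alpha w1 w2 w3).
  have q1 := wgt_sum Halpha.
  have -> : N * chi2 alpha w1 w2 w3 =
     N * ((q 1 * w1 ^+ 2 + q 2 * w2 ^+ 2 + q 3 * w3 ^+ 2) + (q 1 + q 2 + q 3)
       - 2 * (q 1 * w1 + q 2 * w2 + q 3 * w3)) by rewrite /chi2; ring.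
  transitivity (2 * N * ((q 1 * w1 + q 2 * w2 + q 3 * w3)
     - (q 1 * w1 ^+ 2 + q 2 * w2 ^+ 2 + q 3 * w3 ^+ 2))); first by ring.
  by rewrite ws q1; ring.
rewrite nN in L *.
move: L E S D1 D2 D3 C2.
set X1 := 2 * N * _; set X2 := 2 * N * _; set X3 := 2 * N * _.
set Y1 := (_ + 1) * ln w1; set Y2 := (_ + 1) * ln w2; set Y3 := (_ + 1) * ln w3.
set l := ln (_ / mu); set m := _ / mu; set chi := N * chi2 _ _ _ _.
set st := _ - stirling_err c.
clearbody X1 X2 X3 Y1 Y2 Y3 l m chi st.
move: (w1^-1) (w2^-1) (w3^-1) (n * ln alpha) => v1 v2 v3 v.
have : 0 < N^-1 by rewrite invr_gt0.
move: (ln peak) (ln n) (N^-1) => p1 p2 p3.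
by clear; lra.
Qed.
End LogTrinom.

Lemma weight_gt0 (a b c : nat) : (0 < a + 2 * b + 3 * c)%N = (0 < a + b + c)%N.
Proof. by lia. Qed.

(** * Upper bounds for the coefficients of power sums *)

Section PowerCoefBounds.
Variables (R : realType) (alpha : R).
Hypothesis Halpha : alpha ^+ 3 - alpha ^+ 2 - alpha - 1 = 0.
Local Notation q := (wgt alpha).
Local Notation mu := (mean_wgt alpha).
Local Notation T := (power_coef R).
Local Notation pk := (peak alpha).
Implicit Types a b c n : nat.

Let a0 : 0 < alpha := alpha_gt0 Halpha.
Let q0 k : 0 < q k := wgt_gt0 Halpha k.
Let mu0 : 0 < mu := mean_wgt_gt0 Halpha.
Let pk0 : 0 < pk := peak_gt0 Halpha.

Definition growth n : R := alpha ^+ n / n%:R.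

Lemma growth_gt0 n : (0 < n)%N -> 0 < growth n.
Proof. by move=> n0; rewrite divr_gt0 ?exprn_gt0 ?ltr0n. Qed.

Lemma power_coef_ge0 a b c : 0 <= T a b c.
Proof. by apply: mulr_ge0; [exact: divr_ge0 | exact/ltW/trinom_gt0]. Qed.

Lemma wgt_weight a b c : q 1 ^+ a * q 2 ^+ b * q 3 ^+ c = alpha ^- (a + 2 * b + 3 * c).
Proof. by rewrite /wgt -!exprM -!exprD -exprVn mul1n. Qed.

Lemma power_coef_ratio a b c : (0 < a + b + c)%N -> T a b c <= 3 * trinom R a b c.
Proof.
move=> N0; rewrite /power_coef ler_wpM2r ?(ltW (trinom_gt0 _ _ _ _)) //.
by rewrite ler_pdivrMr ?ltr0n // -natrM ler_nat; lia.
Qed.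

Lemma trinom_trivial a b c : trinom R a b c <= alpha ^+ (a + 2 * b + 3 * c).
Proof.
have := trinom_le a b c (ltW (q0 1)) (ltW (q0 2)) (ltW (q0 3)).
by rewrite wgt_weight (wgt_sum Halpha) expr1n ler_pdivrMr ?exprn_gt0 // mul1r.
Qed.

Lemma two_le_expR : 2 <= expR 1 :> R.
Proof. by have := expR_ge1Dx (1 : R); rewrite -natr1. Qed.

Lemma sub_half_pow (x : R) a N : 0 < x -> x <= 1 -> 4 * a%:R <= N%:R * x ->
  2 ^+ a * (1 - x / 2) ^+ N <= expR (- (N%:R * x / 4)).
Proof.
move=> x0 x1 h.
have e1 : 2 ^+ a <= expR a%:R :> R.
  have := expRM_natl a (1 : R); rewrite mulr1 => ->.
  by rewrite lerXn2r ?nnegrE ?expR_ge0 ?two_le_expR.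
have e2 : (1 - x / 2) ^+ N <= expR (- (N%:R * (x / 2))).
  have := expRM_natl N (- (x / 2)); rewrite mulrN => ->.
  rewrite lerXn2r ?nnegrE ?expR_ge0 //; first lra.
  by have := expR_ge1Dx (- (x / 2)).
apply: le_trans (ler_pM _ _ e1 e2) _; rewrite ?exprn_ge0 //; first lra.
by rewrite -expRD ler_expR; lra.
Qed.

(** A Chernoff bound: halving the weight of the deficient part in [trinom_le] gains a factor
    exponential in N. *)
Lemma trinom_far a b c :
    let N := (a + b + c)%N in
    4 * a%:R <= N%:R * q 1 \/ 4 * b%:R <= N%:R * q 2 \/ 4 * c%:R <= N%:R * q 3 ->
  trinom R a b c <= alpha ^+ (a + 2 * b + 3 * c) * expR (- (N%:R / 25)).
Proof.
move=> N h; have [b1 b2 b3 _] := wgt_bounds Halpha.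
have s := wgt_sum Halpha.
have q10 := q0 1; have q20 := q0 2; have q30 := q0 3.
have fin (k e : nat) : 4 / 25 <= q k -> q k <= 1 -> 4 * e%:R <= N%:R * q k ->
   trinom R a b c * (q 1 ^+ a * q 2 ^+ b * q 3 ^+ c) <= 2 ^+ e * (1 - q k / 2) ^+ N ->
   trinom R a b c <= alpha ^+ (a + 2 * b + 3 * c) * expR (- (N%:R / 25)).
  move=> qk qk1 he; rewrite wgt_weight => h1.
  rewrite mulrC -ler_pdivrMr ?exprn_gt0 //; apply: le_trans h1 _.
  apply: le_trans (sub_half_pow (q0 k) qk1 he) _.
  rewrite ler_expR lerN2 -mulrA ler_wpM2l //; lra.
have half (x : R) (e : nat) : 2 ^+ e * (x / 2) ^+ e = x ^+ e.
  by rewrite -exprMn mulrC divfK ?pnatr_eq0.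
case: h => [h|[h|h]].
- apply: (fin 1%N a) => //; try lra.
  have := trinom_le a b c (ltW (divr_gt0 q10 (ltr0Sn R 1))) (ltW q20) (ltW q30).
  rewrite -[X in _ -> _ * (X * _ * _) <= _](half _ a).
  have -> : q 1 / 2 + q 2 + q 3 = 1 - q 1 / 2 by lra.
  rewrite -(ler_pM2l (exprn_gt0 a (ltr0Sn R 1))) => h1; apply: le_trans h1.
  by rewrite le_eqVlt; apply/orP; left; apply/eqP; ring.
- apply: (fin 2%N b) => //; try lra.
  have := trinom_le a b c (ltW q10) (ltW (divr_gt0 q20 (ltr0Sn R 1))) (ltW q30).
  rewrite -[X in _ -> _ * (_ * X * _) <= _](half _ b).
  have -> : q 1 + q 2 / 2 + q 3 = 1 - q 2 / 2 by lra.
  rewrite -(ler_pM2l (exprn_gt0 b (ltr0Sn R 1))) => h1; apply: le_trans h1.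
  by rewrite le_eqVlt; apply/orP; left; apply/eqP; ring.
- apply: (fin 3%N c) => //; try lra.
  have := trinom_le a b c (ltW q10) (ltW q20) (ltW (divr_gt0 q30 (ltr0Sn R 1))).
  rewrite -[X in _ -> _ * (_ * X) <= _](half _ c).
  have -> : q 1 + q 2 + q 3 / 2 = 1 - q 3 / 2 by lra.
  rewrite -(ler_pM2l (exprn_gt0 c (ltr0Sn R 1))) => h1; apply: le_trans h1.
  by rewrite le_eqVlt; apply/orP; left; apply/eqP; ring.
Qed.

Lemma power_coef_far : exists2 K : R, 0 < K & forall a b c,
    let N := (a + b + c)%N in let n := (a + 2 * b + 3 * c)%N in
    (0 < n)%N ->
    4 * a%:R <= N%:R * q 1 \/ 4 * b%:R <= N%:R * q 2 \/ 4 * c%:R <= N%:R * q 3 ->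
  T a b c <= K * (growth n / n%:R).
Proof.
exists (3 * (2 * (75 * 75))) => [|a b c N n n0 h]; first lra.
have N0 : (0 < N)%N by rewrite /N; move: n0; rewrite /n; lia.
apply: le_trans (power_coef_ratio N0) _; rewrite -[leRHS]mulrA ler_pM2l //.
apply: le_trans (trinom_far h) _; rewrite -/N -/n.
rewrite /growth mulrA [_ * (alpha ^+ n / _)]mulrCA -!mulrA ler_pM2l ?exprn_gt0 //.
have n00 : 0 < n%:R :> R by rewrite ltr0n.
have Nn : n%:R / 75 <= N%:R / 25 :> R.
  have : n%:R <= 3 * N%:R :> R by rewrite -natrM ler_nat /n /N; lia.
  lra.
have y0 : 0 < n%:R / 75 :> R by rewrite divr_gt0.
have e1 : expR (- (N%:R / 25)) <= expR (- (n%:R / 75)) :> R by rewrite ler_expR lerN2.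
apply: le_trans e1 _; rewrite expRN.
have e2 := expR_ge1Dxn 1 (ltW y0).
have e3 : (n%:R / 75) ^+ 2 / 2 <= expR (n%:R / 75) :> R.
  by apply: le_trans e2; rewrite ler_wpDl.
have z0 : 0 < (n%:R / 75) ^+ 2 / 2 :> R by rewrite divr_gt0 ?exprn_gt0.
rewrite -lef_pV2 ?posrE ?expR_gt0 // in e3; apply: le_trans e3 _.
by rewrite le_eqVlt; apply/orP; left; apply/eqP; field; rewrite gt_eqF.
Qed.

Lemma exp_ln_power_coef (t : R) a b c : let n := (a + 2 * b + 3 * c)%N in
    (0 < n)%N -> ln (T a b c) <= ln pk + n%:R * ln alpha - ln n%:R + t ->
  T a b c <= pk * growth n * expR t.
Proof.
move=> n n0 h; have N0 : (0 < a + b + c)%N by rewrite -weight_gt0.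
have T0 : 0 < T a b c.
  by apply: mulr_gt0; [rewrite divr_gt0 ?ltr0n | exact: trinom_gt0].
have n00 : 0 < n%:R :> R by rewrite ltr0n.
rewrite -ler_expR lnK ?posrE // in h; apply: le_trans h _.
rewrite expRD expRB !expRD (lnK (pk0 : pk \in Num.pos)) expRM_natl.
by rewrite !lnK ?posrE // /growth mulrA.
Qed.

(** The witness is the square root of m / (N q_k); it is at least 1/2 precisely because the part has
    at least a quarter of its expected share. *)
Lemma sqrt_ratio (N : R) (m k : nat) : 0 < N ->
    N * q k <= 4 * m%:R -> q k <= 1 -> m%:R <= N ->
  exists2 w : R, 1 / 2 <= w & m%:R = N * (q k * w ^+ 2) /\
    (m%:R / N - q k) ^+ 2 <= 4 * (q k * (w - 1) ^+ 2).
Proof.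
move=> N0 hm qk1 mN; pose y := m%:R / (N * q k).
have Nq : 0 < N * q k by rewrite mulr_gt0.
have y1 : 1 / 4 <= y by rewrite ler_pdivlMr //; lra.
have sy : Num.sqrt y ^+ 2 = y by rewrite sqr_sqrtr //; lra.
have sy0 := sqrtr_ge0 y.
have mE : m%:R = N * (q k * Num.sqrt y ^+ 2).
  by rewrite sy /y mulrA mulrC divfK ?gt_eqF.
exists (Num.sqrt y); first by nra.
split=> //; move: (Num.sqrt y) sy0 mE => w w0 mE.
have qw : q k * w ^+ 2 <= 1.
  by rewrite -(ler_pM2l N0) mulr1 -mE.
have -> : m%:R / N - q k = q k * ((w - 1) * (w + 1)).
  by rewrite mE; field; rewrite gt_eqF.
have -> : (q k * ((w - 1) * (w + 1))) ^+ 2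
   = (q k * (w + 1) ^+ 2) * (q k * (w - 1) ^+ 2) by ring.
apply: ler_wpM2r; first by rewrite mulr_ge0 ?sqr_ge0 ?ltW.
have : (w + 1) ^+ 2 <= 2 * w ^+ 2 + 2 by have := sqr_ge0 (w - 1); nra.
rewrite -(ler_pM2l (q0 k)) => h; apply: le_trans h _.
by rewrite mulrDr mulrCA; lra.
Qed.

Lemma power_coef_near_exp a b c :
    let N : R := (a + b + c)%:R in let n := (a + 2 * b + 3 * c)%N in
    400 <= N -> N * q 1 <= 4 * a%:R -> N * q 2 <= 4 * b%:R -> N * q 3 <= 4 * c%:R ->
  exists2 chi : R, T a b c <= pk * growth n * expR (- (1 / 10 / N) - 1 / 5 * (N * chi)) &
    [/\ (a%:R / N - q 1) ^+ 2 <= 4 * chi, (b%:R / N - q 2) ^+ 2 <= 4 * chi &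
        (c%:R / N - q 3) ^+ 2 <= 4 * chi].
Proof.
move=> N n N4 ha hb hc.
have N0 : 0 < N by lra.
have ws := wgt_sum Halpha.
have [q10 q20 q30] := And3 (q0 1) (q0 2) (q0 3).
have NE : N = a%:R + b%:R + c%:R by rewrite /N !natrD.
have [a1 b1 c1] : [/\ 0 <= a%:R :> R, 0 <= b%:R :> R & 0 <= c%:R :> R] by [].
have [na nb nc] : [/\ a%:R <= N, b%:R <= N & c%:R <= N] by split; lra.
have [l1 l2 l3] : [/\ q 1 <= 1, q 2 <= 1 & q 3 <= 1] by split; lra.
have [w1 h1 [E1 D1]] := sqrt_ratio N0 ha l1 na.
have [w2 h2 [E2 D2]] := sqrt_ratio N0 hb l2 nb.
have [w3 h3 [E3 D3]] := sqrt_ratio N0 hc l3 nc.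
have key := power_coef_near Halpha h1 h2 h3 N4 E1 E2 E3.
exists (chi2 alpha w1 w2 w3).
  apply: exp_ln_power_coef.
    by rewrite weight_gt0 -(ltr0n R).
  by apply: le_trans key _; rewrite -/N -/n addrA.
have p (k : nat) (w : R) : 0 <= q k * (w - 1) ^+ 2 by rewrite mulr_ge0 ?sqr_ge0 ?ltW.
have [p1 p2 p3] := And3 (p 1%N w1) (p 2%N w2) (p 3%N w3).
by rewrite /chi2; split; [apply: le_trans D1 _|apply: le_trans D2 _|apply: le_trans D3 _]; lra.
Qed.
End PowerCoefBounds.

Lemma eventually_ge (R : realType) (x : R) :
  exists n0 : nat, forall n, (n0 <= n)%N -> (0 < n)%N /\ x <= n%:R.
Proof.
exists (Num.truncn `|x|).+1 => n n0; split; first exact: leq_trans n0.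
apply: le_trans (ler_norm x) _; apply: ltW; apply: lt_le_trans (truncnS_gt _) _.
by rewrite ler_nat.
Qed.

Lemma expRN_le_inv (R : realType) (y : R) : 0 <= y -> expR (- y) <= (1 + y)^-1.
Proof.
move=> y0; rewrite expRN lef_pV2 ?posrE ?expR_gt0 ?expR_ge1Dx //; lra.
Qed.

Lemma expRN_le_half (R : realType) (y : R) : 0 <= y <= 1 -> expR (- y) <= 1 - y / 2.
Proof.
move=> /andP[y0 y1]; apply: le_trans (expRN_le_inv y0) _.
rewrite -[leLHS]mul1r ler_pdivrMr; nra.
Qed.

Lemma lorentz_tail_le (R : realFieldType) (p g eps N x : R) : 0 < g -> 0 < eps -> 0 < N ->
  5 * (p / eps) ^+ 2 <= N -> p * g * (1 + N * x ^+ 2 / 20)^-1 * x <= eps * g.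
Proof.
move=> g0 e0 N0 h5; set y := N * x ^+ 2 / 20.
have y0 : 0 <= y by apply: divr_ge0 => //; apply: mulr_ge0; [exact: ltW|exact: sqr_ge0].
rewrite mulrAC ler_pdivrMr; last by lra.
have -> : p = (p / eps) * eps by rewrite divfK ?gt_eqF.
rewrite /y; move: (p / eps) h5 => r h5.
have -> : r * eps * g * x = eps * g * (r * x) by ring.
rewrite ler_pM2l ?mulr_gt0 //.
have h6 : 5 * r ^+ 2 * x ^+ 2 <= N * x ^+ 2 by rewrite ler_wpM2r ?sqr_ge0.
have := sqr_ge0 (r * x - 2).
have -> : (r * x - 2) ^+ 2 = r ^+ 2 * x ^+ 2 - 4 * (r * x) + 4 by ring.
by move: h6; lra.
Qed.

Section Asymptotics.
Variables (R : realType) (alpha : R).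
Hypothesis Halpha : alpha ^+ 3 - alpha ^+ 2 - alpha - 1 = 0.
Local Notation q := (wgt alpha).
Local Notation mu := (mean_wgt alpha).
Local Notation T := (power_coef R).
Local Notation pk := (peak alpha).
Local Notation growth := (growth alpha).
Implicit Types a b c n : nat.

Let a0 : 0 < alpha := alpha_gt0 Halpha.
Let q0 k : 0 < q k := wgt_gt0 Halpha k.
Let mu0 : 0 < mu := mean_wgt_gt0 Halpha.
Let pk0 : 0 < pk := peak_gt0 Halpha.

(** Either some part falls below a quarter of its share and the coefficient is smaller by a factor
    n, or the Gaussian-type bound around the peak applies. *)
Lemma power_coef_dichotomy : exists K : R, exists n0 : nat, 0 < K /\
  forall a b c, let N := (a + b + c)%N in let n := (a + 2 * b + 3 * c)%N in
  (n0 <= n)%N ->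
  T a b c <= K * (growth n / n%:R) \/
  exists2 chi : R, T a b c <= pk * growth n * expR (- (1 / 10 / N%:R) - 1 / 5 * (N%:R * chi)) &
    [/\ (a%:R / N%:R - q 1) ^+ 2 <= 4 * chi, (b%:R / N%:R - q 2) ^+ 2 <= 4 * chi &
        (c%:R / N%:R - q 3) ^+ 2 <= 4 * chi].
Proof.
have [K K0 far] := power_coef_far Halpha.
have [n0 n0P] := eventually_ge (3 * 400 : R).
exists K, n0; split=> // a b c N n nn0.
have [n1 n400] := n0P _ nn0.
have N400 : 400 <= N%:R :> R.
  have : n%:R <= 3 * N%:R :> R by rewrite -natrM ler_nat /n /N; clear; lia.
  lra.
case: (leP (4 * a%:R) (N%:R * q 1)) => ha; first by left; apply: far => //; left.
case: (leP (4 * b%:R) (N%:R * q 2)) => hb; first by left; apply: far => //; right; left.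
case: (leP (4 * c%:R) (N%:R * q 3)) => hc; first by left; apply: far => //; right; right.
by right; apply: power_coef_near_exp => //; apply: ltW.
Qed.

(** The 1/20 comes from the -1/(10 N) of [power_coef_near], using N <= n and exp(-y) <= 1 - y/2 on
    [0, 1]. *)
Lemma power_coef_le_sharp : exists n0 : nat, forall a b c,
  let n := (a + 2 * b + 3 * c)%N in (n0 <= n)%N ->
  T a b c <= growth n * (pk - pk / 20 / n%:R).
Proof.
have [K [n0 [K0 dich]]] := power_coef_dichotomy.
have [n1 n1P] := eventually_ge (K / pk * 2).
exists (maxn n0 n1) => a b c n; rewrite geq_max => /andP[nn0 nn1].
have [n_gt0 nK] := n1P _ nn1.
have nr : 1 <= n%:R :> R by rewrite ler1n.
have ni : 0 < n%:R^-1 :> R by rewrite invr_gt0; lra.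
have ni1 : n%:R^-1 <= 1 :> R by rewrite invf_le1 ?ltr0n.
have g0 : 0 < growth n by apply: growth_gt0.
have N0 : (0 < a + b + c)%N by rewrite -weight_gt0.
case: (dich a b c nn0) => [h|[chi h [c1 _ _]]]; apply: le_trans h _.
  rewrite mulrCA ler_pM2l //.
  have : K * n%:R^-1 <= pk / 2.
    by rewrite ler_pdivrMr ?ltr0n //; move: nK; rewrite mulrAC ler_pdivrMr //; nra.
  have : pk * n%:R^-1 <= pk by rewrite ler_piMr // ltW.
  nra.
have e : expR (- (1 / 10 / (a + b + c)%:R) - 1 / 5 * ((a + b + c)%:R * chi))
         <= 1 - 1 / 10 / n%:R / 2.
  apply: le_trans (expRN_le_half _); last first.
    by apply/andP; split; lra.
  have chi0 : 0 <= chi by have := sqr_ge0 (a%:R / (a + b + c)%:R - q 1); lra.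
  have h1 : 0 <= 1 / 5 * ((a + b + c)%:R * chi) by apply: mulr_ge0; [lra|exact: mulr_ge0].
  have h2 : n%:R^-1 <= (a + b + c)%:R^-1 :> R.
    by rewrite lef_pV2 ?posrE ?ltr0n // ler_nat /n; clear; lia.
  by rewrite ler_expR; lra.
rewrite -(ler_pM2l (mulr_gt0 pk0 g0)) in e; apply: le_trans e _.
by move: (growth n) (n%:R^-1) => g v; lra.
Qed.

(** Concentration: coefficients of the order of the peak have proportions close to q. The decay
    exp(-N d^2 / 20) in the deviation d beats the factor d once N is large. *)
Lemma power_coef_dev (eps : R) : 0 < eps -> exists n0 : nat, forall a b c,
  let N := (a + b + c)%N in let n := (a + 2 * b + 3 * c)%N in (n0 <= n)%N ->
  [/\ T a b c * `|a%:R / N%:R - q 1| <= eps * growth n,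
      T a b c * `|b%:R / N%:R - q 2| <= eps * growth n &
      T a b c * `|c%:R / N%:R - q 3| <= eps * growth n].
Proof.
move=> eps0; have [K [n0 [K0 dich]]] := power_coef_dichotomy.
have [n1 n1P] := eventually_ge (K / eps).
have [n2 n2P] := eventually_ge (15 * (pk / eps) ^+ 2).
exists (maxn n0 (maxn n1 n2)) => a b c N n; rewrite !geq_max => /and3P[nn0 nn1 nn2].
have [n_gt0 nK] := n1P _ nn1; have [_ nN] := n2P _ nn2.
have g0 : 0 < growth n by apply: growth_gt0.
have N0 : (0 < N)%N by rewrite /N -weight_gt0.
have Nr : 0 < N%:R :> R by rewrite ltr0n.
have fin (m k : nat) : (m <= N)%N -> q k <= 1 ->
    (T a b c <= K * (growth n / n%:R) \/
     exists2 chi : R, T a b c <= pk * growth n * expR (- (1 / 10 / N%:R) - 1 / 5 * (N%:R * chi)) &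
       (m%:R / N%:R - q k) ^+ 2 <= 4 * chi) ->
    T a b c * `|m%:R / N%:R - q k| <= eps * growth n.
  move=> mN qk; set d := m%:R / N%:R - q k.
  have T0 := power_coef_ge0 R a b c.
  case=> [h|[chi h d4]].
    have d1 : `|d| <= 1.
      have h1 : 0 <= m%:R / N%:R :> R by apply: divr_ge0.
      have h2 : m%:R / N%:R <= 1 :> R by rewrite ler_pdivrMr // mul1r ler_nat.
      by have := q0 k; rewrite ler_norml /d => ?; lra.
    apply: (@le_trans _ _ (T a b c)); first by rewrite ler_piMr.
    apply: le_trans h _; rewrite mulrCA [leRHS]mulrC ler_pM2l //.
    by rewrite ler_pdivrMr ?ltr0n //; move: nK; rewrite ler_pdivrMr // mulrC.
  have y0 : 0 <= N%:R * d ^+ 2 / 20 :> R.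
    by apply: divr_ge0 => //; apply: mulr_ge0; rewrite ?sqr_ge0.
  have e : expR (- (1 / 10 / N%:R) - 1 / 5 * (N%:R * chi)) <= (1 + N%:R * d ^+ 2 / 20)^-1.
    apply: le_trans (expRN_le_inv y0); rewrite ler_expR.
    have i0 : 0 < N%:R^-1 :> R by rewrite invr_gt0.
    have : N%:R * d ^+ 2 <= N%:R * (4 * chi) by rewrite ler_pM2l.
    lra.
  have {}h : T a b c <= pk * growth n * (1 + N%:R * d ^+ 2 / 20)^-1.
    by apply: le_trans h _; rewrite ler_wpM2l // mulr_ge0 ?ltW.
  apply: (@le_trans _ _ (pk * growth n * (1 + N%:R * d ^+ 2 / 20)^-1 * `|d|)).
    by rewrite ler_wpM2r.
  have dd : d ^+ 2 = `|d| ^+ 2 by rewrite real_normK ?num_real.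
  have nN3 : n%:R <= 3 * N%:R :> R by rewrite -natrM ler_nat /n /N; clear; lia.
  rewrite dd; apply: lorentz_tail_le => //; lra.
have [qq1 qq2 qq3 _] := wgt_bounds Halpha; have ws := wgt_sum Halpha.
have D := dich a b c nn0.
have [l1 l2 l3] : [/\ q 1 <= 1, q 2 <= 1 & q 3 <= 1].
  by split; rewrite -ws; [rewrite -addrA ler_wpDr // addr_ge0 // ltW | rewrite -addrA ler_wpDl ?(ltW (q0 _)) // ler_wpDr // ltW | rewrite ler_wpDl // addr_ge0 // ltW].
have [m1 m2 m3] : [/\ (a <= N)%N, (b <= N)%N & (c <= N)%N].
  by rewrite /N; split; clear; lia.
split; [apply: (fin a 1%N)|apply: (fin b 2%N)|apply: (fin c 3%N)] => //;
  by case: D => [h|[chi h [c1 c2 c3]]]; [left|right; exists chi].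
Qed.

Lemma power_coef_le : exists2 C : R, 0 < C & forall a b c,
  let n := (a + 2 * b + 3 * c)%N in (0 < n)%N -> T a b c <= C * growth n.
Proof.
have [n0 sharp] := power_coef_le_sharp.
exists (pk + 3 * n0%:R) => [|a b c n n_gt0]; first by rewrite ltr_wpDr // mulr_ge0.
have g0 : 0 < growth n by apply: growth_gt0.
case: (leqP n0 n) => h.
  apply: le_trans (sharp _ _ _ h) _; rewrite mulrC ler_wpM2r ?(ltW g0) //.
  have : 0 <= pk / 20 / n%:R by apply: divr_ge0 => //; apply: divr_ge0 => //; exact: ltW.
  have : 0 <= n0%:R :> R by [].
  lra.
have N0 : (0 < a + b + c)%N by rewrite -weight_gt0.
apply: le_trans (power_coef_ratio Halpha N0) _.
apply: (@le_trans _ R (3 * (n%:R * growth n))); last first.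
  rewrite mulrA ler_pM2r //.
  have : n%:R <= n0%:R :> R by rewrite ler_nat ltnW.
  by move: pk0; lra.
rewrite ler_pM2l // /growth mulrC divfK ?pnatr_eq0 -?lt0n //.
exact: (trinom_trivial Halpha).
Qed.
End Asymptotics.

(** * A profile that attains the peak *)

Section LowerBound.
Variables (R : realType) (alpha : R).
Hypothesis Halpha : alpha ^+ 3 - alpha ^+ 2 - alpha - 1 = 0.
Local Notation q := (wgt alpha).
Local Notation mu := (mean_wgt alpha).
Local Notation T := (power_coef R).
Local Notation pk := (peak alpha).
Local Notation growth := (growth alpha).
Implicit Types a b c n : nat.

Let a0 : 0 < alpha := alpha_gt0 Halpha.
Let q0 k : 0 < q k := wgt_gt0 Halpha k.
Let mu0 : 0 < mu := mean_wgt_gt0 Halpha.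
Let pk0 : 0 < pk := peak_gt0 Halpha.

Lemma mean_wgt_le3 : mu <= 3.
Proof.
have ws := wgt_sum Halpha; have q1 := q0 1; have q2 := q0 2; have q3 := q0 3.
by rewrite /mean_wgt; lra.
Qed.

Lemma wgt_le1 : [/\ q 1 <= 1, q 2 <= 1 & q 3 <= 1].
Proof.
have ws := wgt_sum Halpha; have q1 := q0 1; have q2 := q0 2; have q3 := q0 3.
by split; lra.
Qed.

Lemma lower_log_term (N v : R) (m k : nat) : 0 < N -> 4 / 25 <= q k ->
    126 <= N -> `|m%:R - q k * N| <= 10 -> v = N^-1 ->
  exists2 w : R, 0 < w & exists x : R, [/\ m%:R = N * (q k * w ^+ 2), x = w ^+ 2,
    - (63 * v) <= x - 1 <= 63 * v,
    (0 < m)%N &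
    - ((2 * m%:R + 1) * ln w) - stirling_err R m >=
     - (m%:R * (x - 1)) - 34 * v].
Proof.
move=> N0 qk N1 dev vE.
have Nq : 0 < N * q k by rewrite mulr_gt0.
have v0 : 0 < v by rewrite vE invr_gt0.
have Nv : N * v = 1 by rewrite vE divff ?gt_eqF.
pose x := m%:R / (N * q k).
have mE : m%:R = N * (q k * x) by rewrite mulrA mulrC divfK ?gt_eqF.
have xd : `|x - 1| <= 63 * v.
  have -> : x - 1 = (m%:R - q k * N) / (N * q k).
    by rewrite /x mulrBl mulrC [q k * N]mulrC divff ?gt_eqF // mulrC.
  rewrite normrM [`|_^-1|]gtr0_norm ?invr_gt0 // ler_pdivrMr //.
  apply: le_trans dev _; rewrite mulrA -[_ * v * N]mulrA [v * N]mulrC Nv; lra.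
have v126 : 126 * v <= 1 by apply: le_trans (_ : N * v <= _); [rewrite ler_pM2r|rewrite Nv].
rewrite ler_norml in xd; case/andP: xd => xl xu.
have x1 : 1 / 2 <= x by lra.
have x0 : 0 < x by lra.
have wx : Num.sqrt x ^+ 2 = x by rewrite sqr_sqrtr ?ltW.
have w0 : 0 < Num.sqrt x by rewrite sqrtr_gt0.
have m0 : (0 < m)%N by rewrite -(ltr0n R) mE mulr_gt0 // mulr_gt0.
have lx : ln x = 2 * ln (Num.sqrt x) by rewrite -{1}wx lnXn // mulr_natl.
exists (Num.sqrt x) => //; exists x; rewrite wx; split=> //; first exact/andP.
have /andP[_ e] := stirling_err_bounds R m0.
have l : (m%:R + 1 / 2) * ln x <= (m%:R + 1 / 2) * (x - 1).
  by rewrite ler_pM2l ?ln_le_sub1 // ltr_wpDl // divr_gt0.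
have im : m%:R^-1 <= 25 / 2 * v.
  have -> : 25 / 2 * v = (2 / 25 * N)^-1 by rewrite vE; field; rewrite gt_eqF.
  have N2 : 0 < 2 / 25 * N by lra.
  rewrite lef_pV2 ?posrE ?ltr0n // mE.
  have : 4 / 25 * (1 / 2) <= q k * x by apply: ler_pM => //; lra.
  by rewrite [_ * N]mulrC => h; rewrite ler_pM2l //; lra.
have -> : (2 * m%:R + 1) * ln (Num.sqrt x) = (m%:R + 1 / 2) * ln x by rewrite lx; field.
have fin (X Y i r z y : R) : r <= 10^-1 * i -> X + 1 / 2 * z <= Y + 1 / 2 * y ->
    i <= 25 / 2 * v -> y <= 63 * v -> - Y - 34 * v <= - (X + 1 / 2 * z) - r.
  by clear -v0; move: v0; lra.
rewrite (mulrDl _ _ (ln x)); apply: fin e _ im xu; rewrite -!mulrDl //.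
Qed.

(** The losses are 3 * 34 + 63^2 in units of 1/N <= 3/n, and 30/n from the logarithm of n/(N mu);
    together they stay below 15000/n. *)
Lemma power_coef_near_ge a b c :
    let N : R := (a + b + c)%:R in let n := (a + 2 * b + 3 * c)%N in
    126 <= N -> `|a%:R - q 1 * N| <= 10 -> `|b%:R - q 2 * N| <= 10 ->
    `|c%:R - q 3 * N| <= 10 -> N - n%:R / mu <= 5 ->
  pk * growth n * (1 - 150 * 100 / n%:R) <= T a b c.
Proof.
move=> N n N1 da db dc dN.
have N0 : 0 < N by lra.
have [q1 q2 q3 mu1] := wgt_bounds Halpha; have ws := wgt_sum Halpha.
have v0 : 0 < N^-1 by rewrite invr_gt0.
have [|w1 w10 [x1 [E1 X1 B1 a1 G1]]] := lower_log_term N0 _ N1 da erefl; first lra.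
have [|w2 w20 [x2 [E2 X2 B2 b1 G2]]] := lower_log_term N0 _ N1 db erefl; first lra.
have [|w3 w30 [x3 [E3 X3 B3 c1 G3]]] := lower_log_term N0 _ N1 dc erefl; first lra.
have T0 : 0 < T a b c.
  by apply: mulr_gt0; [rewrite divr_gt0 ?ltr0n //; clear -a1; lia | exact: trinom_gt0].
have n0 : 0 < n%:R :> R by rewrite ltr0n /n; clear -a1; lia.
have key := ln_power_coef Halpha a1 b1 c1 w10 w20 w30 E1 E2 E3.
have /andP[eN _] := stirling_err_bounds R (leq_trans a1 (leq_trans (leq_addr b a) (leq_addr c _))).
have L : - (30 / n%:R) <= 2 * ln (n%:R / N / mu).
  have r0 : 0 < n%:R / N / mu by rewrite !divr_gt0.
  have l1 := ln_ge_sub1 r0.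
  have l2 : (n%:R / N / mu)^-1 <= 1 + 15 / n%:R.
    have -> : (n%:R / N / mu)^-1 = 1 + (N - n%:R / mu) * mu / n%:R.
      move: (lt0r_neq0 mu0) (lt0r_neq0 n0) (lt0r_neq0 N0).
      move: (mu) (n%:R : R) (N) => z y x hz hy hx.
      by field; rewrite hz hy hx.
    rewrite lerD2l ler_pM2r ?invr_gt0 //.
    have mu3 := mean_wgt_le3.
    apply: le_trans (_ : 5 * mu <= _); last lra.
    by rewrite ler_pM2r.
  by move: l1 l2; clear; lra.
have S : a%:R * (x1 - 1) + b%:R * (x2 - 1) + c%:R * (x3 - 1) <= 63 * 63 / N.
  have NE : N = a%:R + b%:R + c%:R by rewrite /N !natrD.
  have one : q 1 * x1 + q 2 * x2 + q 3 * x3 = 1.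
    apply: (mulfI (lt0r_neq0 N0)); rewrite mulr1 !mulrDr X1 X2 X3.
    by rewrite -E1 -E2 -E3.
  have -> : a%:R * (x1 - 1) + b%:R * (x2 - 1) + c%:R * (x3 - 1) =
     N * (q 1 * (x1 - 1) ^+ 2 + q 2 * (x2 - 1) ^+ 2 + q 3 * (x3 - 1) ^+ 2).
    rewrite E1 E2 E3 -X1 -X2 -X3.
    transitivity (N * (q 1 * (x1 - 1) ^+ 2 + q 2 * (x2 - 1) ^+ 2 + q 3 * (x3 - 1) ^+ 2)
       + N * (q 1 * x1 + q 2 * x2 + q 3 * x3 - (q 1 + q 2 + q 3))); first by ring.
    by rewrite one ws subrr mulr0 addr0.
  have sq k (x : R) : - (63 / N) <= x - 1 <= 63 / N ->
      q k * (x - 1) ^+ 2 <= q k * (63 / N) ^+ 2.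
    move=> xb; rewrite ler_pM2l // -[leLHS]real_normK ?num_real //.
    by rewrite ler_sqr ?nnegrE ?ler_norml // divr_ge0 // ltW.
  apply: le_trans (_ : N * (q 1 * (63 / N) ^+ 2 + q 2 * (63 / N) ^+ 2 + q 3 * (63 / N) ^+ 2) <= _).
    by rewrite ler_pM2l // lerD ?lerD ?sq.
  rewrite -!mulrDl ws mul1r le_eqVlt; apply/orP; left; apply/eqP.
  by move: (N) (lt0r_neq0 N0) => z hz; field.
have vn : N^-1 <= 3 / n%:R.
  have -> : 3 / n%:R = (n%:R / 3)^-1 :> R by rewrite invf_div.
  rewrite lef_pV2 ?posrE ?divr_gt0 // ler_pdivrMr // -natrM ler_nat /n /N; clear; lia.
have fin : ln pk + n%:R * ln alpha - ln n%:R - 150 * 100 / n%:R <= ln (T a b c).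
  have lin (Z1 Z2 Z3 Y1 Y2 Y3 e1 e2 e3 e4 l l1 l2 l3 v u : R) : 0 <= u ->
     - Y1 - 34 * v <= - Z1 - e1 -> - Y2 - 34 * v <= - Z2 - e2 ->
     - Y3 - 34 * v <= - Z3 - e3 -> - (30 * u) <= 2 * l -> Y1 + Y2 + Y3 <= 63 * 63 * v ->
     v <= 3 * u -> 0 <= e4 ->
     l1 + l2 - l3 - 150 * 100 * u <=
     l1 + l2 - l3 + 2 * l - Z1 - Z2 - Z3 + (e4 - e1 - e2 - e3) by clear; lra.
  rewrite key -/N -/n; apply: lin G1 G2 G3 L S vn _; first by rewrite invr_ge0.
  by apply: le_trans eN; apply: divr_ge0; rewrite ?invr_ge0.
rewrite -ler_expR lnK ?posrE // in fin; apply: le_trans fin.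
rewrite !expRB !expRD (lnK (pk0 : pk \in Num.pos)) expRM_natl.
rewrite !lnK ?posrE // -[pk * alpha ^+ n / n%:R]mulrA -expRN.
rewrite ler_pM2l; last by rewrite mulr_gt0 // growth_gt0 // -(ltr0n R).
exact: expR_ge1Dx.
Qed.

Lemma peak_profile n : (1000 <= n)%N -> exists a b c,
  (a + 2 * b + 3 * c)%N = n /\ pk * growth n * (1 - 150 * 100 / n%:R) <= T a b c.
Proof.
move=> n1; have [q1 q2 q3 mu1] := wgt_bounds Halpha; have ws := wgt_sum Halpha.
have muE : mu = q 1 + 2 * q 2 + 3 * q 3 by [].
have mu3 := mean_wgt_le3.
pose M : R := n%:R / mu.
have nr : 1000 <= n%:R :> R by rewrite -[1000]/(1000%:R) ler_nat.
have M1 : 300 <= M by rewrite ler_pdivlMr //; lra.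
have nM : n%:R = M * mu by rewrite divfK ?gt_eqF.
have M0 : 0 <= M by lra.
have fl (x : R) : 0 <= x -> exists m : nat, m%:R <= x < m%:R + 1.
  by move=> x0; exists (Num.truncn x); rewrite natr1 truncn_itv.
(* Round the ideal values of b and c down; a absorbs the remainder, so that the weight is exactly n
   and every part is off by a bounded amount. *)
have [b /andP[b1 b2]] := fl (q 2 * M) (mulr_ge0 (ltW (q0 _)) M0).
have [c /andP[c1 c2]] := fl (q 3 * M) (mulr_ge0 (ltW (q0 _)) M0).
have q1M : 0 <= q 1 * M by rewrite mulr_ge0 // ltW.
have bc : (2 * b + 3 * c <= n)%N.
  rewrite -(ler_nat R) natrD !natrM nM muE.
  by move: b1 c1 q1M; clear; lra.
have aE : ((n - 2 * b - 3 * c)%N)%:R = n%:R - 2 * b%:R - 3 * c%:R :> R.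
  rewrite natrB ?natrB ?natrM //; clear -bc; lia.
exists (n - 2 * b - 3 * c)%N, b, c.
have e : (n - 2 * b - 3 * c + 2 * b + 3 * c)%N = n by clear -bc; lia.
split=> //.
have da : 0 <= (n - 2 * b - 3 * c)%N%:R - q 1 * M < 5.
  by rewrite aE nM muE; move: b1 b2 c1 c2; clear; lra.
move: (n - 2 * b - 3 * c)%N e da aE => a e da aE.
have NM : 0 <= (a + b + c)%N%:R - M < 5.
  have -> : M = (q 1 + q 2 + q 3) * M by rewrite ws mul1r.
  by move: da b1 b2 c1 c2; rewrite !natrD aE nM muE; clear; lra.
have dev k (x : R) : q k <= 1 -> -1 <= x - q k * M < 5 -> `|x - q k * (a + b + c)%N%:R| <= 10.
  move=> qk1 h; have q0k := q0 k.
  have -> : x - q k * (a + b + c)%:R = (x - q k * M) - q k * ((a + b + c)%:R - M) by ring.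
  have : 0 <= q k * ((a + b + c)%:R - M) <= 5.
    move: NM; move: (_ - M) => y /andP[y0 y5]; apply/andP; split; first by rewrite mulr_ge0 // ltW.
    by apply: le_trans (_ : 1 * y <= _); [rewrite ler_wpM2r|lra].
  by rewrite ler_norml; move: h; clear; lra.
have [l1 l2 l3] := wgt_le1.
have near := @power_coef_near_ge a b c; rewrite /= e in near; apply: near.
- by move: NM M1; rewrite -/M; lra.
- by apply: dev => //; move: da; lra.
- by apply: dev => //; move: b1 b2; lra.
- by apply: dev => //; move: c1 c2; lra.
- by rewrite -/M; move: NM; lra.
Qed.
End LowerBound.

(** * Multiplying a power sum by a fixed polynomial *)

Section Leading.
Variables (R : realType) (alpha : R).
Hypothesis Halpha : alpha ^+ 3 - alpha ^+ 2 - alpha - 1 = 0.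
Local Notation q := (wgt alpha).
Local Notation T := (power_coef R).
Local Notation pk := (peak alpha).
Local Notation growth := (growth alpha).
Local Notation P := power_poly.
Implicit Types (m : 'X_{1..3}) (s : {mpoly int[3]}) (k : 'I_3).

Let a0 : 0 < alpha := alpha_gt0 Halpha.
Let q0 (j : nat) : 0 < q j := wgt_gt0 Halpha j.

Definition cf s m : R := (s@_m)%:~R.
Definition Tm m : R := T (m 0) (m 1) (m 2).

Lemma cfD s s' m : cf (s + s') m = cf s m + cf s' m.
Proof. by rewrite /cf mcoeffD rmorphD. Qed.

Lemma cf_power i m : (0 < i)%N -> cf (P i) m = (wt3 m == i)%:R * Tm m.
Proof.
move=> i0; rewrite /cf mcoeff_power //; case: eqP => [<-|]; last by rewrite !mul0r.
by rewrite !mul1r.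
Qed.

Lemma Tm_ge0 m : 0 <= Tm m. Proof. exact: power_coef_ge0. Qed.

Lemma cf_mulX i k m : (0 < i)%N -> cf ('X_k * P i) m =
  (wt3 m == (i + k.+1)%N)%:R *
  (i%:R / (deg3 m).-1%:R * ((m k)%:R / (deg3 m)%:R) * trinom_mnm R m).
Proof.
move=> i0; rewrite /cf mcoeffXUM.
case mk : (m k) => [|x]; first by rewrite !mul0r mulr0 mul0r mulr0.
rewrite mcoeff_power //.
have d0 : (deg3 (m - U_(k))%MM).+1 = deg3 m /\ ((wt3 (m - U_(k))%MM) + k.+1)%N = wt3 m.
  move: mk; elim/ord3_ind: k => mk;
    by rewrite /deg3 /wt3 !mnmBE !mnm1E /= mk; split; clear; lia.
case: d0 => dE wE; rewrite -dE -wE eqn_add2r -pred_Sn.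
congr (_ * _); rewrite -!mulrA; congr (_ * (_ * _)).
have D0 : (deg3 m)%:R != 0 :> R by rewrite -dE pnatr_eq0.
rewrite dE -mk -[LHS](mulfK D0) [_ * trinom_mnm R m]mulrC [RHS]mulrA; congr (_ / _).
move: mk {dE wE}; elim/ord3_ind: k => mk; rewrite /trinom_mnm !mnmBE !mnm1E /= mk ?subn0 subn1 /=.
- by have := trinom_predl R (m 0) (m 1) (m 2); rewrite /deg3 mk.
- by have := trinom_predm R (m 0) (m 1) (m 2); rewrite /deg3 mk.
- by have := trinom_predr R (m 0) (m 1) (m 2); rewrite /deg3 mk.
Qed.

Lemma shift_ratio (N n i w x : nat) (t z : R) : (1 < N)%N -> (N <= n)%N -> (n <= 3 * N)%N ->
    (x <= N)%N -> n = (i + w)%N -> (w <= 3)%N -> 0 <= t ->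
  `|i%:R / N.-1%:R * (x%:R / N%:R) * t - z * (n%:R / N%:R * t)|
  <= n%:R / N%:R * t * `|x%:R / N%:R - z| + n%:R / N%:R * t * (6 / n%:R).
Proof.
move=> N1 Nn nN xN nE w3 t0.
have N0 : 0 < N%:R :> R by rewrite ltr0n ltnW.
have n0 : 0 < n%:R :> R by rewrite ltr0n (leq_trans _ Nn) // ltnW.
have M1 : N%:R = N.-1%:R + 1 :> R by rewrite natr1 prednK // ltnW.
have M0 : 1 <= N.-1%:R :> R by rewrite ler1n -ltnS prednK // ltnW.
have iE : i%:R = n%:R - w%:R :> R by rewrite nE natrD addrK.
have Tp : 0 <= n%:R / N%:R * t by rewrite mulr_ge0 ?divr_ge0.
set y : R := i%:R * N%:R / (n%:R * N.-1%:R).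
have yE : i%:R / N.-1%:R * (x%:R / N%:R) * t - z * (n%:R / N%:R * t)
   = n%:R / N%:R * t * ((x%:R / N%:R - z) + x%:R / N%:R * (y - 1)).
  rewrite /y; move: (n%:R : R) (N%:R : R) (N.-1%:R : R) n0 N0 M0 => u v r u0 v0 r0.
  by field; rewrite !gt_eqF //; lra.
rewrite yE normrM (ger0_norm Tp) -mulrDr ler_wpM2l //.
apply: le_trans (ler_normD _ _) _; rewrite lerD2l normrM.
have xN1 : `|x%:R / N%:R : R| <= 1.
  by rewrite ger0_norm ?divr_ge0 // ler_pdivrMr // mul1r ler_nat.
apply: le_trans (_ : 1 * `|y - 1| <= _); first by rewrite ler_wpM2r.
rewrite mul1r.
have -> : y - 1 = ((n%:R - w%:R * N%:R) / N.-1%:R) / n%:R.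
  rewrite /y iE M1; move: (n%:R : R) (N.-1%:R : R) n0 M0 => u r u0 r0.
  by field; rewrite !gt_eqF //; lra.
rewrite normrM [`|_^-1|]ger0_norm ?invr_ge0 ?(ltW n0) // ler_pM2r ?invr_gt0 //.
rewrite normrM [`|_^-1|]ger0_norm ?invr_ge0 // ler_pdivrMr; last by lra.
have h1 : n%:R <= 3 * N%:R :> R by rewrite -natrM ler_nat.
have h2 : 0 <= w%:R * N%:R :> R by rewrite mulr_ge0.
have h3 : w%:R * N%:R <= 3 * N%:R :> R by rewrite ler_wpM2r // ?ler_nat // ltW.
by rewrite ler_norml; lra.
Qed.

(** Removing one part of size k+1 multiplies the trinomial by the proportion of that part. By
    [power_coef_dev] this proportion can be replaced by q_(k+1) at a cost negligible against the
    peak. *)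
Lemma cf_mulX_near (eps : R) k : 0 < eps -> exists i0 : nat, forall i m, (i0 <= i)%N ->
  `|cf ('X_k * P i) m - q k.+1 * cf (P (i + k.+1)) m| <= eps * growth (i + k.+1).
Proof.
move=> e0; have e2 : 0 < eps / 2 by rewrite divr_gt0.
have [n1 dev] := power_coef_dev Halpha e2.
have [C C0 bnd] := power_coef_le Halpha.
have [n2 n2P] := eventually_ge (6 * C / (eps / 2)).
exists (maxn 4 (maxn n1 n2)) => i m; rewrite !geq_max => /and3P[i4 i1 i2].
have i_gt0 : (0 < i)%N by apply: leq_trans i4.
have g0 : 0 < growth (i + k.+1) by apply: growth_gt0 => //; rewrite addn_gt0 i_gt0.
rewrite cf_mulX // cf_power ?addn_gt0 ?i_gt0 //.
case: eqP => [w|]; last by rewrite !mul0r mulr0 subr0 normr0 mulr_ge0 ?ltW.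
rewrite !mul1r /Tm /power_coef -/(wt3 m) -/(deg3 m) -/(trinom_mnm R m).
have hk : (k < 3)%N by [].
have dN : (deg3 m <= wt3 m)%N by rewrite /deg3 /wt3; clear; lia.
have wN : (wt3 m <= 3 * deg3 m)%N by rewrite /deg3 /wt3; clear; lia.
have d1 : (1 < deg3 m)%N by move: w wN i4; clear; lia.
have xd : (m k <= deg3 m)%N.
  by rewrite /deg3; clear; elim/ord3_ind: k; lia.
apply: le_trans (shift_ratio _ d1 dN wN xd w hk (ltW (trinom_mnm_gt0 _ m))) _.
have TE : (wt3 m)%:R / (deg3 m)%:R * trinom_mnm R m = Tm m by [].
rewrite TE -w.
have wi : (i <= wt3 m)%N by rewrite w leq_addr.
have [D1 D2 D3] := dev (m 0) (m 1) (m 2) (leq_trans i1 wi).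
have D : Tm m * `|(m k)%:R / (deg3 m)%:R - q k.+1| <= eps / 2 * growth (wt3 m).
  by move: D1 D2 D3; clear; elim/ord3_ind: k.
have B : Tm m * (6 / (wt3 m)%:R) <= eps / 2 * growth (wt3 m).
  have [w0 wC] := n2P _ (leq_trans i2 wi).
  apply: le_trans (_ : C * growth (wt3 m) * (6 / (wt3 m)%:R) <= _).
    apply: ler_wpM2r; [exact: divr_ge0 | exact: (bnd (m 0) (m 1) (m 2) w0)].
  rewrite mulrAC; apply: ler_wpM2r; first by rewrite w ltW.
  rewrite mulrA ler_pdivrMr ?ltr0n //.
  by move: wC; rewrite ler_pdivrMr // [C * 6]mulrC [eps / 2 * _]mulrC.
by rewrite [eps]splitr [leRHS]mulrDl; apply: lerD.
Qed.

Lemma growth_shift i w : (0 < i)%N -> growth (i + w) <= alpha ^+ w * growth i.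
Proof.
move=> i0; rewrite /growth mulrA -exprD addnC ler_pM2l ?exprn_gt0 //.
by rewrite lef_pV2 ?posrE ?ltr0n ?addn_gt0 ?i0 ?orbT // ler_nat leq_addl.
Qed.

Lemma wgtM i j : q i * q j = q (i + j). Proof. by rewrite -exprD. Qed.

(* [s * P_i] is [tau * alpha^-w * P_(i+w)] up to coefficients that are [o(alpha^i / i)]. *)
Definition leading s w (tau : R) := forall eps : R, 0 < eps ->
  exists i0 : nat, forall i m, (i0 <= i)%N ->
  `|cf (s * P i) m - tau * q w * cf (P (i + w)) m| <= eps * growth i.

Lemma leading1 : leading 1 0 1.
Proof.
move=> eps e0; exists 1%N => i m i0.
rewrite /wgt expr0 !mul1r addn0 subrr normr0 ltW //; apply: mulr_gt0 => //; exact: growth_gt0.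
Qed.

Lemma leadingD s s' w tau tau' :
  leading s w tau -> leading s' w tau' -> leading (s + s') w (tau + tau').
Proof.
move=> h h' eps e0; have e2 : 0 < eps / 2 by rewrite divr_gt0.
have [i1 h1] := h _ e2; have [i2 h2] := h' _ e2.
exists (maxn i1 i2) => i m; rewrite geq_max => /andP[/h1-/(_ m) {}h1 /h2-/(_ m) {}h2].
rewrite [(s + s') * _]mulrDl cfD [eps]splitr [leRHS]mulrDl.
rewrite (mulrDl tau) (mulrDl (tau * _)) opprD addrACA.
exact: le_trans (ler_normD _ _) (lerD h1 h2).
Qed.

(** Multiplication by X_k only shifts the error of the hypothesis, and [cf_mulX_near] handles the
    main term; [d] is chosen so that the accumulated factor is at most eps / 2. *)
Lemma leadingX k s w tau : leading s w tau -> leading ('X_k * s) (w + k.+1) tau.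
Proof.
move=> h eps e0.
pose d := eps / 2 / (`|tau| * alpha ^+ k.+1 + 1).
have z0 : 0 < `|tau| * alpha ^+ k.+1 + 1.
  by rewrite ltr_wpDl // mulr_ge0 // exprn_ge0 // ltW.
have e2 : 0 < eps / 2 by rewrite divr_gt0.
have d0 : 0 < d by rewrite divr_gt0.
have dle : d * (`|tau| * alpha ^+ k.+1) <= eps / 2.
  by rewrite /d mulrAC ler_pdivrMr // ler_pM2l // lerDl.
clearbody d.
have [i1 h1] := h _ e2; have [i2 h2] := cf_mulX_near k d0.
exists (maxn 1 (maxn i1 i2)) => i m; rewrite !geq_max => /and3P[i_gt0 ii1 ii2].
have g0 : 0 < growth i by apply: growth_gt0.
have E1 : `|cf ('X_k * (s * P i)) m - tau * q w * cf ('X_k * P (i + w)) m| <= eps / 2 * growth i.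
  rewrite /cf !mcoeffXUM; case: (m k) => [|x]; last exact: h1.
  by rewrite mulr0 subrr normr0 ltW // mulr_gt0.
have {h2} E2 := h2 (i + w)%N m (leq_trans ii2 (leq_addr _ _)).
have E3 : `|tau * q w * (cf ('X_k * P (i + w)) m - q k.+1 * cf (P (i + w + k.+1)) m)|
    <= eps / 2 * growth i.
  rewrite normrM; apply: le_trans (ler_wpM2l _ E2) _ => //.
  have gs : growth (i + w + k.+1) <= alpha ^+ w * alpha ^+ k.+1 * growth i.
    by rewrite -exprD -addnA; apply: growth_shift.
  apply: le_trans (_ : `|tau * q w| * (d * (alpha ^+ w * alpha ^+ k.+1 * growth i)) <= _).
    by rewrite ler_wpM2l // ler_wpM2l // ltW.
  rewrite normrM (gtr0_norm (q0 w)); move: (growth i) g0 => G G0.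
  rewrite !mulrA; apply: ler_wpM2r; first exact: ltW.
  have -> : `|tau| * q w * d * alpha ^+ w * alpha ^+ k.+1 = d * (`|tau| * alpha ^+ k.+1).
    have aw : q w * alpha ^+ w = 1 by rewrite /wgt exprVn mulVf // expf_neq0 // lt0r_neq0.
    have -> : `|tau| * q w * d * alpha ^+ w * alpha ^+ k.+1
      = (q w * alpha ^+ w) * (d * (`|tau| * alpha ^+ k.+1)) by ring.
    by rewrite aw mul1r.
  by [].
rewrite addnA -wgtM -mulrA [eps]splitr [leRHS]mulrDl; apply: le_trans (lerD E1 E3).
rewrite mulrBr.
rewrite !mulrA; exact: ler_distD.

Qed.

(** The sum of the j-th powers of the three roots of the tribonacci cubic. *)
Definition tribonacci_lucas j : R := power_sum (fun=> 1) j.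
Local Notation t := tribonacci_lucas.

(** In leading order each variable acts as 1 after the shift of index is accounted for, so the
    factor is the value of the power sum at (1, 1, 1). *)
Lemma leading_power j : leading (P j) j (t j).
Proof.
have x0 := leadingX 0 leading1; have x1 := leadingX 1 leading1.
have x00 := leadingX 0 x0.
elim/ltn_ind: j => -[|[|[|j]]] IH.
- have := leadingD leading1 (leadingD leading1 leading1).
  have -> : P 0 = 1 + (1 + 1) by rewrite /power_poly /power_sum /=; ring.
  by have -> : t 0 = 1 + (1 + 1) by rewrite /tribonacci_lucas /power_sum /=; ring.
- by move: x0; rewrite mulr1.
- have := leadingD x00 (leadingD x1 x1); rewrite !mulr1 /=.
  have -> : P 2 = 'X_0 * 'X_0 + ('X_1 + 'X_1) by rewrite /power_poly /power_sum /=; ring.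
  by have -> : t 2 = 1 + (1 + 1) by rewrite /tribonacci_lucas /power_sum /=; ring.
have h0 := leadingX 0 (IH j.+2 (ltnSn _)); rewrite addn1 in h0.
have h1 := leadingX 1 (IH j.+1 (ltnW (ltnSn _))); rewrite addn2 in h1.
have h2 := leadingX 2 (IH j (ltnW (ltnW (ltnSn _)))); rewrite addn3 in h2.
have := leadingD (leadingD h0 h1) h2.
have -> : P j.+3 = 'X_0 * P j.+2 + 'X_1 * P j.+1 + 'X_2 * P j.
  by rewrite /power_poly /power_sum cubic_recS.
by have -> : t j.+3 = t j.+2 + t j.+1 + t j
  by rewrite /tribonacci_lucas /power_sum cubic_recS !mul1r.
Qed.

Lemma tribonacci_lucas_dev j : (0 < j)%N -> (t j - alpha ^+ j) ^+ 2 < 1.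
Proof.
pose d j := t j - alpha ^+ j; rewrite -/(d j).
have al := alpha_lower Halpha; have au := alpha_upper Halpha.
have ai : alpha^-1 = alpha ^+ 2 - alpha - 1.
  apply: (mulIf (lt0r_neq0 a0)); rewrite mulVf ?gt_eqF //.
  by move: Halpha; lra.
have a3 : alpha ^+ 3 = alpha ^+ 2 + alpha + 1 by move: Halpha; lra.
have t3 (k : nat) : t k.+3 = t k.+2 + t k.+1 + t k.
  by rewrite /tribonacci_lucas /power_sum cubic_recS !mul1r.
have t012 : [/\ t 0 = 3, t 1 = 1 & t 2 = 3].
  by rewrite /tribonacci_lucas /power_sum /= expr1n mulr1; split=> //; ring.
case: t012 => t_0 t_1 t_2.
have rec i : d i.+3 = d i.+2 + d i.+1 + d i.
  rewrite /d t3; have -> : alpha ^+ i.+3 = alpha ^+ i * alpha ^+ 3 by rewrite -exprD addn3.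
  by rewrite a3 !exprS; ring.
have d_rec (k : nat) : d k.+2 + (alpha - 1) * d k.+1 + (alpha ^+ 2 - alpha - 1) * d k = 0.
  elim: k => [|k IH]; first by rewrite /d t_0 t_1 t_2 expr1 expr0; ring.
  rewrite -[RHS](mulr0 alpha) -IH rec.
  have b1 : alpha * (alpha ^+ 2 - alpha - 1) = 1 by move: Halpha; lra.
  apply/eqP; rewrite -subr_eq0; apply/eqP.
  transitivity ((1 - alpha * (alpha ^+ 2 - alpha - 1)) * d k); first by ring.
  by rewrite b1 subrr mul0r.
(* [d] is the power sum of the two other roots, which are complex conjugate with product 1/alpha.
   [E] is a positive definite form that their recurrence scales by 1/alpha, whence d_k^2 <= 4
   alpha^-k. This is below 1 from k = 3 on; k = 1, 2 are computed. *)
pose E (k : nat) := d k.+1 ^+ 2 + (alpha - 1) * d k.+1 * d k + alpha^-1 * d k ^+ 2.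
have E_rec (k : nat) : E k = alpha^-1 ^+ k * E 0.
  elim: k => [|k IH]; first by rewrite mul1r.
  rewrite exprS -mulrA -IH /E ai.
  have -> : d k.+2 = - ((alpha - 1) * d k.+1 + (alpha ^+ 2 - alpha - 1) * d k).
    by move: (d_rec k); lra.
  ring.
have E0 : E 0 = 4 * (alpha^-1 - (alpha - 1) ^+ 2 / 4).
  by rewrite /E /d t_0 t_1 expr0 expr1; field; rewrite gt_eqF.
have E_ge (k : nat) : (alpha^-1 - (alpha - 1) ^+ 2 / 4) * d k ^+ 2 <= E k.
  rewrite -subr_ge0; have -> : E k - (alpha^-1 - (alpha - 1) ^+ 2 / 4) * d k ^+ 2
    = (d k.+1 + (alpha - 1) / 2 * d k) ^+ 2 by rewrite /E; field; rewrite gt_eqF.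
  exact: sqr_ge0.
have disc : 0 < alpha^-1 - (alpha - 1) ^+ 2 / 4 by rewrite ai; nra.
have d_le (k : nat) : d k ^+ 2 <= 4 * alpha^-1 ^+ k.
  rewrite -(ler_pM2l disc); apply: le_trans (E_ge k) _.
  by rewrite E_rec E0 mulrCA mulrA [leRHS]mulrC.
case: j => [|[|[|j]]] // _.
- by rewrite /d t_1 expr1; nra.
- by rewrite /d t_2; nra.
apply: le_lt_trans (d_le _) _.
have i1 : alpha^-1 <= 1 by rewrite invf_le1 //; lra.
have i0 : 0 <= alpha^-1 by rewrite invr_ge0 ltW.
apply: le_lt_trans (_ : 4 * alpha^-1 ^+ 3 < 1).
  by rewrite ler_pM2l // -[j.+3]addn3 exprD ler_piMl ?exprn_ge0 ?exprn_ile1.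
rewrite exprVn ltr_pdivrMr ?exprn_gt0 // a3; nra.
Qed.
End Leading.

(** * Mixed sums with bounded second index *)

Section FewMixed.
Variables (R : realType) (alpha : R).
Hypothesis Halpha : alpha ^+ 3 - alpha ^+ 2 - alpha - 1 = 0.
Local Notation q := (wgt alpha).
Local Notation pk := (peak alpha).
Local Notation growth := (growth alpha).
Local Notation t := (tribonacci_lucas R).
Implicit Types (m : 'X_{1..3}).

Let a0 : 0 < alpha := alpha_gt0 Halpha.
Let q0 (j : nat) : 0 < q j := wgt_gt0 Halpha j.
Let pk0 : 0 < pk := peak_gt0 Halpha.

Lemma power_poly_le_sharp : exists n0 : nat, forall n m, (n0 <= n)%N ->
  `|cf R (power_poly n) m| <= growth n * (pk - pk / 20 / n%:R).
Proof.
have [n0 sharp] := power_coef_le_sharp Halpha.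
exists n0.+2 => n m nn0; have n_gt0 : (0 < n)%N by apply: leq_trans nn0.
rewrite cf_power //; case: eqP => [w|_]; last first.
  rewrite mul0r normr0; apply: mulr_ge0; first exact/ltW/growth_gt0.
  rewrite subr_ge0 ler_pdivrMr ?ltr0n // ler_pM2l //.
  by apply: le_trans (_ : 1 <= _); [lra | rewrite ler1n].
rewrite mul1r ger0_norm ?Tm_ge0 //.
have := sharp (m 0) (m 1) (m 2); rewrite -/(wt3 m) w; apply.
exact/ltnW/ltnW.
Qed.

(** The mixed sum is (t_j alpha^-j - 1) p_(i+j) up to lower order, and the peak of p_(i+j) is at
    most alpha^j times that of p_i. The ratio is thus |t_j - alpha^j| < 1, and theta is the midpoint
    between it and 1. *)
Lemma mixed_poly_fixed j : (0 < j)%N -> exists2 theta : R, 0 <= theta < 1 &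
  exists i0 : nat, forall i m, (i0 <= i)%N ->
    `|cf R (mixed_poly i j) m| <= theta * (pk * growth i).
Proof.
move=> j0; have d1 : `|t j - alpha ^+ j| < 1.
  by rewrite -(@ltr_pXn2r _ 2) ?nnegrE // expr1n real_normK ?num_real // tribonacci_lucas_dev.
set d := `|_| in d1; have d0 : 0 <= d by rewrite normr_ge0.
have eps0 : 0 < (1 - d) / 2 * pk by apply: mulr_gt0 => //; lra.
have [i1 h1] := leading_power Halpha j eps0.
have [i2 h2] := power_poly_le_sharp.
exists ((1 + d) / 2); first by lra.
exists (maxn 1 (maxn i1 i2)) => i m; rewrite !geq_max => /and3P[i_gt0 ii1 ii2].
have g0 : 0 < growth i by apply: growth_gt0.
have E1 := h1 i m ii1.
have E2 := h2 _ m (leq_trans ii2 (leq_addr j i)).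
have -> : cf R (mixed_poly i j) m =
    cf R (power_poly j * power_poly i) m - t j * q j * cf R (power_poly (i + j)) m
    + (t j * q j - 1) * cf R (power_poly (i + j)) m.
  rewrite /mixed_poly /mixed_sum  /cf mcoeffB rmorphB /= [_ * power_poly j]mulrC.
  ring.
apply: le_trans (ler_normD _ _) _; rewrite [X in _ + X]normrM.
have E3 : `|t j * q j - 1| * `|cf R (power_poly (i + j)) m| <= d * (pk * growth i).
  have E4 : `|cf R (power_poly (i + j)) m| <= alpha ^+ j * growth i * pk.
    apply: le_trans E2 _; apply: le_trans (_ : growth (i + j) * pk <= _).
      apply: ler_wpM2l; first by rewrite ltW // growth_gt0 // addn_gt0 i_gt0.
      by rewrite lerBlDr lerDl; apply: divr_ge0 => //; apply: divr_ge0 => //; exact: ltW.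
    by rewrite ler_pM2r //; apply: growth_shift.
  apply: le_trans (ler_wpM2l _ E4) _ => //.
  have qa : q j * alpha ^+ j = 1 by rewrite /wgt exprVn mulVf // expf_neq0 // lt0r_neq0.
  have -> : t j * q j - 1 = (t j - alpha ^+ j) * q j by rewrite mulrBl [alpha ^+ j * _]mulrC qa.
  rewrite normrM -/d (gtr0_norm (q0 j)).
  have -> : d * q j * (alpha ^+ j * growth i * pk) = (q j * alpha ^+ j) * (d * (pk * growth i)).
    by move: (growth i) pk => g p; ring.
  by rewrite qa mul1r.
have -> : (1 + d) / 2 * (pk * growth i) = (1 - d) / 2 * pk * growth i + d * (pk * growth i).
  by move: (growth i) pk => g p; field.
exact: lerD.
Qed.

Lemma mixed_poly_few J : exists2 theta : R, 0 <= theta < 1 &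
  exists i0 : nat, forall i j m, (0 < j <= J)%N -> (i0 <= i)%N ->
    `|cf R (mixed_poly i j) m| <= theta * (pk * growth i).
Proof.
elim: J => [|J [u uu [i1 h1]]].
  exists 0; first by rewrite lexx ltr01.
  by exists 0%N => i [|j] m.
have /andP[u0 u1] := uu.
have [v /andP[v0 v1] [i2 h2]] := mixed_poly_fixed (ltn0Sn J).
exists (Num.max u v); first by rewrite le_max u0 gt_max u1.
exists (maxn 1 (maxn i1 i2)) => i j m /andP[j0]; rewrite !geq_max => jJ /and3P[i_gt0 ii1 ii2].
have p0 : 0 <= pk * growth i by apply/ltW/mulr_gt0 => //; exact: growth_gt0.
move: jJ; rewrite leq_eqVlt ltnS => /orP[/eqP->|jJ].
  apply: le_trans (h2 _ _ ii2) _; apply: ler_wpM2r => //.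
  by rewrite le_max lexx orbT.
apply: le_trans (h1 _ _ m _ ii1) _; first by rewrite j0.
by apply: ler_wpM2r => //; rewrite le_max lexx.
Qed.
End FewMixed.

(** * Heights of products with a sparse factor *)

Section SmallSupport.
Implicit Types (p s : {mpoly int[3]}) (m : 'X_{1..3}).

Lemma msizeM_le_pred p s : (msize (p * s) <= (msize p + msize s).-1)%N.
Proof.
have [->|p0] := eqVneq p 0; first by rewrite mul0r msize0.
have [->|s0] := eqVneq s 0; first by rewrite mulr0 msize0.
by rewrite msizeM.
Qed.

Lemma size_msupp_le p D : (msize p <= D)%N -> (size (msupp p) <= D ^ 3)%N.
Proof.
case: D => [|D] pD; first by move: pD; rewrite leqn0 msize_poly_eq0 => /eqP->; rewrite msupp0.
pose f m : 'I_D.+1 * 'I_D.+1 * 'I_D.+1 := (inord (m 0), inord (m 1), inord (m 2)).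
have le m i : m \in msupp p -> (m i < D.+1)%N.
  move=> /msize_mdeg_lt mp; apply: leq_trans pD; apply: leq_ltn_trans mp.
  by rewrite mdegE (bigD1 i) //= leq_addr.
have fI : {in msupp p &, injective f}.
  move=> m m' mp mp' [/(congr1 val) + /(congr1 val) + /(congr1 val)].
  rewrite /= !inordK ?le // => e0 e1 e2.
  by apply/mnmP; apply: ord3_eqP.
have u : uniq (map f (msupp p)) by rewrite map_inj_in_uniq ?msupp_uniq.
have := max_card (mem (map f (msupp p))); rewrite (card_uniqP u) size_map.
by rewrite !card_prod !card_ord !expnS expn0 muln1 mulnA.
Qed.

Lemma msize_power n : (msize (power_poly n) <= n.+1)%N.
Proof.
have X i : msize ('X_i : {mpoly int[3]}) = 2 by rewrite msizeX mdeg1.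
elim/ltn_ind: n => -[|[|[|n]]] IH.
- rewrite /power_poly /power_sum /= (_ : 3 = 3%:MP); last by rewrite mpolyC_nat.
  by rewrite msizeC.
- by rewrite /power_poly /power_sum /= X.
- rewrite /power_poly /power_sum /=; apply: leq_trans (msizeD_le _ _) _.
  rewrite geq_max; apply/andP; split; first by apply: leq_trans (msizeM_le_pred _ _) _; rewrite X.
  rewrite mulr_natl mulr2n; apply: leq_trans (msizeD_le _ _) _.
  by rewrite geq_max X.
have -> : power_poly n.+3 = 'X_0 * power_poly n.+2 + 'X_1 * power_poly n.+1 + 'X_2 * power_poly n.
  by rewrite /power_poly /power_sum cubic_recS.
have step i k : (k < n.+3)%N -> (msize ('X_i * power_poly k) <= n.+4)%N.
  move=> kn; apply: leq_trans (msizeM_le_pred _ _) _; rewrite X.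
  by have := IH k kn; clear -kn; lia.
move: (step 0 n.+2 (leqnn _)) (step 1 n.+1 (leqnSn _)) (step 2 n (leqW (leqnSn _))) => {IH step}.
move: ('X_0 * _) ('X_1 * _) ('X_2 * _) => u v w hu hv hw.
apply: leq_trans (msizeD_le _ _) _; rewrite geq_max hw andbT.
by apply: leq_trans (msizeD_le _ _) _; rewrite geq_max hu hv.
Qed.

Lemma msize_mixed i j : (msize (mixed_poly i j) <= (i + j).+1)%N.
Proof.
rewrite /mixed_poly /mixed_sum -!/(power_poly _).
apply: leq_trans (msizeD_le _ _) _; rewrite geq_max msizeN msize_power andbT.
apply: leq_trans (msizeM_le_pred _ _) _.
by have := msize_power i; have := msize_power j; clear; lia.
Qed.

Lemma coef_leM (R : numDomainType) (p s : {mpoly int[3]}) (K L : R) D :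
    (msize p <= D)%N -> 0 <= K -> 0 <= L ->
    (forall m, `|(p@_m)%:~R| <= K) -> (forall m, `|(s@_m)%:~R| <= L) ->
  forall m, `|((p * s)@_m)%:~R| <= D%:R ^+ 3 * K * L.
Proof.
move=> pD K0 L0 pK sL m.
rewrite (mpolyE p) mulr_suml raddf_sum /= rmorph_sum /=.
apply: le_trans (ler_norm_sum _ _ _) _.
apply: le_trans (_ : \sum_(m' <- msupp p) K * L <= _).
  apply: ler_sum => m' _; rewrite -scalerAl mcoeffZ rmorphM normrM.
  apply: ler_pM; rewrite ?normr_ge0 //; first exact: pK.
  rewrite mcoeffXM; case: ifP => _; last by rewrite rmorph0 normr0.
  exact: sL.
rewrite big_const_seq iter_addr_0 count_predT -[leLHS]mulr_natl -mulrA.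
apply: ler_wpM2r; first exact: mulr_ge0.
by rewrite -natrX ler_nat size_msupp_le.
Qed.
End SmallSupport.

(** * Mixed sums with large second index *)

Section ManyMixed.
Variables (R : realType) (alpha : R).
Hypothesis Halpha : alpha ^+ 3 - alpha ^+ 2 - alpha - 1 = 0.
Local Notation growth := (growth alpha).
Local Notation rho := (98 / 100 : R).
Implicit Types (m : 'X_{1..3}) (p s : {mpoly int[3]}).

Let a0 : 0 < alpha := alpha_gt0 Halpha.

(** The trinomial is at most the Girard-Waring coefficient, since its factor n/N is at least 1. *)
Lemma complete_poly_le : exists2 D : R, 0 < D & forall n m,
  n%:R * `|cf R (complete_poly n) m| <= D * alpha ^+ n.
Proof.
have [C C0 bnd] := power_coef_le Halpha.
exists (2 * C + 2) => [|n m]; first by lra.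
have an : 0 < alpha ^+ n by rewrite exprn_gt0.
rewrite /cf mcoeff_complete; case: eqP => [w|_]; last first.
  by rewrite mul0r normr0 mulr0 mulr_ge0 //; lra.
rewrite mul1r ger0_norm ?(ltW (trinom_mnm_gt0 _ _)) //.
have al := alpha_lower Halpha.
case: (posnP (wt3 m)) => [w0|w0].
  have [m0 [m1 m2]] : m 0 = 0%N /\ m 1 = 0%N /\ m 2 = 0%N by move: w0; rewrite /wt3; clear; lia.
  rewrite -w w0 /trinom_mnm m0 m1 m2 /trinom fact0 !mulr1 divr1 mulr1.
  have : 1 <= alpha ^+ (0 + 2) by rewrite add0n; nra.
  rewrite -(ler_pM2l (_ : 0 < 2 * C + 2)); last lra.
  by apply: le_trans; rewrite mulr1; lra.
have d0 : (0 < deg3 m)%N by move: w0; rewrite /wt3 /deg3; clear; lia.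
have dw : (deg3 m <= wt3 m)%N by rewrite /wt3 /deg3; clear; lia.
have T1 : trinom_mnm R m <= power_coef R (m 0) (m 1) (m 2).
  rewrite /power_coef -/(wt3 m) -/(deg3 m) -/(trinom_mnm R m).
  by rewrite ler_peMl ?(ltW (trinom_mnm_gt0 _ _)) // ler_pdivlMr ?ltr0n // mul1r ler_nat.
have T2 := le_trans T1 (bnd _ _ _ w0); rewrite -/(wt3 m) in T2.
have wr : 1 <= (wt3 m)%:R :> R by rewrite ler1n.
have T3 : (wt3 m)%:R * trinom_mnm R m <= C * alpha ^+ wt3 m.
  apply: le_trans (ler_wpM2l _ T2) _ => //; rewrite /growth mulrCA ler_pM2l //.
  by rewrite mulrC divfK // gt_eqF // ltr0n.
have T4 : trinom_mnm R m <= alpha ^+ wt3 m by exact: (trinom_trivial Halpha).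
have A : alpha ^+ wt3 m <= alpha ^+ n by rewrite -w exprD ler_peMr ?exprn_ge0 ?(ltW a0) //; nra.
have nE : n%:R = (wt3 m)%:R + 2 :> R by rewrite -w natrD.
have B : C * alpha ^+ wt3 m <= C * alpha ^+ n by rewrite ler_pM2l.
have B' : 0 <= C * alpha ^+ n by rewrite mulr_ge0 // ltW.
rewrite nE mulrDl [leRHS]mulrDl -[2 * C * _]mulrA; lra.
Qed.

Lemma cf_mixed_torus k j m : `|cf R (mixed_poly (j.*2 + k) j) m| <=
  6 * (rho ^+ j * alpha ^+ (j.*2 + k)).
Proof.
have := mixed_poly_torus Halpha m (leq_addr k j.*2).
rewrite /cf -intr_norm => /le_trans; apply; rewrite addKn exprMn -exprM -mul2n exprD.
by rewrite le_eqVlt; apply/orP; left; apply/eqP; ring.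
Qed.

(** Run the recurrence in the first index from 2j. The initial data have polynomially many terms in
    j, each of size 0.98^j alpha^(2j) by the torus bound, and the complete sums supply alpha^k /
    k. *)
Lemma mixed_poly_kle : exists2 C : R, 0 < C & forall k j m, (0 < j)%N ->
  k%:R * `|cf R (mixed_poly (j.*2 + k) j) m| <= C * (3 * j + 3)%:R ^+ 3 * (rho ^+ j * alpha ^+ (j.*2 + k)).
Proof.
have [D D0 hD] := complete_poly_le.
pose A := 6 * (alpha ^+ 2 + alpha + 1).
have A0 : 0 < A by rewrite /A; nra.
have Q0 : 0 < alpha ^+ 2 + alpha + 1 by nra.
exists (A * D * (alpha ^+ 2 + alpha + 1)) => [|k j m j0]; first by rewrite !mulr_gt0.
pose B := rho ^+ j * alpha ^+ j.*2.
have B0 : 0 <= B by rewrite mulr_ge0 ?exprn_ge0 ?divr_ge0 // ltW.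
pose s i := mixed_poly (j.*2 + i) j.
have srec i : s i.+3 = 'X_0 * s i.+2 + 'X_1 * s i.+1 + 'X_2 * s i.
  by rewrite /s !addnS; exact: mixed_sumS.
have E := @cubic_rec_complete _ (fun i => 'X_i) s k srec.
have [s0 s1 s2] : [/\ forall m', `|cf R (s 0) m'| <= 6 * B, forall m', `|cf R (s 1) m'| <= 6 * (alpha * B)
    & forall m', `|cf R (s 2) m'| <= 6 * (alpha ^+ 2 * B)].
  split=> m'; apply: le_trans (cf_mixed_torus _ _ _) _; rewrite /B exprD;
    by rewrite le_eqVlt; apply/orP; left; apply/eqP; rewrite ?expr0 ?expr1; ring.
have h6 : 0 <= 6 :> R by [].
have shiftX i p (K : R) : 0 <= K -> (forall m', `|cf R p m'| <= K) -> forall m', `|cf R ('X_i * p) m'| <= K.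
  by move=> K0 pK m'; rewrite /cf mcoeffXUM; case: (m' i) => [|?]; rewrite ?rmorph0 ?normr0 //; exact: pK.
have cfB p p' (K K' : R) : (forall m', `|cf R p m'| <= K) -> (forall m', `|cf R p' m'| <= K') ->
    forall m', `|cf R (p - p') m'| <= K + K'.
  move=> h h' m'; rewrite /cf mcoeffB rmorphB /=; apply: le_trans (ler_normB _ _) _.
  exact: lerD (h m') (h' m').
have aB : 0 <= alpha * B by rewrite mulr_ge0 // ltW.
have aaB : 0 <= alpha ^+ 2 * B by rewrite mulr_ge0 // exprn_ge0 // ltW.
have AB : A * B = 6 * (alpha ^+ 2 * B) + 6 * (alpha * B) + 6 * B by rewrite /A; ring.
have q0 : forall m', `|cf R (s 0) m'| <= A * B by move=> m'; have := s0 m'; lra.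
have q1 : forall m', `|cf R (s 1 - 'X_0 * s 0) m'| <= A * B.
  by move=> m'; have := cfB _ _ _ _ s1 (shiftX 0 _ _ (mulr_ge0 h6 B0) s0) m'; lra.
have q2 : forall m', `|cf R (s 2 - 'X_0 * s 1 - 'X_1 * s 0) m'| <= A * B.
  move=> m'; have := cfB _ _ _ _ (cfB _ _ _ _ s2 (shiftX 0 _ _ (mulr_ge0 h6 aB) s1))
     (shiftX 1 _ _ (mulr_ge0 h6 B0) s0) m'; lra.
have z (i : 'I_3) : msize ('X_i : {mpoly int[3]}) = 2 by rewrite msizeX mdeg1.
have zX (i : 'I_3) p d : (msize p <= d)%N -> (msize ('X_i * p) <= d.+1)%N.
  by move=> h; apply: leq_trans (msizeM_le_pred _ _) _; rewrite z; move: h; clear; lia.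
have zB p p' d : (msize p <= d)%N -> (msize p' <= d)%N -> (msize (p - p') <= d)%N.
  by move=> h h'; apply: leq_trans (msizeD_le _ _) _; rewrite geq_max msizeN h.
have ms i : (msize (s i) <= 3 * j + 1 + i)%N.
  by apply: leq_trans (msize_mixed _ _) _; clear; lia.
have m0 : (msize (s 0) <= 3 * j + 3)%N by apply: leq_trans (ms 0) _; clear; lia.
have m1 : (msize (s 1%N - 'X_0 * s 0%N)%R <= 3 * j + 3)%N.
  by apply: zB; [apply: leq_trans (ms 1) _|apply: leq_trans (zX _ _ _ (ms 0)) _]; clear; lia.
have m2 : (msize (s 2%N - 'X_0 * s 1%N - 'X_1 * s 0%N)%R <= 3 * j + 3)%N.
  apply: (zB); last by (apply: leq_trans (zX _ _ _ (ms 0)) _; clear; lia).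
  by apply: zB; [apply: leq_trans (ms 2) _|apply: leq_trans (zX _ _ _ (ms 1)) _]; clear; lia.
case: k E => [|k] E.
  rewrite mul0r mulr_ge0 //; first by rewrite mulr_ge0 ?exprn_ge0 // ltW // mulr_gt0 ?mulr_gt0.
  by rewrite mulr_ge0 ?exprn_ge0 ?divr_ge0 // ltW.
have hL r : (k.+1 <= r)%N -> forall m', `|cf R (complete_poly r) m'| <= D * alpha ^+ r / k.+1%:R.
  move=> kr m'; rewrite ler_pdivlMr ?ltr0n //; apply: le_trans (hD r m').
  by rewrite mulrC ler_wpM2r // ler_nat.
have L0 r : 0 <= D * alpha ^+ r / k.+1%:R.
  by apply: divr_ge0 => //; rewrite mulr_ge0 ?exprn_ge0 // ltW.
have K0 : 0 <= A * B by rewrite mulr_ge0 // ltW.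
rewrite -/(s k.+1) E.
have e0 := coef_leM m0 K0 (L0 _) q0 (hL k.+3 (leqW (leqnSn _))) m.
have e1 := coef_leM m1 K0 (L0 _) q1 (hL k.+2 (leqnSn _)) m.
have e2 := coef_leM m2 K0 (L0 _) q2 (hL k.+1 (leqnn _)) m.
move: e0 e1 e2; move: ((3 * j + 3)%:R ^+ 3 : R) => v e0 e1 e2.
rewrite /cf !mcoeffD !rmorphD /= mulrC -ler_pdivlMr ?ltr0n //.
apply: le_trans (ler_normD _ _) _; apply: le_trans (lerD (ler_normD _ _) e2) _.
apply: le_trans (lerD (lerD e0 e1) (lexx _)) _.
rewrite exprD /B; move: (rho ^+ j) (alpha ^+ j.*2) => w y.
rewrite !exprS; move: (alpha ^+ k) (k.+1%:R^-1) => x u.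
by rewrite le_eqVlt; apply/orP; left; apply/eqP; ring.
Qed.
(** To gain the factor 1/i, write i = (i - 2j) + 2j: the first summand is paid for by
    [mixed_poly_kle], the second by the torus bound and the spare powers of j. *)
Lemma mixed_poly_cubic : exists2 C : R, 0 < C & forall i j m, (0 < j)%N -> (j.*2 <= i)%N ->
  `|cf R (mixed_poly i j) m| <= C * (j%:R ^+ 3 * rho ^+ j) * growth i.
Proof.
have [C C0 hC] := mixed_poly_kle.
exists (C * 6 ^+ 3 + 12) => [|i j m j0 ji].
  by rewrite ltr_wpDr // mulr_gt0 // exprn_gt0.
have ir : 0 < i%:R :> R by rewrite ltr0n; move: j0 ji; clear; lia.
have j1 : 1 <= j%:R :> R by rewrite ler1n.
have r0 : 0 <= rho ^+ j * alpha ^+ i.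
  by rewrite mulr_ge0 // exprn_ge0 // ?divr_ge0 // ltW.
have iE : (j.*2 + (i - j.*2))%N = i by rewrite subnKC.
have h1 := hC (i - j.*2)%N j m j0; rewrite iE in h1.
have h2 := cf_mixed_torus (i - j.*2) j m; rewrite iE in h2.
have h1' : (i - j.*2)%:R * `|cf R (mixed_poly i j) m| <= C * 6 ^+ 3 * j%:R ^+ 3 * (rho ^+ j * alpha ^+ i).
  apply: le_trans h1 _; apply: ler_wpM2r => //; rewrite -mulrA ler_pM2l // -exprMn.
  by apply: lerXn2r; rewrite ?nnegrE ?mulr_ge0 // natrD natrM; lra.
have h2' : 2 * j%:R * `|cf R (mixed_poly i j) m| <= 12 * j%:R ^+ 3 * (rho ^+ j * alpha ^+ i).
  have j3 : j%:R <= j%:R ^+ 3 :> R by rewrite -[leLHS]expr1 ler_weXn2l.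
  apply: le_trans (ler_wpM2l _ h2) _; first by rewrite mulr_ge0.
  have := ler_wpM2r r0 j3; move: (rho ^+ j * alpha ^+ i) (j%:R ^+ 3) => y z; lra.
rewrite /growth mulrA ler_pdivlMr // mulrC.
have -> : i%:R = (i - j.*2)%:R + 2 * j%:R :> R by rewrite -natrM -natrD mul2n subnK.
rewrite mulrDl; move: (rho ^+ j) h1' h2' {h1 h2 r0} => r.
move: (_ * `|_|) (2 * j%:R * _) (alpha ^+ i) (j%:R ^+ 3) => x y a z; lra.
Qed.

Lemma cubic_geometric (eps : R) : 0 < eps ->
  exists J : nat, forall j, (J <= j)%N -> j%:R ^+ 3 * rho ^+ j <= eps.
Proof.
move=> e0; have [J JP] := eventually_ge (24 * 50 ^+ 4 / eps).
exists J => j /JP[j0 je].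
have jr : 0 < j%:R :> R by rewrite ltr0n.
have y0 : 0 < j%:R / 50 :> R by rewrite divr_gt0.
have h1 : rho ^+ j <= expR (- (j%:R / 50)).
  have -> : - (j%:R / 50) = j%:R * (- (1 / 50)) :> R by ring.
  rewrite expRM_natl lerXn2r ?nnegrE ?expR_ge0 ?divr_ge0 //.
  by have := expR_ge1Dx (- (1 / 50) : R); lra.
have h2 : (j%:R / 50) ^+ 4 / 24 <= expR (j%:R / 50) :> R.
  by apply: le_trans (expR_ge1Dxn 3 (ltW y0)); rewrite ler_wpDl.
have z0 : 0 < (j%:R / 50) ^+ 4 / 24 :> R by rewrite divr_gt0 ?exprn_gt0.
rewrite -lef_pV2 ?posrE ?expR_gt0 // -expRN in h2.
have h3 := le_trans h1 h2.
apply: le_trans (ler_wpM2l _ h3) _; first by rewrite exprn_ge0.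
have -> : j%:R ^+ 3 * ((j%:R / 50) ^+ 4 / 24)^-1 = (24 * 50 ^+ 4) / j%:R :> R.
  by move: (j%:R : R) (50 : R) jr (ltr0Sn R 49) => y c yp cp; field; rewrite !gt_eqF.
by move: je; rewrite !ler_pdivrMr // [eps * _]mulrC.
Qed.

Lemma mixed_poly_many (eps : R) : 0 < eps -> exists J : nat, forall i j m,
  (J < j)%N -> (j.*2 <= i)%N -> `|cf R (mixed_poly i j) m| <= eps * growth i.
Proof.
move=> e0; have [C C0 hC] := mixed_poly_cubic.
have [J JP] := cubic_geometric (divr_gt0 e0 C0).
exists J => i j m Jj ji; have j0 : (0 < j)%N by apply: leq_ltn_trans Jj.
have i0 : (0 < i)%N by move: j0 ji; clear; lia.
apply: le_trans (hC _ _ m j0 ji) _; apply: ler_wpM2r; first exact/ltW/growth_gt0.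
by rewrite mulrC -ler_pdivlMr // JP // ltnW.
Qed.
End ManyMixed.

(** * The upper bound for the height *)

Section HeightAsymptotics.
Variables (R : realType) (alpha : R).
Hypothesis Halpha : alpha ^+ 3 - alpha ^+ 2 - alpha - 1 = 0.
Local Notation growth := (growth alpha).
Local Notation pk := (peak alpha).
Local Notation mu := (mean_wgt alpha).
Implicit Types (m : 'X_{1..3}).

Let a0 : 0 < alpha := alpha_gt0 Halpha.
Let pk0 : 0 < pk := peak_gt0 Halpha.

Lemma growth_step i : (3 <= i)%N -> 4 / 3 * growth i <= growth i.+1.
Proof.
move=> i3; have al := alpha_lower Halpha.
have i0 : 3 <= i%:R :> R by rewrite ler_nat.
have i00 : 0 < i%:R :> R by lra.
have -> : growth i.+1 = alpha * (i%:R / i.+1%:R) * growth i.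
  rewrite /growth exprS -natr1; move: (alpha ^+ i) (i%:R : R) i00 => x y y0.
  by field; rewrite gt_eqF //=; lra.
rewrite ler_pM2r; last by apply: (growth_gt0 Halpha); exact: leq_trans i3.
rewrite mulrA ler_pdivlMr ?ltr0n // -natr1.
by nra.
Qed.

Lemma growth_mono i n : (3 <= i)%N -> (i <= n)%N -> growth i <= growth n.
Proof.
move=> i3; elim: n => [|n IH]; first by rewrite leqn0 => /eqP->.
rewrite leq_eqVlt ltnS => /orP[/eqP-> //|in_].
apply: le_trans (IH in_) _; apply: le_trans (growth_step (leq_trans i3 in_)).
have g0 : 0 < growth n by apply: (growth_gt0 Halpha); move: i3 in_; clear; lia.
by move: g0; move: (growth n) => g; lra.
Qed.

Lemma growth_lt i n : (3 <= i)%N -> (i < n)%N -> growth i <= 3 / 4 * growth n.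
Proof.
case: n => // n i3; rewrite ltnS => in_.
have h1 := growth_mono i3 in_; have h2 := growth_step (leq_trans i3 in_).
by move: h1 h2; move: (growth n) (growth i) (growth n.+1) => x y z; lra.
Qed.

Lemma growth_unbounded (X : R) : exists n0 : nat, forall n, (n0 <= n)%N -> X <= growth n.
Proof.
have g3 : 0 < growth 3 by apply: growth_gt0.
have [k kP] := eventually_ge (3 * X / growth 3).
have lin j : (1 + j%:R / 3) * growth 3 <= growth (3 + j)%N.
  elim: j => [|j IH]; first by rewrite mul0r addr0 mul1r addn0.
  rewrite addnS; apply: le_trans (growth_step (leq_addr _ _)).
  have j0 : 0 <= j%:R :> R by [].
  apply: le_trans (_ : 4 / 3 * ((1 + j%:R / 3) * growth 3) <= _); last by rewrite ler_pM2l //; lra.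
  by rewrite mulrA ler_pM2r // -natr1; lra.
exists (3 + k)%N => n kn.
have [_ kk] := kP _ (leqnn k).
apply: le_trans (growth_mono (leq_addr k 3) kn); apply: le_trans (lin k).
by move: kk; rewrite ler_pdivrMr // => kk; rewrite mulrDl mul1r; lra.
Qed.

Lemma mixed_poly_le : exists2 theta : R, 0 <= theta < 1 & exists i0 : nat,
  forall i j m, (0 < j)%N -> (j.*2 <= i)%N -> (i0 <= i)%N ->
  `|cf R (mixed_poly i j) m| <= theta * (pk * growth i).
Proof.
have e0 : 0 < pk / 2 by rewrite divr_gt0.
have [J hJ] := mixed_poly_many Halpha e0.
have [u /andP[u0 u1] [i1 h1]] := mixed_poly_few Halpha J.
exists (Num.max u (1 / 2)).
  by rewrite le_max u0 gt_max u1 /=; lra.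
exists (maxn 1 i1) => i j m j0 ji; rewrite geq_max => /andP[i_gt0 ii1].
have p0 : 0 <= pk * growth i by apply/ltW/mulr_gt0 => //; exact: growth_gt0.
case: (leqP j J) => jJ.
  apply: le_trans (h1 _ _ m _ ii1) _; first by rewrite j0.
  by apply: ler_wpM2r => //; rewrite le_max lexx.
apply: le_trans (hJ _ _ m jJ ji) _.
apply: le_trans (_ : 1 / 2 * (pk * growth i) <= _); last first.
  by apply: ler_wpM2r => //; rewrite le_max lexx orbT.
by move: (growth i) pk => g p; lra.
Qed.

(** The asymptotic bounds start at some index; below it a constant suffices, since [growth n] is
    unbounded. *)
Lemma small_index_le (i0 : nat) : exists M : R, forall i m, (i <= i0)%N ->
  ((0 < i)%N -> `|cf R (power_poly i) m| <= M) /\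
  (forall j, (0 < j)%N -> (j.*2 <= i)%N -> `|cf R (mixed_poly i j) m| <= M).
Proof.
have [C C0 bnd] := power_coef_le Halpha.
have al := alpha_lower Halpha.
have a1 : 1 <= alpha by lra.
exists ((C + 6) * alpha ^+ i0) => i m ii.
have ai : alpha ^+ i <= alpha ^+ i0 by rewrite ler_weXn2l.
have ai0 : 0 < alpha ^+ i by rewrite exprn_gt0.
split=> [i_gt0|j j0 ji].
  rewrite cf_power //; case: eqP => [w|_]; last first.
    by rewrite mul0r normr0 mulr_ge0 ?exprn_ge0 ?(ltW a0) //; lra.
  rewrite mul1r ger0_norm ?Tm_ge0 //.
  have := bnd (m 0) (m 1) (m 2); rewrite -/(wt3 m) w => /(_ i_gt0) h.
  have gi : growth i <= alpha ^+ i0.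
    apply: le_trans ai; rewrite /growth ler_pdivrMr ?ltr0n // ler_peMr ?(ltW ai0) //.
    by rewrite ler1n.
  have g0 : 0 < growth i by apply: growth_gt0.
  by apply: le_trans h _; apply: ler_pM => //; rewrite ?ltW //; lra.
have := cf_mixed_torus Halpha (i - j.*2) j m; rewrite subnKC // => h.
apply: le_trans h _.
have rj : (98 / 100 : R) ^+ j <= 1 by apply: exprn_ile1; lra.
have : (98 / 100 : R) ^+ j * alpha ^+ i <= 1 * alpha ^+ i by rewrite ler_wpM2r // ltW.
have : 0 <= C * alpha ^+ i0 by rewrite mulr_ge0 ?exprn_ge0 // ltW.
have -> : (C + 6) * alpha ^+ i0 = C * alpha ^+ i0 + 6 * alpha ^+ i0 by ring.
move: ai; move: (98 / 100 : R) => r; lra.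
Qed.

(** Only p_n competes for the maximum: p_i with i < n loses a factor 3/4, mixed sums lose theta, and
    small indices are bounded. For large n all these are below 1 - 1/(20 n). *)
Lemma cubic_res_height_upper : exists n0 : nat, forall n, (n0 <= n)%N ->
  (cubic_res_height n)%:~R <= growth n * (pk - pk / 20 / n%:R).
Proof.
have [theta /andP[th0 th1] [i1 mixed]] := mixed_poly_le.
have [i2 sharp] := power_poly_le_sharp Halpha.
have [M small] := small_index_le (maxn 3 (maxn i1 i2)).
have [n1 big] := growth_unbounded (2 * `|M| / pk + 2 / pk).
have [n2 n2P] := eventually_ge (1 / (1 - theta)).
exists (maxn (maxn 3 i2) (maxn n1 n2)) => n; rewrite !geq_max.
move=> /andP[/andP[n3 ni2] /andP[nn1 nn2]].
have [n_gt0 nth] := n2P _ nn2; have {nn1}big := big _ nn1.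
have nr : 0 < n%:R :> R by rewrite ltr0n.
have g0 : 0 < growth n by apply: growth_gt0.
set B := growth n * _.
have pg0 : 0 < pk * growth n by apply: mulr_gt0.
have BE : B = (1 - n%:R^-1 / 20) * (pk * growth n) by rewrite /B; move: (growth n) pk (n%:R^-1) => x y z; ring.
have ni : n%:R^-1 <= 1 - theta.
  rewrite -[1 - theta]invrK lef_pV2 ?posrE ?invr_gt0 ?subr_gt0 //.
  by move: nth; rewrite mul1r.
have ni0 : 0 < n%:R^-1 :> R by rewrite invr_gt0.
have ni1 : n%:R^-1 <= 1 :> R by rewrite invf_le1 // ler1n.
have Bth (u : R) : u <= 1 - n%:R^-1 / 20 -> u * (pk * growth n) <= B by rewrite BE ler_pM2r.
have half : 1 / 2 * (pk * growth n) >= `|M| + 1.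
  move: big; rewrite -mulrDl ler_pdivrMr // [growth n * _]mulrC; move: (pk * growth n) => x; lra.
have B1 : `|M| + 1 <= B by apply: le_trans half _; apply: Bth; lra.
have M0 := normr_ge0 M; have MM := ler_norm M.
(* Coefficients are integers, so the real bound B passes to its floor, the integer bound required by
   [cubic_res_height_le]. *)
have key p : (forall m, `|cf R p m| <= B) -> coef_le (Num.floor B) p.
  by move=> h m; rewrite floor_ge_int intr_norm; exact: h.
have up : cubic_res_height n <= Num.floor B.
  apply: cubic_res_height_le => [|i /andP[i_gt0 i_n]|i j j0 /andP[ji i_n]].
  - by rewrite floor_ge_int; lra.
  - apply: key => m; case: (leqP i (maxn 3 (maxn i1 i2))) => [si|].
      by have [/(_ i_gt0) h _] := small i m si; lra.
    rewrite !gtn_max => /and3P[i3 ii1 ii2].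
    move: i_n; rewrite leq_eqVlt => /orP[/eqP ->|i_n]; first exact: sharp.
    apply: le_trans (sharp i m (ltnW ii2)) _.
    have h := growth_lt (ltnW i3) i_n.
    apply: le_trans (_ : growth i * pk <= _).
      apply: ler_wpM2l; first exact/ltW/growth_gt0.
      by rewrite lerBlDr lerDl; apply: divr_ge0 => //; apply: divr_ge0 => //; exact: ltW.
    apply: le_trans (_ : 3 / 4 * (pk * growth n) <= _); last by apply: Bth; lra.
    by rewrite mulrC [leRHS]mulrCA ler_pM2l.
  - apply: key => m; case: (leqP i (maxn 3 (maxn i1 i2))) => [si|].
      by have [_ /(_ j j0 ji) h] := small i m si; lra.
    rewrite !gtn_max => /and3P[i3 ii1 ii2].
    apply: le_trans (mixed i j m j0 ji (ltnW ii1)) _.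
    apply: le_trans (_ : theta * (pk * growth n) <= _); last by apply: Bth; lra.
    by apply: ler_wpM2l => //; rewrite ler_pM2l //; apply: growth_mono => //; exact: ltnW.
by apply: le_trans (floor_le B); rewrite ler_int.
Qed.
End HeightAsymptotics.

(** * The lower bound and the constant beta *)

Section Conclusion.
Variables (R : realType) (alpha : R).
Hypothesis Halpha : alpha ^+ 3 - alpha ^+ 2 - alpha - 1 = 0.
Local Notation growth := (growth alpha).
Local Notation pk := (peak alpha).

Lemma cubic_res_height_lower n : (1000 <= n)%N ->
  pk * growth n * (1 - 150 * 100 / n%:R) <= (cubic_res_height n)%:~R.
Proof.
move=> n1; have [a [b [c [w h]]]] := peak_profile Halpha n1.
have n0 : (0 < n)%N by apply: leq_trans n1.
apply: le_trans h _.
pose m : 'X_{1..3} := [multinom [tuple a; b; c]].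
have [m0 m1 m2] : [/\ m 0 = a, m 1 = b & m 2 = c] by split; rewrite /m multinomE.
have := cubic_res_height_ge n0 m; rewrite -(ler_int R) intr_norm -/(cf R _ m).
rewrite cf_power // /wt3 m0 m1 m2 w eqxx mul1r /Tm m0 m1 m2.
by rewrite ger0_norm ?power_coef_ge0.
Qed.

(** The number 6 + 3 alpha - alpha^2 is a root of the cubic of beta, and mu^2 alpha^3 is twice that
    number modulo the equation of alpha. *)
Lemma peak_beta (beta : R) : beta ^+ 3 - 18 * beta ^+ 2 + 110 * beta - 242 = 0 ->
  beta / pi = pk.
Proof.
move=> hb; have a0 := alpha_gt0 Halpha.
pose b0 := 6 + 3 * alpha - alpha ^+ 2.
have hb0 : b0 ^+ 3 - 18 * b0 ^+ 2 + 110 * b0 - 242 = 0.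
  transitivity ((alpha ^+ 3 - alpha ^+ 2 - alpha - 1) *
    (14 - 20 * alpha + 8 * alpha ^+ 2 - alpha ^+ 3)); first by rewrite /b0; ring.
  by rewrite Halpha mul0r.
have bb0 : beta = b0.
  apply/eqP; rewrite -subr_eq0; apply/eqP.
  (* In y = beta - 6 the cubic is y^3 + 2 y - 14. Its difference quotient [s] is positive, so the
     real root is unique. *)
  pose s := (beta - 6) ^+ 2 + (beta - 6) * (b0 - 6) + (b0 - 6) ^+ 2 + 2.
  have s0 : s != 0.
    have -> : s = ((beta - 6) + (b0 - 6) / 2) ^+ 2 + 3 / 4 * (b0 - 6) ^+ 2 + 2.
      by rewrite /s; field.
    by rewrite gt_eqF // ltr_wpDl // addr_ge0 ?sqr_ge0 // mulr_ge0 ?sqr_ge0 // divr_ge0.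
  apply: (mulIf s0); rewrite mul0r -[RHS](subrr 0) -{1}hb -hb0 /s; ring.
have muE : mean_wgt alpha = (alpha ^+ 2 + 2 * alpha + 3) / alpha ^+ 3.
  by rewrite /mean_wgt /wgt; field; rewrite gt_eqF.
have sq : (alpha ^+ 2 + 2 * alpha + 3) ^+ 2 = 2 * alpha ^+ 3 * b0.
  apply/eqP; rewrite eq_sym -subr_eq0; apply/eqP.
  transitivity ((alpha ^+ 3 - alpha ^+ 2 - alpha - 1) *
    (9 + 3 * alpha - 2 * alpha ^+ 2)); first by rewrite /b0; ring.
  by rewrite Halpha mul0r.
rewrite bb0 /peak muE expr_div_n sq.
move: (b0) (pi : R) (pi_gt0 R) => b p p0.
by field; rewrite !gt_eqF.
Qed.
End Conclusion.

Theorem theorem1p5 (R : realType) (alpha beta : R)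
    (Halpha : alpha ^+ 3 - alpha ^+ 2 - alpha - 1 = 0)
    (Hbeta : beta ^+ 3 - 18 * beta ^+ 2 + 110 * beta - 242 = 0) :
  two_sided_O
    (fun n : nat =>
       beta / (pi * n%:R) * alpha ^+ n - (cubic_res_height n)%:~R)
    (fun n : nat => alpha ^+ n / n%:R ^+ 2).
Proof.
have pk0 := peak_gt0 Halpha.
have [n0 upper] := cubic_res_height_upper Halpha.
(* The two constants are the second-order terms of the upper and of the lower bound for the height,
   respectively. *)
exists (peak alpha / 20), (peak alpha * (150 * 100)), (maxn 1000 n0).
split; [exact: divr_gt0 | by apply: mulr_gt0 => //; apply: mulr_gt0 | by rewrite leq_max |] => n; rewrite gtn_max => /andP[n1 nn0].
have nr : 0 < n%:R :> R by rewrite ltr0n (leq_trans _ n1).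
have up := upper n (ltnW nn0).
have low := cubic_res_height_lower Halpha (ltnW n1).
have -> : beta / (pi * n%:R) * alpha ^+ n = peak alpha * growth alpha n.
  rewrite -(peak_beta Halpha Hbeta) /growth; move: (pi : R) (pi_gt0 R) => p p0.
  by field; rewrite !gt_eqF.
have -> : alpha ^+ n / n%:R ^+ 2 = growth alpha n / n%:R.
  by rewrite /growth; field; rewrite gt_eqF.
move: up low; move: (growth alpha n) (peak alpha) (n%:R^-1) (_%:~R) => g p v h up low.
by apply/andP; split; lra.
Qed.
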